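(* For every $d\in\mathbb{N}$ (with $d\ge 1$) there exists a constant $C_d<\infty$, depending only on $d$, such that the following holds. For all real numbers $a_1,\dots,a_d$ and all positive integers $\alpha_1,\dots,\alpha_d$, let $Q(t)=a_1t^{\alpha_1}+\dots+a_dt^{\alpha_d}$. Then the Hilbert transform along the polynomial curve $(t,Q(t))_{t\in\mathbb{R}}$, $$\mathcal{H}_Qf(x,y)=\mathrm{p.v.}\int_{\mathbb{R}} f(x-t,\,y-Q(t))\,\frac{dt}{t},$$ initially defined for Schwartz functions $f:\mathbb{R}^2\to\mathbb{C}$, extends to a bounded operator on $L^2(\mathbb{R}^2)$ and satisfies $$\|\mathcal{H}_Qf\|_{L^2(\mathbb{R}^2)}\le C_d\,\|f\|_{L^2(\mathbb{R}^2)}\quad\text{for all } f\in L^2(\mathbb{R}^2).$$ In particular $C_d$ does not depend on any of the $a_i$ or $\alpha_i$.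
   Context: For a Schwartz function $f$ on $\mathbb{R}^2$, the principal value integral means $\mathrm{p.v.}\int_{\mathbb{R}} f(x-t,y-Q(t))\frac{dt}{t}=\lim_{\varepsilon\to0^+}\int_{|t|>\varepsilon} f(x-t,y-Q(t))\frac{dt}{t}$. The integral over $|t|>\varepsilon$ converges absolutely by the decay of $f$. *)

(* Defs.v *)
From HB Require Import structures.
From mathcomp Require Import all_boot all_order all_algebra.
From mathcomp Require Import all_classical all_reals all_analysis.
From mathcomp Require Export complex.

Set Implicit Arguments.
Unset Strict Implicit.
Unset Printing Implicit Defensive.

Import Order.TTheory GRing.Theory Num.Theory.
Import numFieldNormedType.Exports.

Local Open Scope classical_set_scope.
Local Open Scope ring_scope.
Local Open Scope complex_scope.

Notation mu2 R := (@lebesgue_measure R \x @lebesgue_measure R)%E.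

(* Complex-valued functions are handled through their real and imaginary
   parts, since the library has no derivative or integral with values in R[i].
   The absolute value of z : R[i], as an element of R, is [Normc.normc z]. *)
Section HilbertTransform.
Context {R : realType}.
Implicit Types f g : R * R -> R[i].

Definition re_part f : R * R -> R := fun p => complex.Re (f p).
Definition im_part f : R * R -> R := fun p => complex.Im (f p).

Definition axis (b : bool) : R * R := if b then (0, 1) else (1, 0).

Definition partial (b : bool) f : R * R -> R[i] :=
  fun p => ('D_(axis b) (re_part f) p) +i* ('D_(axis b) (im_part f) p).

(* Iterated partial derivatives are indexed by words in the two coordinate
   directions, so that no symmetry of mixed derivatives is presupposed. *)
Definition partials (s : seq bool) f : R * R -> R[i] := foldr partial f s.

Definition smooth f : Prop := forall (s : seq bool) (p : R * R),
  differentiable (re_part (partials s f)) p /\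
  differentiable (im_part (partials s f)) p.

Definition schwartz f : Prop :=
  smooth f /\
  forall (j k : nat) (s : seq bool), exists M : R, forall x y : R,
    `|x ^+ j * y ^+ k| * Normc.normc (partials s f (x, y)) <= M.

Definition norm2 f : \bar R := 'N[mu2 R]_2%:E [EFin \o (@Normc.normc R \o f)]%E.

Definition L2 f : Prop :=
  [/\ measurable_fun setT (re_part f), measurable_fun setT (im_part f)
    & (norm2 f < +oo)%E].

(* An operator on the space of classes modulo a.e. equality, presented by its
   action on representatives. *)
Definition L2_operator (T : (R * R -> R[i]) -> (R * R -> R[i])) : Prop :=
  [/\ forall f, L2 f -> L2 (T f),
      forall f g, L2 f -> L2 g -> ae_eq (mu2 R) setT f g ->
        ae_eq (mu2 R) setT (T f) (T g)
    & forall (c : R[i]) f g, L2 f -> L2 g ->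
        ae_eq (mu2 R) setT (T (fun p => c * f p + g p))
                       (fun p => c * T f p + T g p)].

Definition sparse_poly (d : nat) (a : 'I_d -> R) (alpha : 'I_d -> nat) (t : R)
    : R :=
  \sum_(i < d) a i * t ^+ alpha i.

Section Curve.
Variable Q : R -> R.

Definition hilbert_integrand f (x y t : R) : R[i] :=
  f (x - t, y - Q t) / t%:C.

Definition away (e : R) : set R := [set t | e < `|t|].

Definition truncated_re f (x y e : R) : R :=
  \int[lebesgue_measure]_(t in away e) complex.Re (hilbert_integrand f x y t).

Definition truncated_im f (x y e : R) : R :=
  \int[lebesgue_measure]_(t in away e) complex.Im (hilbert_integrand f x y t).

Definition hilbert_defined f (x y : R) : Prop :=
  [/\ forall e, 0 < e ->
        lebesgue_measure.-integrable (away e)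
          (fun t => (complex.Re (hilbert_integrand f x y t))%:E) /\
        lebesgue_measure.-integrable (away e)
          (fun t => (complex.Im (hilbert_integrand f x y t))%:E),
      cvg (truncated_re f x y e @[e --> 0^'+])
    & cvg (truncated_im f x y e @[e --> 0^'+])].

Definition hilbert f : R * R -> R[i] := fun p =>
  lim (truncated_re f p.1 p.2 e @[e --> 0^'+]) +i*
  lim (truncated_im f p.1 p.2 e @[e --> 0^'+]).

End Curve.

End HilbertTransform.

(* Main.v *)
From HB Require Import structures.
Require Import Defs.
From mathcomp Require Import all_boot all_order all_algebra polyrcf.
From mathcomp Require Import all_classical all_reals all_analysis.
From mathcomp Require Import measurable_realfun.
From mathcomp Require Import ring lra zify.

(* On trigonometric polynomials of a large period the transform truncated to
   [a <= |t| <= b] is a Fourier multiplier, whose symbol is an oscillatory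
   integral of [exp(i P(t)) / t] with [P] a sparse polynomial. After
   symmetrization such an integral is bounded by a constant that depends only on
   the number of monomials: where the sum of the moduli of the non-constant
   monomials is at most a constant, the cosines of [P(t)] and [P(- t)] nearly
   cancel; where it is large, [t P'(t)] is at least [1] in modulus outside
   boundedly many intervals of bounded logarithmic length, by Descartes' rule and
   the mean value theorem, and van der Corput's estimate applies. Density of
   trigonometric polynomials on a large square transfers the multiplier bound to
   all truncations on the plane. The truncations to [4^-n <= |t| <= 4^n] of the
   indicator of a box form a Cauchy sequence, with geometrically small dyadic
   shells, so by density they converge in square mean for every square integrable
   function. The limit is the operator; for Schwartz functions the truncations
   also converge pointwise, to the principal value. *)

Set Implicit Arguments.
Unset Strict Implicit.
Unset Printing Implicit Defensive.
Import Order.TTheory GRing.Theory Num.Theory.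
Import numFieldNormedType.Exports.
Local Open Scope classical_set_scope.
Local Open Scope ring_scope.

(** * Sparse polynomials *)

(** The exponents are arbitrary, so neither the degree nor a derivative of fixed order may enter an
    estimate. This is why t P'(t) takes the place of P': its exponents are among those of P, and
    together with dt / t it makes every estimate invariant under dilations of t, so that the
    coefficients drop out as well. Periodic functions replace the Fourier transform of the plane:
    only the orthogonality of finitely many exponentials is used, and since the symbol bound ignores
    coefficients, it is the same for all periods and frequencies. A uniform bound on the truncations
    does not by itself make them converge. Box indicators are a dense class on which the shells can
    be estimated by hand: small shells because few points lie near an edge of the box, large shells
    because t is confined to a set of bounded length. Sizes are integrals of squares throughout, so
    every use of the triangle inequality costs a factor 2; such a loss is harmless except where it
    would be iterated over infinitely many shells. *)

Section Sparse.
Variable R : rcfType.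
Implicit Types (p q h : {poly R}) (s : seq nat) (k : nat).

(** The exponents sit in a list of which only the length is controlled; differentiation and
    multiplication by ['X] merely shift its entries. *)
Definition sparse k p :=
  exists2 s, (size s <= k)%N & forall i, p`_i != 0 -> i \in s.

Lemma sparse0 p : sparse 0 p -> p = 0.
Proof.
move=> [s]; rewrite leqn0 size_eq0 => /eqP -> ps; apply/polyP => i.
by rewrite coef0; apply/eqP/negP => /negP /ps.
Qed.

Lemma sparse_deriv k p : sparse k p -> sparse k p^`().
Proof.
move=> [s sk ps]; exists [seq i.-1 | i <- s]; first by rewrite size_map.
move=> i; rewrite coef_deriv => pi; apply/mapP; exists i.+1 => //.
by apply: ps; apply: contraNneq pi => ->; rewrite mul0rn.
Qed.

Lemma sparse_mulX k p : sparse k p -> sparse k ('X * p).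
Proof.
move=> [s sk ps]; exists [seq i.+1 | i <- s]; first by rewrite size_map.
by case=> [|i]; rewrite coefXM ?eqxx//= => /ps si; apply/mapP; exists i.
Qed.

Lemma sparse_addC k p c : sparse k p -> sparse k.+1 (p + c%:P).
Proof.
move=> [s sk ps]; exists (0%N :: s) => // -[|i] //.
by rewrite coefD coefC addr0 inE => /ps.
Qed.

(* Factoring out the lowest monomial makes the next derivative lose a term. *)
Lemma sparse_reduce k p : sparse k.+1 p ->
  exists m h, p = 'X^m * h /\ sparse k h^`().
Proof.
move=> [s sk ps]; have [p0|p0] := eqVneq p 0.
  exists 0%N, 0; split; first by rewrite mulr0.
  by exists [::] => // i; rewrite linear0 coef0 eqxx.
have exm : exists i, p`_i != 0 by exists (size p).-1; rewrite -lead_coefE lead_coef_eq0.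
case: (ex_minnP exm) => m pm minm; exists m, (drop_poly m p); split.
  apply/polyP => i; rewrite coefXnM coef_drop_poly; case: ltnP => [im|mi].
    by apply/eqP/negPn/negP => /minm; rewrite leqNgt im.
  by rewrite subnK.
(* [m] leaves the list: its coefficient became the constant term of [drop_poly m p], which the
   derivative kills. *)
exists [seq (j - m).-1 | j <- rem m s].
  by rewrite size_map size_rem ?ps// -ltnS (leq_trans _ sk)// prednK ?leqnn// lt0n size_eq0; apply: contraTneq (ps _ pm) => ->.
move=> i; rewrite coef_deriv coef_drop_poly => pi; apply/mapP.
exists (i.+1 + m)%N; last by rewrite addnK.
have: (i.+1 + m)%N \in s by apply: ps; apply: contraNneq pi => ->; rewrite mul0rn.
move=> si; have := perm_to_rem (ps _ pm) => /perm_mem/(_ (i.+1 + m)%N).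
by rewrite si inE; case: eqP => //=; lia.
Qed.

(** Induction on the list, with [u] set to zero at its head; repeated entries and entries outside
    the range of the sum only weaken the bound. *)
Lemma sum_supp (n : nat) s (u : nat -> R) (c : R) : 0 <= c ->
  (forall i, 0 <= u i <= c) -> (forall i, u i != 0 -> i \in s) ->
  \sum_(i < n) u i <= c *+ size s.
Proof.
move=> c0 uc; elim: s u uc => [|j s IH] u uc us.
  by rewrite big1// => i _; apply/eqP/negPn/negP => /us.
pose v i := if i == j then 0 else u i.
have -> : \sum_(i < n) u i = \sum_(i < n) v i + \sum_(i < n | i == j :> nat) u i.
  rewrite [X in _ = _ + X]big_mkcond -big_split/=; apply: eq_bigr => i _; rewrite /v.
  by case: eqP; rewrite ?addr0 ?add0r.
rewrite /= mulrSr lerD//.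
  apply: IH => i; rewrite /v; first by case: eqP; rewrite // lexx c0.
  have [_|ij ui] := eqVneq i j; first by rewrite eqxx.
  by have := us i ui; rewrite inE (negPf ij).
have [jn|nj] := ltnP j n.
  rewrite (big_pred1 (Ordinal jn)) //.
  by have /andP[] := uc j.
rewrite big_pred0// => i; apply/eqP => ij; have := ltn_ord i.
by rewrite ij ltnNge nj.
Qed.

Lemma poly_mvt_weak p (a b : R) : a < b ->
  exists2 c, a <= c <= b & p.[b] - p.[a] = p^`().[c] * (b - a).
Proof.
move=> ab; have [c + ->] := poly_mvt p ab.
by rewrite in_itv/= => /andP[/ltW ac /ltW cb]; exists c => //; rewrite ac.
Qed.

(** One step of [coef_bound]: after reduction a coefficient of positive degree costs a factor [4],
    and the constant coefficient is one value of the polynomial minus at most [k'] such terms. One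
    further multiple lets the same constant serve all degrees. *)
Fixpoint coef_cst k : R :=
  if k is k'.+1 then 1 + 4 * coef_cst k' *+ k'.+1 else 1.

Lemma coef_cst_ge1 k : 1 <= coef_cst k.
Proof.
elim: k => //= k IH; rewrite lerDl mulrn_wge0// mulr_ge0//.
exact: le_trans IH.
Qed.

Lemma coef_cst_ge0 k : 0 <= coef_cst k.
Proof. exact: le_trans ler01 (coef_cst_ge1 k). Qed.

(* The mean value theorem applied to pairs of consecutive points halves the
   number of points and trades the polynomial for one with one term less. *)
Lemma coef_bound k p (t : nat -> R) (M : R) : sparse k p -> 0 <= M ->
  0 < t 0%N -> (forall i, 2 * t i <= t i.+1) ->
  (forall i, (i < 2 ^ k)%N -> `|p.[t i]| <= M) ->
  forall j, `|p`_j| * t 0%N ^+ j <= coef_cst k * M.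
Proof.
elim: k p t M => [|k IH] p t M sp M0 t0 t2 tM j.
  by rewrite (sparse0 sp) coef0 normr0 mul0r mulr_ge0.
have tgt0 i : 0 < t i.
  elim: i => // i; move: (t2 i); lra.
have tnd i : t 0%N <= t i.
  elim: i => // i; move: (t2 i) (tgt0 i); lra.
have [m [h [ph sh]]] := sparse_reduce sp.
pose M' := M / t 0%N ^+ m.
have M'0 : 0 <= M' by rewrite divr_ge0// exprn_ge0// ltW.
have hM i : (i < 2 ^ k.+1)%N -> `|h.[t i]| <= M'.
  move=> /tM; rewrite ph hornerM hornerXn normrM normrX (gtr0_norm (tgt0 i)) => hti.
  rewrite ler_pdivlMr ?exprn_gt0// [leLHS]mulrC; apply: le_trans hti.
  by rewrite ler_wpM2r// lerXn2r// nnegrE ltW.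
(* Mean value points are taken on every other interval. The gaps left between them preserve the
   factor 2: 2 u_i <= 2 t_(2i+1) <= t_(2i+2) <= u_(i+1). *)
have tlt i : t i.*2 < t i.*2.+1 by move: (t2 i.*2) (tgt0 i.*2); lra.
pose u i := s2val (poly_mvt h (tlt i)).
have u1 i : t i.*2 <= u i <= t i.*2.+1.
  by have := s2valP (poly_mvt h (tlt i)); rewrite in_itv/= => /andP[/ltW -> /ltW].
have u2 i : h.[t i.*2.+1] - h.[t i.*2] = h^`().[u i] * (t i.*2.+1 - t i.*2).
  exact: (s2valP' (poly_mvt h (tlt i))).
have hj1 j' : `|h`_j'.+1| * t 0%N ^+ j'.+1 <= 4 * coef_cst k * M'.
  have ut : t 0%N <= u 0%N by have /andP[] := u1 0%N.
  have hb : `|('X * h^`())`_j'.+1| * u 0%N ^+ j'.+1 <= coef_cst k * (4 * M').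
    apply: IH.
    - exact: sparse_mulX.
    - by rewrite mulr_ge0.
    - exact: lt_le_trans ut.
    - move=> i; have /andP[_ a1] := u1 i; have /andP[a2 _] := u1 i.+1.
      by move: (t2 i.*2.+1); rewrite -doubleS; lra.
    - move=> i ik; rewrite hornerM hornerX normrM.
      have /andP[b1 b2] := u1 i.
      have d0 : 0 < t i.*2.+1 - t i.*2 by rewrite subr_gt0.
      have : `|h^`().[u i] * (t i.*2.+1 - t i.*2)| <= 2 * M'.
        rewrite -u2 (le_trans (ler_normB _ _))// mulr2n mulrDl mul1r lerD// hM// expnS; lia.
      rewrite normrM (gtr0_norm d0) => b3.
      rewrite (ger0_norm (le_trans (ltW (tgt0 _)) b1)).
      (* As t_(2i) is at most half of t_(2i+1), the point u_i is at most twice the length of its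
         interval; the increment bound 2 M' thus becomes 4 M' for u h'(u). *)
      have b4 : u i <= 2 * (t i.*2.+1 - t i.*2) by move: (t2 i.*2); lra.
      have b5 := ler_wpM2l (normr_ge0 h^`().[u i]) b4; lra.
  rewrite [4 * _]mulrC -mulrA; apply: le_trans hb.
  rewrite coefXM/= coef_deriv ler_pM ?exprn_ge0 ?normr_ge0 ?(ltW t0)//.
    by rewrite normrMn mulrSr lerDr mulrn_wge0.
  by rewrite lerXn2r// nnegrE ltW// (lt_le_trans t0).
have C0 : 0 <= 4 * coef_cst k * M' by apply: mulr_ge0 => //; apply: mulr_ge0 => //; exact: coef_cst_ge0.
have hj j' : `|h`_j'| * t 0%N ^+ j' <= coef_cst k.+1 * M'.
  case: j' => [|j']; last first.
    apply: le_trans (hj1 j') _; rewrite ler_wpM2r//=.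
    have := coef_cst_ge1 k; rewrite mulrSr => kk.
    have : 0 <= 4 * coef_cst k *+ k by rewrite mulrn_wge0//; lra.
    lra.
  rewrite expr0 mulr1.
  (* The derivative has forgotten the constant coefficient; it is recovered from the value at the
     first point. *)
  have -> : h`_0 = h.[t 0%N] - \sum_(i < (size h)) (if i == 0 :> nat then 0 else h`_i * t 0%N ^+ i).
    rewrite horner_coef; case E : (size h) => [|n].
      by rewrite !big_ord0 subr0 nth_default// E.
    rewrite !big_ord_recl/= expr0 mulr1 add0r.
    by under [X in _ - X]eq_bigr do rewrite /bump/=; rewrite addrK.
  apply: le_trans (ler_normB _ _) _.
  rewrite [leRHS]/= mulrDl mul1r lerD ?hM//; first by rewrite expn_gt0.
  apply: le_trans (ler_norm_sum _ _ _) _.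
  have [s sk hs] := sh.
  apply: le_trans (_ : 4 * coef_cst k * M' *+ size [seq i.+1 | i <- s] <= _).
    apply: (@sum_supp _ _ (fun i => `|if i == 0 :> nat then 0 else h`_i * t 0%N ^+ i|)).
    - exact: C0.
    - case=> [|i]/=; rewrite normr_ge0/= ?normr0//.
      by rewrite normrM normrX (gtr0_norm t0).
    - case=> [|i]/=; first by rewrite normr0 eqxx.
      rewrite normr_eq0 mulf_eq0 negb_or => /andP[hi _].
      by rewrite (mem_map succn_inj) hs// coef_deriv mulrn_eq0 negb_or/=.
  rewrite size_map -mulrnAl ler_wpM2r// ler_wpMn2l ?mulr_ge0 ?coef_cst_ge0//.
  exact: leqW.
rewrite ph coefXnM; case: ltnP => jm.
  by rewrite normr0 mul0r mulr_ge0// coef_cst_ge0.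
rewrite -{2}(subnK jm) exprD mulrA.
by rewrite -ler_pdivlMr ?exprn_gt0// -mulrA hj.
Qed.

(** A binary tree of cuts of depth [n], hence [2 ^ n] pieces, some possibly degenerate. With trees,
    refining a subdivision adds depths, and a subadditive estimate doubles at each level. *)
Fixpoint splits n (S : R -> R -> Prop) a b : Prop :=
  if n is n'.+1 then
    exists z, [/\ a <= z <= b, splits n' S a z & splits n' S z b]
  else S a b.

Lemma splits_sub n (S S' : R -> R -> Prop) a b :
  (forall u v, a <= u -> u <= v -> v <= b -> S u v -> S' u v) ->
  a <= b -> splits n S a b -> splits n S' a b.
Proof.
elim: n a b => [|n IH] a b SS' ab /=; first exact: SS'.
move=> [z [/andP[az zb] s1 s2]]; exists z; split; first by rewrite az.
- by apply: IH s1 => // u v au uv vz; apply: SS' => //; exact: le_trans zb.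
- by apply: IH s2 => // u v au uv vz; apply: SS' => //; exact: le_trans au.
Qed.

Lemma splits_comp n m (S S' : R -> R -> Prop) a b :
  (forall u v, a <= u -> u <= v -> v <= b -> S u v -> splits m S' u v) ->
  a <= b -> splits n S a b -> splits (n + m) S' a b.
Proof.
elim: n a b => [|n IH] a b SS' ab /=; first exact: SS'.
move=> [z [/andP[az zb] s1 s2]]; exists z; split; first by rewrite az.
- by apply: IH s1 => // u v au uv vz; apply: SS' => //; exact: le_trans zb.
- by apply: IH s2 => // u v au uv vz; apply: SS' => //; exact: le_trans au.
Qed.

Definition const_sign p (a b : R) :=
  (forall x, a <= x <= b -> 0 <= p.[x]) \/ (forall x, a <= x <= b -> p.[x] <= 0).

Lemma const_sign_sub p a b u v : a <= u -> v <= b ->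
  const_sign p a b -> const_sign p u v.
Proof.
by move=> au vb [] H; [left|right] => x /andP[ux xv];
  apply: H; rewrite (le_trans au ux) (le_trans xv vb).
Qed.

Lemma monotone_const_sign p a b : a <= b ->
  (forall x y, a <= x -> x <= y -> y <= b -> p.[x] <= p.[y]) ->
  splits 1 (const_sign p) a b.
Proof.
move=> ab mono; have [pa|pa] := lerP 0 p.[a].
  exists a; rewrite lexx ab; split=> //; left => x /andP[ax xb].
    by apply: le_trans (mono _ _ _ ax _) => //; rewrite (le_trans xb).
  exact: le_trans (mono _ _ _ ax _).
have [pb|pb] := lerP p.[b] 0.
  exists a; rewrite lexx ab; split=> //; right => x /andP[ax xb].
    by rewrite (le_trans (mono x b _ _ _)) // (le_trans xb).
  by rewrite (le_trans (mono x b _ _ _)).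
have pab : p.[a] <= 0 <= p.[b] by rewrite !ltW.
have [z /andP[az zb] /rootP pz] := poly_ivt ab pab.
exists z; split; first by rewrite az.
- by right=> x /andP[ax xz]; rewrite -pz mono.
- by left=> x /andP[zx xb]; rewrite -pz mono.
Qed.

Lemma const_signN p a b : const_sign (- p) a b -> const_sign p a b.
Proof.
by case=> H; [right|left] => x /H; rewrite hornerN ?oppr_ge0 ?oppr_le0.
Qed.

Lemma deriv_mono p a b : (forall x, a <= x <= b -> 0 <= p^`().[x]) ->
  forall x y, a <= x -> x <= y -> y <= b -> p.[x] <= p.[y].
Proof.
move=> dp x y ax; rewrite le_eqVlt => /predU1P[->//|xy] yb.
have [c /andP[xc cy] pc] := poly_mvt_weak p xy.
rewrite -subr_ge0 pc mulr_ge0 ?subr_ge0 ?(ltW xy)// dp//.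
by rewrite (le_trans ax xc) (le_trans cy yb).
Qed.

(** The weak form of Descartes' rule that is used below. Write p = x^m h with h' of one term less:
    where h' keeps its sign h is monotone, so one more cut per piece suffices, and x^m is
    nonnegative on positive reals. *)
Lemma sparse_const_sign k p a b : sparse k p -> 0 < a -> a <= b ->
  splits k (const_sign p) a b.
Proof.
elim: k p => [|k IH] p sp a0 ab.
  by rewrite (sparse0 sp); left => x _; rewrite horner0.
have [m [h [ph sh]]] := sparse_reduce sp.
rewrite -addn1; apply: splits_comp ab (IH _ sh a0 ab) => u v au uv vb hs.
apply: (@splits_sub _ (const_sign h)) => //.
  move=> x y ux xy yv [] H; [left|right] => t xty;
  have/andP[xt ty] := xty; rewrite ph hornerM hornerXn.
  - by rewrite mulr_ge0 ?H// exprn_ge0// ltW// (lt_le_trans a0)// (le_trans au)// (le_trans ux).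
  - by rewrite mulr_ge0_le0 ?H// exprn_ge0// ltW// (lt_le_trans a0)// (le_trans au)// (le_trans ux).
case: hs => hs.
  by apply: monotone_const_sign => //; exact: deriv_mono.
apply: (@splits_sub _ (const_sign (- h))) => //.
  by move=> x y _ _ _ /const_signN.
apply: monotone_const_sign => //; apply: deriv_mono => x xuv.
by rewrite derivN hornerN oppr_ge0 hs.
Qed.

End Sparse.

(** * Oscillatory integrals *)

Section Calculus.
Variable R : realType.
Notation leb := (@lebesgue_measure R).
Implicit Types (f g F : R -> R) (a b x : R).

Lemma segment_integrable f a b : (forall x, a <= x <= b -> {for x, continuous f}) ->
  leb.-integrable `[a, b] (EFin \o f).
Proof.
move=> cf; apply: continuous_compact_integrable; first exact: segment_compact.
by apply: continuous_in_subspaceT => x; rewrite inE/= in_itv/= => /cf.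
Qed.

Lemma Rintegral_FTC2 f F a b : a <= b ->
  (forall x, a <= x <= b -> is_derive x 1 F (f x)) ->
  (forall x, a <= x <= b -> {for x, continuous f}) ->
  \int[leb]_(x in `[a, b]) f x = F b - F a.
Proof.
rewrite le_eqVlt => /predU1P[->|ab] dF cf.
  by rewrite set_itv1 Rintegral_set1 subrr.
have cF x : a <= x <= b -> {for x, continuous F}.
  by move=> /dF[dx _]; apply/differentiable_continuous/derivable1_diffP.
rewrite /Rintegral (@continuous_FTC2 _ f F)//.
- by apply: continuous_in_subspaceT => x; rewrite inE/= in_itv/= => /cf.
- split.
  + by move=> x; rewrite in_itv/= => /andP[/ltW ax /ltW xb]; have [] := dF x _; rewrite ?ax.
  + by apply: cvg_at_right_filter; apply: cF; rewrite lexx ltW.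
  + by apply: cvg_at_left_filter; apply: cF; rewrite lexx ltW.
- move=> x; rewrite in_itv/= => /andP[/ltW ax /ltW xb]; rewrite derive1E.
  by have [] := dF x _; rewrite ?ax.
Qed.

Lemma le_Rintegral_segment f g a b :
  (forall x, a <= x <= b -> {for x, continuous f}) ->
  (forall x, a <= x <= b -> {for x, continuous g}) ->
  (forall x, a <= x <= b -> f x <= g x) ->
  \int[leb]_(x in `[a, b]) f x <= \int[leb]_(x in `[a, b]) g x.
Proof.
move=> cf cg fg; by apply: le_Rintegral => //; exact: segment_integrable.
Qed.

Lemma norm_Rintegral_le f g a b :
  (forall x, a <= x <= b -> {for x, continuous f}) ->
  (forall x, a <= x <= b -> {for x, continuous g}) ->
  (forall x, a <= x <= b -> `|f x| <= g x) ->
  `|\int[leb]_(x in `[a, b]) f x| <= \int[leb]_(x in `[a, b]) g x.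
Proof.
move=> cf cg fg; rewrite (le_trans (le_normr_Rintegral _ _))//.
  exact: segment_integrable.
apply: le_Rintegral_segment => // x xab.
by apply: continuous_comp; [exact: cf|exact: norm_continuous].
Qed.

Lemma Rintegral_split f a b c : a <= b <= c ->
  (forall x, a <= x <= c -> {for x, continuous f}) ->
  \int[leb]_(x in `[a, c]) f x =
  \int[leb]_(x in `[a, b]) f x + \int[leb]_(x in `[b, c]) f x.
Proof.
move=> /andP[ab bc] cf; apply/eqP; rewrite addrC -subr_eq; apply/eqP.
rewrite Rintegral_itvB//; last exact: segment_integrable.
rewrite Rintegral_itv_obnd_cbnd//.
apply: integrableS (segment_integrable cf) => //.
by apply: subset_itv; rewrite bnd_simp.
Qed.

End Calculus.

Section Oscillatory.
Variable R : realType.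
Notation leb := (@lebesgue_measure R).
Implicit Types (P : {poly R}) (a b x : R).

(** Cosines are enough: the bounds below ignore the constant term of [P], and subtracting pi / 2
    from [P] turns the cosine into a sine. *)
Definition osc P a b : R := \int[leb]_(t in `[a, b]) (cos P.[t] / t).

Lemma osc_continuous P x : 0 < x -> {for x, continuous (fun t => cos P.[t] / t)}.
Proof.
move=> x0; apply: cvgM.
  by apply: continuous_comp; [exact: continuous_horner|exact: continuous_cos].
by apply: cvgV; [rewrite gt_eqF|exact: cvg_id].
Qed.

Lemma osc_split P a b c : 0 < a -> a <= b <= c -> osc P a c = osc P a b + osc P b c.
Proof.
move=> a0 abc; apply: Rintegral_split => // x /andP[ax _].
by apply: osc_continuous; exact: lt_le_trans ax.
Qed.

Lemma osc_trivial P a b N : 0 < a -> a <= b -> b <= N * a -> `|osc P a b| <= N.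
Proof.
move=> a0 ab bN.
have xge0 x : a <= x <= b -> 0 < x by case/andP => + _; exact: lt_le_trans.
apply: le_trans (_ : \int[leb]_(x in `[a, b]) (a^-1) <= _).
  apply: norm_Rintegral_le => x xab.
  - exact: osc_continuous (xge0 _ xab).
  - exact: cvg_cst.
  - have x0 := xge0 _ xab.
    rewrite normrM normfV (gtr0_norm x0) -[leRHS]mul1r ler_pM ?invr_ge0 ?(ltW x0) ?cos_max//.
    by rewrite lef_pV2 ?posrE//; case/andP: xab.
rewrite Rintegral_cst//= lebesgue_measure_itv/= lte_fin; case: ltP => _ /=; last first.
  by rewrite mulr0 -(@ler_pM2r _ a)// mul0r (le_trans _ bN)// (le_trans _ ab)// ltW.
rewrite mulrC ler_pdivrMr// (le_trans _ bN)// lerBlDr lerDl ltW//.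
Qed.

(** With G(t) = t P'(t) one has P' / G = 1 / t, so this primitive yields the integrand of [osc] and
    a single correction term. The constant [s] does not touch the main term; it is free to fix the
    sign of the correction. *)
Lemma is_derive_osc_aux P x (s : R) : 0 < x -> ('X * P^`()).[x] != 0 ->
  is_derive x 1 (fun t => (sin P.[t] - s) / ('X * P^`()).[t])
   (cos P.[x] / x - (sin P.[x] - s) * ('X * P^`())^`().[x] / ('X * P^`()).[x] ^+ 2).
Proof.
move=> x0; set G := 'X * P^`() => G0.
have dP : is_derive x 1 (fun t => sin P.[t]) (P^`().[x] * cos P.[x]).
  rewrite mulrC; exact: (is_derive1_comp (is_derive_sin _) (is_derive_poly P x)).
have dV : is_derive x 1 (fun t => G.[t]^-1) (- G.[x] ^- 2 *: G^`().[x]).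
  exact: (@is_deriveV R (horner G) x G^`().[x] 1 G0 (is_derive_poly G x)).
have dS : is_derive x 1 (fun t => sin P.[t] - s) (P^`().[x] * cos P.[x] - 0).
  exact: (is_deriveB dP (is_derive_cst s x 1)).
have -> : (fun t => (sin P.[t] - s) / G.[t]) =
  (fun t => sin P.[t] - s) * (fun t => G.[t]^-1) by [].
have dM := is_deriveM dS dV.
apply: (is_derive_eq dM).
rewrite /GRing.scale/= subr0.
have -> : P^`().[x] = G.[x] / x by rewrite /G hornerM hornerX mulrAC mulfV ?mul1r ?gt_eqF.
by field; rewrite G0 gt_eqF.
Qed.

Lemma osc_split_bound n P (S : R -> R -> Prop) a b B : 0 < a -> a <= b ->
  splits n S a b ->
  (forall u v, a <= u -> u <= v -> v <= b -> S u v -> `|osc P u v| <= B) ->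
  `|osc P a b| <= 2 ^+ n * B.
Proof.
elim: n a b => [|n IH] a b a0 ab /=; first by move=> Sab SB; rewrite expr0 mul1r SB.
move=> [z [/andP[az zb] s1 s2]] SB.
rewrite (osc_split _ a0 (_ : a <= z <= b)) ?az//.
rewrite exprS -mulrA mulr2n mulrDl mul1r (le_trans (ler_normD _ _))// lerD//.
- by apply: IH => // u v au uv vz; apply: SB => //; exact: le_trans zb.
- apply: IH => //; first exact: lt_le_trans az.
  by move=> u v au uv vz; apply: SB => //; exact: le_trans au.
Qed.

(** Only the endpoints contribute, each at most 2: the numerator of the primitive is at most 1 + |s|
    and the denominator at least 1. *)
Lemma osc_aux_integral P a b (s : R) (D := fun x => cos P.[x] / x -
    (sin P.[x] - s) * ('X * P^`())^`().[x] / ('X * P^`()).[x] ^+ 2) :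
  0 < a -> a <= b -> `|s| <= 1 -> (forall x, a <= x <= b -> 1 <= ('X * P^`()).[x]) ->
  (forall x, a <= x <= b -> {for x, continuous D}) /\
  `|\int[leb]_(x in `[a, b]) D x| <= 4.
Proof.
set G := 'X * P^`() in D * => a0 ab s1 G1.
have xge0 x : a <= x <= b -> 0 < x by case/andP => + _; exact: lt_le_trans.
have Gn0 x : a <= x <= b -> G.[x] != 0 by move=> /G1; case: eqP => // ->; rewrite ler10.
have cD x : a <= x <= b -> {for x, continuous D}.
  move=> xab; apply: cvgB; first exact: osc_continuous (xge0 _ xab).
  apply: cvgM.
    apply: cvgM; last exact: continuous_horner.
    apply: cvgB; last exact: cvg_cst.
    by apply: continuous_comp; [exact: continuous_horner|exact: continuous_sin].
  apply: cvgV; first by rewrite expf_neq0// Gn0.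
  by apply: (@continuous_comp _ _ _ (horner G) (fun y => y ^+ 2));
    [exact: continuous_horner|exact: exprn_continuous].
split => //.
have dU x (xab : a <= x <= b) := is_derive_osc_aux s (xge0 x xab) (Gn0 x xab).
rewrite (Rintegral_FTC2 ab dU cD).
have U2 x : a <= x <= b -> `|(sin P.[x] - s) / G.[x]| <= 2.
  move=> xab; rewrite normrM normfV ler_pdivrMr ?normr_gt0 ?Gn0//.
  have := G1 _ xab => g1; rewrite (ger0_norm (le_trans ler01 g1)).
  have := ler_normB (sin P.[x]) s; have := sin_max P.[x]; lra.
have := U2 a; have := U2 b; rewrite !lexx ab /= => /(_ isT) h1 /(_ isT) h2.
have := ler_normB ((sin P.[b] - s) / G.[b]) ((sin P.[a] - s) / G.[a]); lra.
Qed.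

(** For [s = 1] and [s = -1] the factor sin P - s has constant sign, opposite in the two cases. As
    the derivative of t P'(t) has constant sign too, one choice of [s] makes the correction
    droppable in the upper bound and the other in the lower bound. *)
Lemma osc_monotone P a b : 0 < a -> a <= b ->
  (forall x, a <= x <= b -> 1 <= ('X * P^`()).[x]) ->
  const_sign ('X * P^`())^`() a b -> `|osc P a b| <= 4.
Proof.
move=> a0 ab G1 sG.
have Gpos x : a <= x <= b -> 0 <= (('X * P^`()).[x] ^+ 2)^-1.
  by move=> _; rewrite invr_ge0 sqr_ge0.
have N1 : `|1 : R| <= 1 by rewrite normr1.
have NN1 : `|-1 : R| <= 1 by rewrite normrN normr1.
have [c1 /ler_normlP[i1 i2]] := osc_aux_integral a0 ab N1 G1.
have [c2 /ler_normlP[i3 i4]] := osc_aux_integral a0 ab NN1 G1.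
have co x : a <= x <= b -> {for x, continuous (fun t => cos P.[t] / t)}.
  by case/andP => ax _; apply: osc_continuous; exact: lt_le_trans ax.
have s1 x : sin P.[x] - 1 <= 0 by rewrite subr_le0 sin_le1.
have s2 x : 0 <= sin P.[x] + 1 by rewrite -lerBlDr sub0r sin_geN1.
rewrite /osc; case: sG => sG; apply/ler_normlP; split.
- rewrite lerNl (le_trans _ (le_Rintegral_segment c2 co _)) 1?lerNl//.
  move=> x xab; rewrite opprK gerBl mulr_ge0 ?Gpos// mulr_ge0 ?sG//.
- rewrite (le_trans (le_Rintegral_segment co c1 _))//.
  move=> x xab; rewrite lerDl oppr_ge0 mulr_le0_ge0 ?Gpos// mulr_le0_ge0 ?sG//.
- rewrite lerNl (le_trans _ (le_Rintegral_segment c1 co _)) 1?lerNl//.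
  move=> x xab; rewrite gerBl mulr_ge0 ?Gpos// mulr_le0 ?sG//.
- rewrite (le_trans (le_Rintegral_segment co c2 _))//.
  move=> x xab; rewrite opprK lerDl oppr_ge0 mulr_le0_ge0 ?Gpos// mulr_ge0_le0 ?sG//.
Qed.

Lemma oscN P a b : osc (- P) a b = osc P a b.
Proof. by apply: eq_Rintegral => x _; rewrite hornerN cosN. Qed.

(** A monotone majorant on positive reals of the oscillation of [P]; the constant term is left out
    because it only shifts the phase. Its size decides between cancellation and oscillation. *)
Definition abs_poly P : {poly R} := \poly_(i < size P) (`|P`_i| *+ (i != 0%N)).

Lemma abs_poly_ge0 P i : 0 <= (abs_poly P)`_i.
Proof. by rewrite coef_poly; case: ifP => // _; rewrite mulrn_wge0. Qed.

Lemma abs_poly_deriv_ge0 P x : 0 <= x -> 0 <= (abs_poly P)^`().[x].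
Proof.
move=> x0; rewrite horner_coef sumr_ge0// => i _.
by rewrite mulr_ge0 ?exprn_ge0// coef_deriv mulrn_wge0// abs_poly_ge0.
Qed.

Lemma abs_poly_mono P x y : 0 <= x -> x <= y -> (abs_poly P).[x] <= (abs_poly P).[y].
Proof.
move=> x0 xy; apply: (@deriv_mono _ _ 0 y) => // z /andP[z0 _].
exact: abs_poly_deriv_ge0.
Qed.

Lemma abs_poly0 P : (abs_poly P).[0] = 0.
Proof. by rewrite horner_coef0 coef_poly eqxx mulr0n; case: ifP. Qed.

(** With G = t P'(t), the exponent counts the cuts for the signs of G - 1, G + 1 and G'. A piece
    contributes at most [4] where |G| >= 1, and at most the ratio [2 ^+ (2 ^ k)] of its endpoints
    where |G| <= 1. *)
Definition osc_cst (k : nat) : R := 2 ^+ (k.+1 + k.+1 + k) * (4 + 2 ^+ (2 ^ k)).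

(* On a piece where ['X * P^`()] has modulus at least [1], van der Corput's
   integration by parts applies; a piece where it is below [1] has a bounded
   ratio of endpoints, for otherwise [coef_bound] makes all coefficients small. *)
Lemma osc_high k P a b : sparse k ('X * P^`()) -> 0 < a -> a <= b ->
  coef_cst R k *+ k < (abs_poly P).[a] -> `|osc P a b| <= osc_cst k.
Proof.
set G := 'X * P^`() => sG a0 ab Ka.
have coefG i : G`_i = P`_i *+ i by rewrite coefXM; case: i => [|i]//=; rewrite coef_deriv.
have sp1 := sparse_const_sign (sparse_addC (-1) sG) a0 ab.
have sp2 u v : a <= u -> u <= v -> splits k.+1 (const_sign (G + 1%:P)) u v.
  by move=> au uv; apply: sparse_const_sign => //; [exact: sparse_addC|exact: lt_le_trans au].
have sp3 u v : a <= u -> u <= v -> splits k (const_sign G^`()) u v.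
  by move=> au uv; apply: sparse_const_sign => //; [exact: sparse_deriv|exact: lt_le_trans au].
pose S1 := const_sign (G + (-1)%:P).
pose S2 u v := S1 u v /\ const_sign (G + 1%:P) u v.
pose S3 u v := S2 u v /\ const_sign G^`() u v.
have spl : splits (k.+1 + k.+1 + k) S3 a b.
  apply: (@splits_comp _ _ _ S2) => //.
    move=> u v au uv vb [h1 h2]; apply: (splits_sub _ uv (sp3 _ _ au uv)) => x y ux xy yv h3.
    by split => //; split; [exact: const_sign_sub h1|exact: const_sign_sub h2].
  apply: (@splits_comp _ _ _ S1) => // u v au uv vb h1.
  apply: (splits_sub _ uv (sp2 _ _ au uv)) => x y ux xy yv h2.
  by split => //; exact: const_sign_sub h1.
apply: (osc_split_bound a0 ab spl) => u v au uv vb [[h1 h2] h3].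
have u0 : 0 < u by exact: lt_le_trans au.
have p2 : (0 : R) <= 2 ^+ (2 ^ k) by rewrite exprn_ge0.
case: h1 => [h1|h1].
  apply: (@le_trans _ _ 4); last by rewrite lerDl.
  apply: osc_monotone => // x /h1; rewrite hornerD hornerC; lra.
(* Where t P'(t) <= -1, [P] is replaced by [- P], the cosine being even. *)
case: h2 => [h2|h2]; last first.
  apply: (@le_trans _ _ 4); last by rewrite lerDl.
  rewrite -oscN; apply: osc_monotone => //.
    by move=> x /h2; rewrite derivN mulrN hornerN hornerD hornerC; lra.
  by apply: const_signN; rewrite derivN mulrN derivN opprK.
have G1 x : u <= x <= v -> `|G.[x]| <= 1.
  by move=> xuv; have := h1 _ xuv; have := h2 _ xuv; rewrite !hornerD !hornerC ler_norml; lra.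
apply: (@le_trans _ _ (2 ^+ (2 ^ k))); last by rewrite lerDr.
(* A longer piece would contain the [2 ^ k] points 2^i u, at all of which |G| <= 1. Then
   [coef_bound] controls |G_j| u^j, hence |P_j| u^j for j >= 1 because G_j = j P_j; the sum over at
   most [k] exponents contradicts the lower bound on [abs_poly P], which is monotone. *)
apply: osc_trivial => //; rewrite leNgt; apply/negP => vu.
move: Ka; rewrite ltNge => /negP; apply.
apply: (le_trans (abs_poly_mono P (ltW a0) au)).
have cb := @coef_bound _ k G (fun i => 2 ^+ i * u) 1 sG.
have {}cb j : `|G`_j| * u ^+ j <= coef_cst R k.
  have := cb _ _ _ _ j; rewrite expr0 mul1r mulr1; apply => //.
    by move=> i; rewrite exprS mulrA.
  move=> i ik; apply: G1; rewrite ler_peMl ?(ltW u0) ?exprn_ege1//; last lra.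
  rewrite (le_trans _ (ltW vu))// ler_wpM2r ?(ltW u0)// ler_weXn2l//; first lra.
  exact: ltnW.
case: (sG) => s sk ss.
rewrite horner_coef; apply: le_trans (_ : coef_cst R k *+ size s <= _); last first.
  by apply: ler_wpMn2l sk; exact: coef_cst_ge0.
apply: (@sum_supp _ _ _ (fun i => (abs_poly P)`_i * u ^+ i)).
- exact: coef_cst_ge0.
- move=> i; rewrite mulr_ge0 ?abs_poly_ge0 ?exprn_ge0 ?(ltW u0)//=.
  apply: le_trans (cb i); rewrite ler_wpM2r ?exprn_ge0 ?(ltW u0)// coefG.
  rewrite coef_poly; case: ifP => // _; rewrite normrMn.
  by case: i => [|i]//=; rewrite mulr1n mulrSr lerDr mulrn_wge0.
- move=> i; rewrite mulf_eq0 negb_or => /andP[+ _]; rewrite coef_poly; case: ifP => [_|]; last by rewrite eqxx.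
  move=> hi; apply: ss; rewrite coefG; case: i hi => [|i]/=; first by rewrite eqxx.
  by rewrite mulr1n normr_eq0 mulrn_eq0.
Qed.

End Oscillatory.

(** * Symmetrized oscillatory integrals *)

Section SymOsc.
Variable R : realType.
Notation leb := (@lebesgue_measure R).
Implicit Types (P : {poly R}) (a b x : R).

Lemma cos_lipschitz (x y : R) : `|cos x - cos y| <= `|x - y|.
Proof.
wlog xy : x y / x <= y.
  move=> H; case/orP: (le_total x y) => [xy|yx]; first exact: H.
  by rewrite -(opprB y x) -(opprB (cos y)) !normrN; exact: H.
move: xy; rewrite le_eqVlt => /predU1P[->|xy]; first by rewrite !subrr.
have [c _ E] := MVT xy (fun t _ => is_derive_cos t) (continuous_subspaceT (@continuous_cos R)).
rewrite distrC E normrM normrN (distrC x) ler_piMl// sin_max//.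
Qed.

(** The integral of cos P(t) / t over a <= |t| <= b, with t and - t folded together. *)
Definition osc_sym P a b : R :=
  \int[leb]_(t in `[a, b]) ((cos P.[t] - cos P.[- t]) / t).

Lemma osc_sym_continuous P x : 0 < x ->
  {for x, continuous (fun t => (cos P.[t] - cos P.[- t]) / t)}.
Proof.
move=> x0; apply: cvgM; last by apply: cvgV; [rewrite gt_eqF|exact: cvg_id].
apply: cvgB.
  by apply: continuous_comp; [exact: continuous_horner|exact: continuous_cos].
apply: (@continuous_comp _ _ _ (fun t => P.[- t])); last exact: continuous_cos.
by apply: continuous_comp; [exact: opp_continuous|exact: continuous_horner].
Qed.

(** Even monomials cancel, and the others gain a harmless factor i >= 1. This factor makes the
    bound, once divided by x, an exact derivative. *)
Lemma horner_odd_bound P x : 0 <= x ->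
  `|P.[x] - P.[- x]| <= 2 * (abs_poly P)^`().[x] * x.
Proof.
move=> x0; have E : 'X * (abs_poly P)^`() = \poly_(i < size P) (`|P`_i| *+ i).
  apply/polyP => -[|i]; rewrite coefXM/=; first by rewrite coef_poly mulr0n if_same.
  by rewrite coef_deriv !coef_poly/=; case: ifP => //; rewrite mul0rn.
have -> : 2 * (abs_poly P)^`().[x] * x = 2 * ('X * (abs_poly P)^`()).[x].
  by rewrite hornerM hornerX; ring.
rewrite E horner_poly !horner_coef mulr_sumr -sumrB (le_trans (ler_norm_sum _ _ _))// ler_sum// => i _.
rewrite -mulrBr normrM -mulr_natr.
case: i => -[|i] ip /=; first by rewrite !expr0 subrr normr0 !mulr0 mul0r mulr0.
rewrite [leRHS](_ : _ = `|P`_i.+1| * (2 * (i.+1%:R * x ^+ i.+1))); last by ring.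
rewrite ler_wpM2l//.
apply: le_trans (ler_normB _ _) _.
rewrite !normrX normrN (ger0_norm x0).
have xi : 0 <= x ^+ i.+1 by rewrite exprn_ge0.
have : 0 <= i%:R * x ^+ i.+1 by rewrite mulr_ge0.
by rewrite -[i.+1%:R]natr1; lra.
Qed.

(** The cosine is 1-Lipschitz, so the integrand is dominated by the derivative of [2 *: abs_poly P],
    whose integral does not see the ratio b / a. *)
Lemma osc_low P a b A : 0 < a -> a <= b -> (abs_poly P).[b] <= A ->
  `|osc_sym P a b| <= 2 * A.
Proof.
move=> a0 ab bA.
have xge0 x : a <= x <= b -> 0 < x by case/andP => + _; exact: lt_le_trans.
have c2 x : a <= x <= b -> {for x, continuous (fun t => (2 *: (abs_poly P)^`()).[t])}.
  by move=> _; exact: continuous_horner.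
have c1 x (xab : a <= x <= b) := osc_sym_continuous (P := P) (xge0 x xab).
apply: (le_trans (norm_Rintegral_le c1 c2 _)).
  move=> x /xge0 x0; rewrite normrM normfV (gtr0_norm x0) ler_pdivrMr// hornerZ.
  by rewrite (le_trans (cos_lipschitz _ _))// horner_odd_bound// ltW.
have dF x (_ : a <= x <= b) : is_derive x 1 (horner (2 *: abs_poly P)) (2 *: (abs_poly P)^`()).[x].
  by rewrite -derivZ; exact: is_derive_poly.
rewrite (Rintegral_FTC2 ab dF c2).
rewrite !hornerZ; have : (0 : R) <= (abs_poly P).[a].
  by rewrite -(abs_poly0 P) abs_poly_mono// ltW.
by lra.
Qed.

Definition reflect_poly P : {poly R} := \poly_(i < size P) ((-1) ^+ i * P`_i).

Lemma horner_reflect P x : (reflect_poly P).[x] = P.[- x].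
Proof.
rewrite horner_poly horner_coef; apply: eq_bigr => i _.
by rewrite [in RHS]exprNn; ring.
Qed.

Lemma coef_reflect P i : (reflect_poly P)`_i = (-1) ^+ i * P`_i.
Proof.
by rewrite coef_poly; case: ltnP => // /(nth_default _) ->; rewrite mulr0.
Qed.

Lemma coef_abs_poly P i : (abs_poly P)`_i = `|P`_i| *+ (i != 0%N).
Proof.
by rewrite coef_poly; case: ltnP => // /(nth_default _) ->; rewrite normr0 mul0rn.
Qed.

Lemma abs_poly_reflect P x : (abs_poly (reflect_poly P)).[x] = (abs_poly P).[x].
Proof.
congr horner; apply/polyP => i; rewrite !coef_abs_poly coef_reflect.
by rewrite normrM normrX normrN1 expr1n mul1r.
Qed.

Lemma sparse_reflect k P : sparse k ('X * P^`()) -> sparse k ('X * (reflect_poly P)^`()).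
Proof.
move=> [s sk sP]; exists s => // -[|i]; rewrite coefXM ?eqxx//= coef_deriv coef_reflect.
move=> h; apply: sP; rewrite coefXM/= coef_deriv; apply: contraNneq h => h.
by rewrite -mulrnAr h mulr0.
Qed.

Lemma osc_symE P a b : 0 < a -> osc_sym P a b = osc P a b - osc (reflect_poly P) a b.
Proof.
move=> a0; rewrite -RintegralB//.
- by apply: eq_Rintegral => x _; rewrite horner_reflect mulrBl.
- by apply: segment_integrable => x /andP[ax _]; apply: osc_continuous; exact: lt_le_trans ax.
- by apply: segment_integrable => x /andP[ax _]; apply: osc_continuous; exact: lt_le_trans ax.
Qed.

Lemma osc_sym_bound k : exists2 B, 0 <= B & forall P a b, sparse k ('X * P^`()) ->
  0 < a -> a <= b -> `|osc_sym P a b| <= B.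
Proof.
(* The [+ 1] leaves room for the strict inequality that [osc_high] asks for. *)
pose A := coef_cst R k *+ k + 1.
have K0 : 0 <= coef_cst R k *+ k by rewrite mulrn_wge0// coef_cst_ge0.
have O0 : 0 <= osc_cst R k by rewrite mulr_ge0 ?exprn_ge0// addr_ge0// exprn_ge0.
pose B1 := 2 * A + 2 * osc_cst R k.
exists (2 * B1); first by rewrite mulr_ge0// addr_ge0// mulr_ge0// addr_ge0.
move=> P a b sP a0 ab.
have piece u v : a <= u -> u <= v -> const_sign (abs_poly P - A%:P) u v ->
    `|osc_sym P u v| <= B1.
  move=> au uv; have u0 : 0 < u by exact: lt_le_trans au.
  case=> H.
  - have : coef_cst R k *+ k < (abs_poly P).[u].
      have := H u; rewrite lexx uv hornerD hornerN hornerC => /(_ isT).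
      by rewrite /A; lra.
    move=> Hu; rewrite osc_symE// (le_trans (ler_normB _ _))//.
    have h1 := osc_high sP u0 uv Hu.
    have h2 := osc_high (sparse_reflect sP) u0 uv.
    move: h2; rewrite abs_poly_reflect => /(_ Hu) h2.
    rewrite /B1 /A; lra.
  - have := H v; rewrite lexx uv hornerD hornerN hornerC => /(_ isT) Hv.
    apply: le_trans (osc_low u0 uv (_ : _ <= A)) _; first by move: Hv; lra.
    by rewrite /B1; lra.
(* By monotonicity a single cut separates the cancelling part from the oscillating one. *)
have [|z [/andP[az zb] s1 s2]] := @monotone_const_sign _ (abs_poly P - A%:P) a b ab.
  move=> x y ax xy yb; rewrite !hornerD !hornerN !hornerC lerB// abs_poly_mono//.
  exact: le_trans (ltW a0) ax.
have -> : osc_sym P a b = osc_sym P a z + osc_sym P z b.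
  apply: Rintegral_split; first by rewrite az.
  by move=> x /andP[ax _]; apply: osc_sym_continuous; exact: lt_le_trans ax.
rewrite (le_trans (ler_normD _ _))//.
have := piece _ _ (lexx a) az s1; have := piece _ _ az zb s2; lra.
Qed.

End SymOsc.

(** * Square integrals *)

Lemma eq_leW d (T : porderType d) (x y : T) : x = y -> (x <= y)%O.
Proof. by move=> ->. Qed.

Section SquareIntegral.
Context d (T : measurableType d) (R : realType) (mu : {measure set T -> \bar R}).
Implicit Types (D : set T) (f g : T -> R).

(** The square of the norm, as an extended real: it makes sense without finiteness, and its triangle
    inequality is [sqintD], with a factor 2. *)
Definition sqint D f : \bar R := (\int[mu]_(p in D) ((f p) ^+ 2)%:E)%E.

Lemma measurable_sq D f : measurable_fun D f ->
  measurable_fun D (fun p => ((f p) ^+ 2)%:E : \bar R).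
Proof. by move=> mf; apply/measurable_EFinP; exact: measurable_funX. Qed.

Lemma sqint_ge0 D f : (0 <= sqint D f)%E.
Proof. by apply: integral_ge0 => x _; rewrite lee_fin sqr_ge0. Qed.

Lemma le_sqint D f g : measurable D -> measurable_fun D f -> measurable_fun D g ->
  (forall x, D x -> `|f x| <= `|g x|) -> (sqint D f <= sqint D g)%E.
Proof.
move=> mD mf mg fg; apply: ge0_le_integral => //.
- by move=> x _; rewrite lee_fin sqr_ge0.
- exact: measurable_sq.
- exact: measurable_sq.
- move=> x Dx; rewrite lee_fin -(real_normK (num_real (f x))) -(real_normK (num_real (g x))).
  by rewrite lerXn2r ?nnegrE// fg.
Qed.

Lemma sqint_subset D E f : measurable D -> measurable E -> D `<=` E ->
  measurable_fun E f -> (sqint D f <= sqint E f)%E.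
Proof.
move=> mD mE DE mf; apply: ge0_subset_integral => //.
- exact: measurable_sq.
- by move=> x _; rewrite lee_fin sqr_ge0.
Qed.

Lemma sqintD D f g : measurable D -> measurable_fun D f -> measurable_fun D g ->
  (sqint D (f \+ g)%R <= 2%:E * sqint D f + 2%:E * sqint D g)%E.
Proof.
move=> mD mf mg; rewrite -!ge0_integralZl//; last 4 first.
- by apply: measurable_sq.
- by move=> x _; rewrite lee_fin sqr_ge0.
- by apply: measurable_sq.
- by move=> x _; rewrite lee_fin sqr_ge0.
rewrite -ge0_integralD//; last 4 first.
- by move=> x _; rewrite lee_fin mulr_ge0// sqr_ge0.
- by apply: measurable_funeM; apply: measurable_sq.
- by move=> x _; rewrite lee_fin mulr_ge0// sqr_ge0.
- by apply: measurable_funeM; apply: measurable_sq.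
apply: ge0_le_integral => //.
- by move=> x _; rewrite lee_fin sqr_ge0.
- by apply: measurable_sq; exact: measurable_funD.
- by apply: emeasurable_funD; apply: measurable_funeM; apply: measurable_sq.
- move=> x _; rewrite -!EFinM -EFinD lee_fin /=.
  by have := sqr_ge0 (f x - g x); nra.
Qed.

Lemma sqintZ D c f : measurable D -> measurable_fun D f ->
  sqint D (fun x => c * f x) = ((c ^+ 2)%:E * sqint D f)%E.
Proof.
move=> mD mf; rewrite -ge0_integralZl//.
- by apply: eq_integral => x _; rewrite exprMn EFinM.
- exact: measurable_sq.
- by move=> x _; rewrite lee_fin sqr_ge0.
- by rewrite lee_fin sqr_ge0.
Qed.

Lemma sqintB D f g : measurable D -> measurable_fun D f -> measurable_fun D g ->
  (sqint D (f \- g)%R <= 2%:E * sqint D f + 2%:E * sqint D g)%E.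
Proof.
move=> mD mf mg; have := sqintD mD mf (measurable_funN mg).
have -> // : sqint D ( \- g)%R = sqint D g.
by apply: eq_integral => x _; rewrite /= sqrrN.
Qed.

Lemma sqintC D f g : sqint D (f \- g)%R = sqint D (g \- f)%R.
Proof. by apply: eq_integral => x _ /=; rewrite -sqrrN opprB. Qed.

Lemma sqint_eq0 f : measurable_fun setT f -> sqint setT f = 0%E ->
  {ae mu, forall x, f x = 0}.
Proof.
move=> mf f0.
have : ae_eq mu setT (fun x => ((f x) ^+ 2)%:E) (cst 0%E).
  apply/ae_eq_integral_abs => //; first exact: measurable_sq.
  rewrite -[RHS]f0; apply: eq_integral => x _.
  by rewrite gee0_abs// lee_fin sqr_ge0.
apply: filterS => x /(_ I)/= [] /eqP; rewrite sqrf_eq0 => /eqP//.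
Qed.

Lemma ae_imp2 (P Q S : T -> Prop) : {ae mu, forall x, P x} -> {ae mu, forall x, Q x} ->
  (forall x, P x -> Q x -> S x) -> {ae mu, forall x, S x}.
Proof. by move=> aP aQ PQS; apply: filterS2 aP aQ. Qed.

Lemma ae_eq_sqint f g : measurable_fun setT f -> measurable_fun setT g ->
  {ae mu, forall x, f x = g x} -> sqint setT f = sqint setT g.
Proof.
move=> mf mg fg; apply: ge0_ae_eq_integral => //.
- exact: measurable_sq.
- exact: measurable_sq.
- by move=> x _; rewrite lee_fin sqr_ge0.
- by move=> x _; rewrite lee_fin sqr_ge0.
- by apply: filterS fg => x -> .
Qed.

Lemma ae_eq_sqint_in D f g : measurable D -> measurable_fun setT f ->
  measurable_fun setT g -> {ae mu, forall x, D x -> f x = g x} -> sqint D f = sqint D g.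
Proof.
move=> mD mf mg fg; apply: ge0_ae_eq_integral => //.
- by apply: measurable_sq; exact: measurable_funTS.
- by apply: measurable_sq; exact: measurable_funTS.
- by move=> x _; rewrite lee_fin sqr_ge0.
- by move=> x _; rewrite lee_fin sqr_ge0.
- by apply: filterS fg => x h Dx; rewrite h.
Qed.

Lemma fatou_bound D (u : nat -> T -> \bar R) (v : T -> \bar R) (c : \bar R) :
  measurable D -> (forall n, measurable_fun D (u n)) ->
  (forall n x, D x -> (0 <= u n x)%E) ->
  (forall x, D x -> u ^~ x @ \oo --> v x) ->
  (\forall n \near \oo, (\int[mu]_(x in D) u n x <= c)%E) ->
  (\int[mu]_(x in D) v x <= c)%E.
Proof.
move=> mD mu_ u0 uv uc.
have -> : (\int[mu]_(x in D) v x = \int[mu]_(x in D) limn_einf (u ^~ x))%E.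
  apply: eq_integral => x; rewrite inE => Dx.
  rewrite is_cvg_limn_einfE; first by apply/esym/cvg_lim => //; exact: uv.
  by apply/cvg_ex; exists (v x); exact: uv.
apply: le_trans (fatou mu mD mu_ u0) _.
rewrite limn_einf_lim; apply: lime_le.
  exact: is_cvg_einfs.
near=> n.
have [m /= _ mc] : \forall n \near \oo, (\int[mu]_(x in D) u n x <= c)%E by [].
apply: le_trans (_ : (\int[mu]_(x in D) u (maxn n m) x <= c)%E).
  by apply: ereal_inf_lbound; exists (maxn n m) => //=; rewrite leq_maxl.
by apply: mc => /=; rewrite leq_maxr.
Unshelve. all: by end_near. Qed.

Definition L2lim (h : nat -> T -> R) g :=
  forall e, 0 < e -> \forall n \near \oo, (sqint setT (h n \- g)%R <= e%:E)%E.

(** Here g = h n - (h n - g) with a negligible second term; the factor 2 of [sqintB] survives in the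
    final constant. *)
Lemma L2lim_sqint_le (h : nat -> T -> R) g c : (0 <= c)%E ->
  measurable_fun setT g -> (forall n, measurable_fun setT (h n)) -> L2lim h g ->
  (\forall n \near \oo, (sqint setT (h n) <= c)%E) -> (sqint setT g <= 2%:E * c)%E.
Proof.
move=> c0 mg mh hg hc.
apply/lee_addgt0Pr => e e0.
have e2 : 0 < e / 2 by rewrite divr_gt0.
near \oo => n.
have -> : sqint setT g = sqint setT (h n \- (h n \- g)%R)%R.
  by apply: eq_integral => x _ /=; rewrite opprB addrC subrK.
apply: le_trans (sqintB measurableT (mh n) (measurable_funB (mh n) mg)) _.
rewrite leeD//; first by rewrite lee_pmul2l//; near: n.
have -> : e%:E = (2%:E * (e / 2)%:E)%E by rewrite -EFinM; congr EFin; field.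
by rewrite lee_pmul2l//; near: n; exact: hg.
Unshelve. all: by end_near. Qed.

(** Fatou's lemma for the squares of f - h n, which tend pointwise to the square of f - g. *)
Lemma L2lim_pointwise_unique (h : nat -> T -> R) f g :
  (forall n, measurable_fun setT (h n)) -> measurable_fun setT f ->
  L2lim h f -> (forall x, h ^~ x @ \oo --> g x) -> {ae mu, forall x, f x = g x}.
Proof.
move=> mh mf hf hg.
have mg : measurable_fun setT g by apply: (measurable_fun_cvg mh) => x _; exact: hg.
suff : {ae mu, forall x, (f \- g)%R x = 0}.
  by apply: filterS => x /eqP; rewrite subr_eq0 => /eqP.
apply: sqint_eq0; first exact: measurable_funB.
apply/eqP; rewrite eq_le sqint_ge0 andbT; apply/lee_addgt0Pr => e e0; rewrite add0e.
apply: (@fatou_bound setT (fun n x => ((f x - h n x) ^+ 2)%:E)) => //.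
- by move=> n; apply: measurable_sq; exact: measurable_funB.
- by move=> n x _; rewrite lee_fin sqr_ge0.
- move=> x _; apply: cvg_EFin; first exact: nearW.
  apply: (@cvg_comp _ _ _ (fun n => f x - h n x) (fun y => y ^+ 2) _ (nbhs (f x - g x))).
    by apply: cvgB; [exact: cvg_cst|exact: hg].
  exact: exprn_continuous.
- by have := hf _ e0; apply: filterS => n; rewrite sqintC.
Qed.

Lemma riesz_fischer (h : nat -> T -> R) : (forall n, measurable_fun setT (h n)) ->
  (forall e, 0 < e -> exists N, forall m n, (N <= m)%N -> (N <= n)%N ->
     (sqint setT (h m \- h n)%R <= e%:E)%E) ->
  exists2 g, measurable_fun setT g & L2lim h g.
Proof.
move=> mh ch.
(* With increments of square integral 16^-k, the sum [S] of their squares weighted by 4^k has a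
   finite integral; where [S] is finite, the k-th increment is at most 2^-k times the root of [S],
   hence summable. *)
pose eps k : R := 16^-1 ^+ k.
have e16 k : 0 < eps k by rewrite exprn_gt0// invr_gt0.
pose N k := projT1 (cid (ch _ (e16 k))).
have NP k m n : (N k <= m)%N -> (N k <= n)%N -> (sqint setT (h m \- h n)%R <= (eps k)%:E)%E.
  exact: projT2 (cid (ch _ (e16 k))) m n.
(* The maximum makes the indices nondecreasing, and the summand [i] forces phi k >= k. *)
pose phi k := \big[maxn/0]_(i < k.+1) (N i + i)%N.
have phiN k : (N k + k <= phi k)%N by exact: (@leq_bigmax_cond _ predT (fun i : 'I_k.+1 => (N i + i)%N) ord_max).
have phiS k : (phi k <= phi k.+1)%N by rewrite /phi [in leqRHS]big_ord_recr/= leq_maxl.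
pose D k := h (phi k.+1) \- h (phi k).
have mD k : measurable_fun setT (D k) by exact: measurable_funB.
have Dk k : (sqint setT (D k) <= (eps k)%:E)%E.
  have a : (N k <= phi k)%N by apply: leq_trans (phiN k); rewrite leq_addr.
  by apply: NP => //; exact: leq_trans (phiS k).
pose S x : \bar R := (\sum_(0 <= k <oo) ((4 ^+ k * D k x ^+ 2)%:E))%E.
have mterm k : measurable_fun setT (fun x => (4 ^+ k * D k x ^+ 2)%:E : \bar R).
  by apply/measurable_EFinP; apply: measurable_funM => //; exact: measurable_funX.
have t0 k x : (0 <= (4 ^+ k * D k x ^+ 2)%:E)%E.
  rewrite lee_fin; apply: mulr_ge0; last exact: sqr_ge0. by apply: exprn_ge0; rewrite ler0n.
have mS : measurable_fun setT S by apply: ge0_emeasurable_sum => [k x *|k _]; [exact: t0|exact: mterm].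
pose q4 : R := 4^-1.
have S0 x : (0 <= S x)%E by apply: nneseries_ge0 => k *; exact: t0.
have IS : (\int[mu]_x S x < +oo)%E.
  rewrite integral_nneseries//.
  apply: le_lt_trans (_ : \sum_(0 <= k <oo) (q4 ^+ k)%:E < +oo)%E.
    apply: lee_nneseries => k _; first by move=> *; apply: integral_ge0 => *; exact: t0.
    under eq_integral do rewrite EFinM.
    rewrite ge0_integralZl//; last first.
    - by move=> x _; rewrite lee_fin sqr_ge0.
    - exact: measurable_sq.
    apply: le_trans (_ : (4 ^+ k)%:E * (eps k)%:E <= _)%E.
      by apply: lee_wpmul2l; rewrite ?lee_fin ?exprn_ge0//; exact: Dk.
    rewrite -EFinM /eps -exprMn lee_fin; apply: eq_leW; congr (_ ^+ _).
    by rewrite /q4; field.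
  have geo : \sum_(0 <= k < n) (q4 ^+ k)%:E @[n --> \oo] --> ((1 - q4)^-1)%:E.
    under eq_fun do rewrite sumEFin.
    apply: cvg_EFin; first exact: nearW.
    have q1 : `|q4| < 1 by rewrite /q4 ger0_norm; lra.
    rewrite (_ : fine \o _ = series (geometric 1 q4)); last first.
      apply/funext => n; rewrite /series/=; apply: eq_bigr => k _; rewrite /geometric/=. by rewrite mul1r.
    by have := @cvg_geometric_series R 1 q4 q1; rewrite mul1r.
  by rewrite (cvg_lim _ geo)// ltry.
have aeS : {ae mu, forall x, S x \is a fin_num}.
  have iS : mu.-integrable setT S.
    apply/integrableP; split => //; apply: le_lt_trans IS.
    apply: eq_leW.
    by apply: eq_integral => x _; rewrite gee0_abs.
  by have := integrable_ae measurableT iS; apply: filterS => x; exact.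
pose E := [set x | S x \is a fin_num].
have mE : measurable E.
  have := emeasurable_fin_num measurableT mS; by rewrite setTI.
(* Killing the sequence off the full-measure set [E] makes it converge everywhere, so that the limit
   is measurable. *)
pose gk k x := h (phi k) x * \1_E x.
have mgk k : measurable_fun setT (gk k).
  by apply: measurable_funM => //; exact: measurable_indic.
have cgk x : cvgn (gk ^~ x).
  have [Sx|NSx] := pselect (E x); last first.
    have -> : gk ^~ x = cst 0 by apply/funext => k; rewrite /gk indicE memNset// mulr0.
    exact: is_cvg_cst.
  have -> : gk ^~ x = (fun k => h (phi k) x).
    by apply/funext => k; rewrite /gk indicE mem_set// mulr1.
  have Dle k : `|D k x| <= Num.sqrt (fine (S x)) * (1/2) ^+ k.
    have : ((4 ^+ k * D k x ^+ 2)%:E <= S x)%E.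
      apply: le_trans (_ : (\sum_(0 <= i < k.+1) (4 ^+ i * D i x ^+ 2)%:E <= S x)%E).
        by rewrite big_nat_recr//= leeDr// sume_ge0// => i _; exact: t0.
      by apply: nneseries_lim_ge => *; exact: t0.
    move=> le0; have le1 : 4 ^+ k * D k x ^+ 2 <= fine (S x) by rewrite -lee_fin fineK.
    have -> : `|D k x| = Num.sqrt (D k x ^+ 2) by rewrite sqrtr_sqr.
    have -> : (1/2 : R) ^+ k = Num.sqrt ((1/4) ^+ k).
      have -> : (1/4 : R) = (1/2) ^+ 2 by field.
      by rewrite -exprM mulnC exprM sqrtr_sqr ger0_norm// exprn_ge0.
    rewrite -sqrtrM ?fine_ge0// ler_wsqrtr//.
    rewrite expr_div_n expr1n mulrA mulr1 ler_pdivlMr ?exprn_gt0//.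
    by rewrite mulrC.
  have -> : (fun k => h (phi k) x) = (fun k => h (phi 0%N) x + series (D ^~ x) k).
    apply/funext => k; rewrite /series/= /D/= telescope_sumr// addrCA subrr addr0//.
  apply: is_cvgD; first exact: is_cvg_cst.
  apply: normed_cvg; apply: (@series_le_cvg _ _ (fun k => Num.sqrt (fine (S x)) * (1/2) ^+ k)).
  - by move=> k; exact: normr_ge0.
  - by move=> k; apply: mulr_ge0; rewrite ?sqrtr_ge0// exprn_ge0// divr_ge0.
  - exact: Dle.
  - apply: (@is_cvg_geometric_series _ (Num.sqrt (fine (S x))) (1/2)).
    by rewrite ger0_norm; lra.
pose g x := limn (gk ^~ x).
have gkg x : gk ^~ x @ \oo --> g x by exact: cgk.
have mg : measurable_fun setT g.
  by apply: (measurable_fun_cvg mgk) => x _; exact: gkg.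
exists g => // e e0.
have [M MP] := ch _ e0.
exists M => // n /= Mn.
apply: (@fatou_bound setT (fun k x => ((h n x - gk k x) ^+ 2)%:E)) => //.
- by move=> k; apply: measurable_sq; exact: measurable_funB.
- by move=> k x _; rewrite lee_fin sqr_ge0.
- move=> x _; apply: cvg_EFin; first exact: nearW.
  apply: (@cvg_comp _ _ _ (fun k => h n x - gk k x) (fun y => y ^+ 2) _ (nbhs (h n x - g x))).
    by apply: cvgB; [exact: cvg_cst|exact: gkg].
  exact: exprn_continuous.
- exists M => // k /= Mk.
  have -> : (\int[mu]_x ((h n x - gk k x) ^+ 2)%:E)%E = sqint setT (h n \- h (phi k))%R.
    apply: ae_eq_sqint; [exact: measurable_funB|exact: measurable_funB|].
    apply: filterS aeS => x Sx /=; rewrite /gk indicE mem_set ?mulr1//.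
  apply: MP => //; apply: leq_trans Mk _.
  by apply: leq_trans (phiN k); rewrite leq_addl.
Qed.

Lemma bounded_integrable D f M : measurable D -> (mu D < +oo)%E ->
  measurable_fun D f -> (forall x, D x -> `|f x| <= M) -> mu.-integrable D (EFin \o f).
Proof.
move=> mD D1 mf fM; apply: measurable_bounded_integrable => //.
exists M; split; first exact: num_real.
by move=> N MN x Dx; rewrite /= (le_trans (fM x Dx))// ltW.
Qed.

Lemma integrable_cst_fin D c : measurable D -> (mu D < +oo)%E ->
  mu.-integrable D (EFin \o cst c).
Proof. by move=> mD D1; apply: (@bounded_integrable _ _ `|c|). Qed.

Lemma sqint_integrable D u : measurable D -> (mu D < +oo)%E ->
  measurable_fun D u -> (sqint D u < +oo)%E -> mu.-integrable D (EFin \o u).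
Proof.
move=> mD D1 mu_ su.
have i1 : mu.-integrable D (EFin \o cst 1) by exact: integrable_cst_fin.
have i2 : mu.-integrable D (EFin \o (fun x => u x ^+ 2)).
  apply/integrableP; split; first exact: measurable_sq.
  by under eq_integral do rewrite gee0_abs ?lee_fin ?sqr_ge0//.
apply: le_integrable (integrableD mD i1 i2) => //; first exact/measurable_EFinP.
move=> x Dx /=; rewrite lee_fin.
by rewrite [leRHS]ger0_norm ?addr_ge0 ?sqr_ge0// -(real_normK (num_real (u x))); nra.
Qed.

(** The integral of (u - c)^2 is nonnegative, with c the mean of u over D. *)
Lemma cauchy_schwarz_Rintegral D u : measurable D -> (mu D < +oo)%E ->
  measurable_fun D u ->
  (((\int[mu]_(x in D) u x) ^+ 2)%:E <= mu D * sqint D u)%E.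
Proof.
move=> mD D1 mu_.
have [D0|D0] := eqVneq (mu D) 0%E.
  rewrite /Rintegral null_set_integral//; last exact/measurable_EFinP.
  by rewrite /= expr0n/= D0 mul0e.
have Dgt0 : (0 < mu D)%E by rewrite lt0e D0 measure_ge0.
have [su|] := ltP (sqint D u) +oo%E; last first.
  by rewrite leye_eq => /eqP ->; rewrite gt0_muley// leey.
have iu := sqint_integrable mD D1 mu_ su.
have i2 : mu.-integrable D (EFin \o (fun x => u x ^+ 2)).
  apply/integrableP; split; first exact: measurable_sq.
  by under eq_integral do rewrite gee0_abs ?lee_fin ?sqr_ge0//.
have Df : mu D \is a fin_num by rewrite ge0_fin_numE.
set m := fine (mu D); have m0 : 0 < m by rewrite fine_gt0// Dgt0.
set I := Rintegral _ _ _; pose c := I / m.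
have ic : mu.-integrable D (EFin \o cst (c ^+ 2)) by exact: integrable_cst_fin.
have icu : mu.-integrable D (EFin \o (fun x => 2 * c * u x)).
  exact: (integrableZl mD (2 * c) iu).
have Su : sqint D u = (\int[mu]_(x in D) (u x ^+ 2))%:E.
  by rewrite /Rintegral fineK//; exact: integrable_fin_num.
have : 0 <= \int[mu]_(x in D) ((u x - c) ^+ 2).
  by apply: Rintegral_ge0 => x _; exact: sqr_ge0.
have -> : \int[mu]_(x in D) ((u x - c) ^+ 2) =
    \int[mu]_(x in D) (u x ^+ 2 - 2 * c * u x + c ^+ 2).
  by apply: eq_Rintegral => x _; ring.
have iB : mu.-integrable D (EFin \o (fun x => u x ^+ 2 - 2 * c * u x)).
  exact: (integrableB mD i2 icu).
rewrite RintegralD//.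
rewrite RintegralB// RintegralZl// Rintegral_cst// -/I -/m => h.
rewrite Su -(fineK Df) -EFinM lee_fin -/m.
set S := Rintegral _ _ _ in h *.
have -> : I = c * m by rewrite /c mulfVK// gt_eqF.
have hI : I = c * m by rewrite /c mulfVK// gt_eqF.
by rewrite hI in h; nra.
Qed.

Lemma dominated_L2lim_ae (u : nat -> T -> R) f g :
  (forall n, measurable_fun setT (u n)) -> measurable_fun setT f ->
  measurable_fun setT g -> (sqint setT g < +oo)%E ->
  {ae mu, forall x, u ^~ x @ \oo --> f x} ->
  (forall n x, `|u n x| <= g x) -> (forall x, `|f x| <= g x) ->
  L2lim u f.
Proof.
move=> mu_ mf mg sg uf ug fg.
have ig : mu.-integrable setT (EFin \o (fun x => 4 * g x ^+ 2)).
  have i2 : mu.-integrable setT (EFin \o (fun x => g x ^+ 2)).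
    apply/integrableP; split; first exact: measurable_sq.
    by under eq_integral do rewrite gee0_abs ?lee_fin ?sqr_ge0//.
  exact: (integrableZl measurableT 4 i2).
have mdiff n : measurable_fun setT (fun x => ((u n x - f x) ^+ 2)%:E : \bar R).
  by apply: measurable_sq; exact: measurable_funB.
have dom n x : (`|((u n x - f x) ^+ 2)%:E| <= (4 * g x ^+ 2)%:E)%E.
  rewrite gee0_abs ?lee_fin ?sqr_ge0//.
  have h : `|u n x - f x| <= 2 * g x.
    by rewrite (le_trans (ler_normB _ _))//; have := ug n x; have := fg x; lra.
  rewrite -(real_normK (num_real (u n x - f x))); have := normr_ge0 (u n x - f x); nra.
have cv0 x : u ^~ x @ \oo --> f x -> ((u n x - f x) ^+ 2)%:E @[n --> \oo] --> (0 : \bar R)%E.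
  move=> ufx.
  apply: cvg_EFin; first exact: nearW.
  apply: (@cvg_comp _ _ _ (fun n => u n x - f x) (fun y => y ^+ 2) _ (nbhs (f x - f x))).
    by apply: cvgB; [exact: ufx|exact: cvg_cst].
  rewrite subrr; have := @exprn_continuous R 2 0; rewrite /continuous_at expr0n/=.
  exact.
have c1 : {ae mu, forall x, setT x ->
    ((u n x - f x) ^+ 2)%:E @[n --> \oo] --> cst (0 : \bar R)%E x}.
  by apply: filterS uf => x /cv0.
have c2 : {ae mu, forall x n, setT x ->
    (`|((u n x - f x) ^+ 2)%:E| <= (4 * g x ^+ 2)%:E)%E}.
  by apply: aeW => x n _; exact: dom.
have [_ _] := dominated_convergence measurableT mdiff (measurable_cst _) c1 ig c2.
rewrite integral0 => cv e e0.
have H : nbhs (0%E : \bar R) [set x | (x <= e%:E)%E].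
  exists e => //= r; rewrite /ball/= add0r normrN lee_fin => /ltW.
  exact/le_trans/ler_norm.
have := cv _ H; exact.
Qed.

Lemma dominated_L2lim (u : nat -> T -> R) f g :
  (forall n, measurable_fun setT (u n)) -> measurable_fun setT f ->
  measurable_fun setT g -> (sqint setT g < +oo)%E ->
  (forall x, u ^~ x @ \oo --> f x) -> (forall n x, `|u n x| <= g x) ->
  L2lim u f.
Proof.
move=> mu_ mf mg sg uf ug.
apply: (dominated_L2lim_ae mu_ mf mg sg (aeW _ uf) ug) => x; apply: (@closed_cvg _ _ \oo _ (fun n => `|u n x|) [set y | y <= g x]).
- exact: closed_le.
- by apply: nearW => n; exact: ug.
- by apply: cvg_norm; exact: uf.
Qed.

End SquareIntegral.

(** * Density of box indicators *)

Section Density.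
Import HBNNSimple.
Variable R : realType.
Notation leb := (@lebesgue_measure R).
Notation mu := (mu2 R).
Implicit Types f g : R * R -> R.

Definition L2r f := measurable_fun setT f /\ (sqint mu setT f < +oo)%E.

(** Half-open sides: such boxes are stable under intersection, and a degenerate one is empty. *)
Definition box (a b c d : R) : set (R * R) := `]a, b]%classic `*` `]c, d]%classic.

Lemma measurable_box a b c d : measurable (box a b c d).
Proof. exact: measurableX. Qed.

Lemma box_lty a b c d : (mu (box a b c d) < +oo)%E.
Proof.
rewrite product_measure1E//= lte_mul_pinfty//=.
  by rewrite lebesgue_measure_itv/= ; case: ifP; rewrite // -EFinD.
by rewrite lebesgue_measure_itv/= ; case: ifP; rewrite // -?EFinD ltry.
Qed.

Lemma sqint_indic D (A : set (R * R)) : measurable D -> measurable A ->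
  sqint mu D (\1_A : R * R -> R) = mu (D `&` A).
Proof.
move=> mD mA; rewrite setIC -(integral_indic mu mD mA).
by apply: eq_integral => x _; rewrite indicE; case: (x \in A); rewrite ?expr1n ?expr0n.
Qed.

Lemma L2r_indic (A : set (R * R)) : measurable A -> (mu A < +oo)%E ->
  L2r (\1_A : R * R -> R).
Proof.
by move=> mA A1; split; [exact: measurable_indic|rewrite sqint_indic// setTI].
Qed.

Lemma L2r_lin c f g : L2r f -> L2r g -> L2r (fun p => c * f p + g p).
Proof.
move=> [mf sf] [mg sg]; have mcf : measurable_fun setT (fun p => c * f p).
  exact: measurable_funM.
split; first exact: measurable_funD.
apply: le_lt_trans (sqintD mu measurableT mcf mg) _.
rewrite sqintZ//; apply: lte_add_pinfty; rewrite lte_mul_pinfty//.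
by rewrite lte_mul_pinfty// ?lee_fin ?sqr_ge0.
Qed.

Section Principle.
Variable P : (R * R -> R) -> Prop.
Hypothesis Pbox : forall a b c d, P \1_(box a b c d).
Hypothesis Plin : forall c f g, P f -> P g -> P (fun p => c * f p + g p).
Hypothesis Plim : forall f, L2r f ->
  (forall e, 0 < e -> exists g, [/\ L2r g, P g & (sqint mu setT (g \- f)%R <= e%:E)%E]) ->
  P f.

Let P0 : P (fun=> 0).
Proof.
have := Pbox 0 0 0 0; congr P; apply/funext => x.
by rewrite /box set_itvoc0 set0X indic0.
Qed.

Let PZ c f : P f -> P (fun p => c * f p).
Proof. by move=> Pf; have := Plin c Pf P0; congr P; apply/funext => x; rewrite addr0. Qed.

Let Psum n (u : nat -> R * R -> R) : (forall i, P (u i)) -> P (fun p => \sum_(i < n) u i p).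
Proof.
move=> Pu; elim: n => [|n IH]; first by have := P0; congr P; apply/funext => x; rewrite big_ord0.
have := Plin 1 (Pu n) IH; congr P; apply/funext => x.
by rewrite big_ord_recr/= mul1r addrC.
Qed.

Let Plim_seq (u : nat -> R * R -> R) f : (forall n, P (u n)) -> (forall n, L2r (u n)) ->
  L2r f -> L2lim mu u f -> P f.
Proof.
move=> Pu Lu Lf uf; apply: Plim => // e e0.
have [n _ /(_ n (leqnn n)) un] := uf _ e0.
by exists (u n).
Qed.

(** Pi-lambda induction inside a window [W] of finite measure: the complement within [W] is a linear
    combination, and a disjoint union is a square-mean limit dominated by the indicator of [W]. It
    is run on the first coordinate, then on the second, then on the plane with measurable rectangles
    as generators. *)
Let dynkin d (U : measurableType d) (h : R * R -> U) (W : set (R * R)) (G : set (set U)) :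
  measurable_fun setT h -> measurable W -> (mu W < +oo)%E -> P \1_W ->
  @measurable _ U = <<s G >> -> setI_closed G ->
  (forall S, G S -> P \1_(h @^-1` S `&` W)) ->
  forall S, measurable S -> P \1_(h @^-1` S `&` W).
Proof.
move=> mh mW W1 PW GE GI PG S mS.
have mhS S' : measurable S' -> measurable (h @^-1` S').
  by move=> mS'; rewrite -[X in measurable X]setTI; exact: mh.
have hW A : measurable A -> (mu (A `&` W) < +oo)%E.
  move=> mA; apply: le_lt_trans W1; apply: le_measure; rewrite ?inE//.
  exact: measurableI.
apply: (@dynkin_induction _ U G [set S | P \1_(h @^-1` S `&` W)]) => //; last 1 first.
- by rewrite -GE.
- by rewrite /= preimage_setT setTI.
- move=> A mA /= PA; have := Plin (-1) PA PW; congr P; apply/funext => x.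
  rewrite !indicI/= !indicE preimage_setC in_setC.
  by case: (x \in W); case: (x \in _); rewrite /= ?mulr1 ?mulr0 ?mul1r ?addr0 ?addNr ?add0r.
- move=> F mF tF /= PF.
  pose u n p := \sum_(i < n) (\1_(h @^-1` F i `&` W) p : R).
  have mF' n : measurable (\big[setU/set0]_(i < n) (h @^-1` F i `&` W)).
    by apply: bigsetU_measurable => i _; apply: measurableI => //; exact: mhS.
  have uE n : u n = \1_(\big[setU/set0]_(i < n) (h @^-1` F i `&` W)).
    rewrite /u; elim: n => [|n IH].
      by rewrite big_ord0 indic0; apply/funext => x; rewrite big_ord0.
    apply/funext => x; rewrite !big_ord_recr/=.
    have -> : \sum_(i < n) (\1_(h @^-1` F i `&` W) x : R) =
      \1_(\big[setU/set0]_(i < n) (h @^-1` F i `&` W)) x by rewrite -IH.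
    rewrite !indicE in_setU; have [/set_mem[Fn Wx]|_] := boolP (x \in h @^-1` F n `&` W).
      rewrite memNset ?orbT ?add0r//.
      rewrite -(bigcup_mkord n (fun i => h @^-1` F i `&` W)) => -[k/= kn [Fk _]].
      have kn' : k = n by apply: tF => //; exists (h x).
      by rewrite kn' ltnn in kn.
    by rewrite addr0 orbF.
  have mU : measurable (h @^-1` (\bigcup_k F k) `&` W).
    by apply: measurableI => //; apply: mhS; exact: bigcup_measurable.
  have sub n : \big[setU/set0]_(i < n) (h @^-1` F i `&` W) `<=`
      h @^-1` (\bigcup_k F k) `&` W.
    by move=> x; rewrite -(bigcup_mkord n (fun i => h @^-1` F i `&` W)) => -[k kn [Fx Wx]]; split => //; exists k.
  apply: (@Plim_seq u).
  + by move=> n; exact: (Psum _ PF).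
  + move=> n; rewrite uE; apply: L2r_indic => //.
    apply: le_lt_trans W1; apply: le_measure; rewrite ?inE//.
    - exact: mF'.
    - by move=> x Ux; have [] := sub n x Ux.
  + by apply: L2r_indic => //; apply: hW; apply: mhS; exact: bigcup_measurable.
  + have mu_ n : measurable_fun setT (u n) by rewrite uE; exact: measurable_indic.
    have := @dominated_L2lim _ _ _ mu u (\1_(h @^-1` (\bigcup_k F k) `&` W)) (\1_W). apply => //.
    * by rewrite sqint_indic// setTI.
    * move=> x; apply: cvg_near_cst; have [[[k _ Fx] Wx]|Nx] := pselect ((h @^-1` (\bigcup_k F k) `&` W) x).
        exists k.+1 => // n /= kn; rewrite uE !indicE !mem_set//.
          by split => //; exists k.
        by rewrite -(bigcup_mkord n (fun i => h @^-1` F i `&` W)); exists k.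
      by apply: nearW => n; rewrite uE !indicE !memNset// => /(sub n x).
    * move=> n x; rewrite uE !indicE ger0_norm// ler_nat.
      have [/set_mem /(sub n x)[_ Wx]|//] := boolP (_ \in _).
      by rewrite mem_set.
Qed.

Let Pfst a b c d (A : set R) : measurable A -> P \1_(fst @^-1` A `&` box a b c d).
Proof.
move=> mA; apply: (@dynkin _ R fst (box a b c d) (@ocitv R)) => //.
- exact: measurable_box.
- exact: box_lty.
- exact: ocitvI.
- move=> S oS; have [[a' b'] _ /= E] := ocitvI oS (is_ocitv a b).
  rewrite (_ : fst @^-1` S `&` _ = box a' b' c d); first exact: Pbox.
  apply/seteqP; rewrite /box E; split => -[x y]/=; tauto.
Qed.

Let Psnd a b c d (A B : set R) : measurable A -> measurable B ->
  P \1_(snd @^-1` B `&` (fst @^-1` A `&` box a b c d)).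
Proof.
move=> mA mB.
have mW : measurable (fst @^-1` A `&` box a b c d).
  by apply: measurableI; [rewrite -[X in measurable X]setTI; exact: measurable_fst|exact: measurable_box].
apply: (@dynkin _ R snd (fst @^-1` A `&` box a b c d) (@ocitv R)) => //.
- apply: le_lt_trans (box_lty a b c d); apply: le_measure; rewrite ?inE//; exact: measurable_box.
- exact: Pfst.
- exact: ocitvI.
- move=> S oS; have [[c' d'] _ /= E] := ocitvI oS (is_ocitv c d).
  rewrite (_ : snd @^-1` S `&` _ = fst @^-1` A `&` box a b c' d'); first exact: Pfst.
  apply/seteqP; rewrite /box E; split => -[x y]/=; tauto.
Qed.

Let Pmeas a b c d (A : set (R * R)) : measurable A -> P \1_(A `&` box a b c d).
Proof.
move=> mA; apply: (@dynkin _ _ id (box a b c d)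
    [set A `*` B | A in @measurable _ R & B in @measurable _ R]) => //.
- exact: measurable_box.
- exact: box_lty.
- exact: measurable_prod_measurableType.
- move=> _ _ [A1 mA1 [B1 mB1 <-]] [A2 mA2 [B2 mB2 <-]].
  exists (A1 `&` A2); first exact: measurableI.
  by exists (B1 `&` B2); [exact: measurableI|rewrite setXI].
- move=> _ [A1 mA1 [B1 mB1 <-]].
  rewrite (_ : _ `&` _ = snd @^-1` B1 `&` (fst @^-1` A1 `&` box a b c d)); first exact: Psnd.
  by apply/seteqP; split => -[x y]/=; tauto.
Qed.

(** Simple functions increasing to [f] are cut off to growing squares, which leaves combinations of
    indicators of bounded measurable sets. *)
Let Pge0 f : (forall x, 0 <= f x) -> L2r f -> P f.
Proof.
move=> f0 Lf; have [mf sf] := Lf.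
have mEf : measurable_fun setT (EFin \o f) by exact/measurable_EFinP.
have Ef0 x : setT x -> (0 <= (EFin \o f) x)%E by move=> _; rewrite lee_fin.
pose s n : {nnsfun (R * R) >-> R} := nnsfun_approx measurableT mEf n.
pose W n : set (R * R) := box (- n%:R) n%:R (- n%:R) n%:R.
pose u n x := s n x * \1_(W n) x.
have sle n x : s n x <= f x.
  by rewrite -lee_fin nnsfun_approxE; exact: (le_approx n Ef0).
have s0 n x : 0 <= s n x by exact: fun_ge0.
have mu_ n : measurable_fun setT (u n).
  by apply: measurable_funM => //; apply: measurable_indic; exact: measurable_box.
have uf n x : `|u n x| <= f x.
  rewrite /u indicE; case: (x \in _); rewrite ?mulr1 ?mulr0 ?normr0//.
  by rewrite ger0_norm.
have Lu n : L2r (u n).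
  split => //; apply: le_lt_trans sf; apply: (le_sqint mu measurableT (mu_ n) mf) => x _.
  by rewrite (ger0_norm (f0 x)).
apply: (@Plim_seq u) => //.
- move=> n; pose S : seq R := finmap.enum_fset (fset_set (s n @` setT)).
  rewrite (_ : u n = fun p => \sum_(i < size S) S`_i * \1_(s n @^-1` [set S`_i] `&` W n) p).
    apply: (@Psum (size S) (fun i p => S`_i * \1_(s n @^-1` [set S`_i] `&` W n) p)) => i.
    by apply: (@PZ S`_i \1_(s n @^-1` [set S`_i] `&` W n)); exact: Pmeas.
  apply/funext => x; under eq_bigr => i _ do rewrite indicI /= mulrA.
  by rewrite -mulr_suml -(fimfunEord (s n)).
- apply: (@dominated_L2lim _ _ _ mu u f f) => //.
  move=> x; have cs : s ^~ x @ \oo --> f x.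
    have h : (EFin \o s ^~ x) @ \oo --> (f x)%:E.
      by have := cvg_nnsfun_approx measurableT mEf Ef0 I.
    exact: (fine_cvg h).
  rewrite -[f x]mulr1; apply: cvgM => //.
  apply: cvg_near_cst; near=> n.
  rewrite indicE mem_set// /W /box /=.
  have h1 : `|x.1| < n%:R by near: n; exact: nbhs_infty_gtr.
  have h2 : `|x.2| < n%:R by near: n; exact: nbhs_infty_gtr.
  by move: h1 h2; rewrite !ltr_norml !in_itv/= => /andP[-> /ltW ->] /andP[-> /ltW ->].
Unshelve. all: by end_near. Qed.

(** Density stated as an induction principle, closed by splitting [f] into its positive and negative
    parts. In its uses [P] contains [L2r] as a conjunct, which makes square integrability available
    in the linear step. *)
Lemma L2_ind f : L2r f -> P f.
Proof.
move=> [mf sf].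
have mp g : measurable_fun setT g -> (sqint mu setT g < +oo)%E -> P (fun x => Num.max (g x) 0).
  move=> mg sg; apply: Pge0; first by move=> x; rewrite le_max lexx orbT.
  split; first exact: measurable_maxr.
  apply: le_lt_trans sg; apply: (le_sqint mu measurableT _ mg); first exact: measurable_maxr.
  by move=> x _; rewrite ger0_norm ?le_max ?lexx ?orbT// ge_max ler_norm normr_ge0.
have mN : measurable_fun setT (\- f) by exact: measurable_funN.
have sN : (sqint mu setT (\- f)%R < +oo)%E.
  by have -> : sqint mu setT (\- f)%R = sqint mu setT f by apply: eq_integral => x _; rewrite /= sqrrN.
have := Plin (-1) (mp _ mN sN) (mp _ mf sf); congr P; apply/funext => x /=.
rewrite mulN1r; case: (leP 0 (f x)) => fx.
  by rewrite (max_idPr _) ?oppr0 ?add0r// oppr_le0.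
by rewrite (max_idPl _) ?opprK ?addr0// oppr_ge0 ltW.
Qed.

End Principle.
End Density.

(** * Parametric integrals and translations *)

Section ParametricIntegral.
Context d1 d2 (T1 : measurableType d1) (T2 : measurableType d2) (R : realType).
Variable m1 : {sigma_finite_measure set T1 -> \bar R}.
Variable m2 : {sigma_finite_measure set T2 -> \bar R}.
Variables (D : set T2) (mD : measurable D).

(** The inner domain becomes a factor, so that Tonelli's theorem on the whole product applies. *)
Let ind (h : T1 * T2 -> \bar R) (z : T1 * T2) : \bar R := (h z * (\1_D z.2)%:E)%E.

Let measurable_ind h : measurable_fun setT h -> measurable_fun setT (ind h).
Proof.
move=> mh; apply: emeasurable_funM => //; apply/measurable_EFinP.
by apply: measurableT_comp => //; exact: measurable_indic.
Qed.

Let integral_ind h x : (\int[m2]_(t in D) h (x, t) = \int[m2]_t ind h (x, t))%E.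
Proof. by rewrite integral_mkcond epatch_indic. Qed.

Lemma measurable_integral_param (h : T1 * T2 -> \bar R) : measurable_fun setT h ->
  (forall z, 0 <= h z)%E -> measurable_fun setT (fun x => \int[m2]_(t in D) h (x, t))%E.
Proof.
move=> mh h0; under eq_fun do rewrite integral_ind.
apply: (measurable_fun_fubini_tonelli_F (ind h)).
- exact: measurable_ind.
- by move=> z; rewrite mule_ge0// lee_fin.
Qed.

Lemma tonelli_in (h : T1 * T2 -> \bar R) : measurable_fun setT h ->
  (forall z, 0 <= h z)%E ->
  (\int[m1]_x \int[m2]_(t in D) h (x, t) = \int[m2]_(t in D) \int[m1]_x h (x, t))%E.
Proof.
move=> mh h0; under eq_integral do rewrite integral_ind.
rewrite (fubini_tonelli (ind h)); last 2 first.
- exact: measurable_ind.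
- by move=> z; rewrite mule_ge0// lee_fin.
rewrite [RHS]integral_mkcond epatch_indic; apply: eq_integral => t _.
rewrite /ind /= ge0_integralZr ?lee_fin//.
exact: measurableT_comp.
Qed.

Lemma measurable_Rintegral_param (h : T1 * T2 -> R) : measurable_fun setT h ->
  measurable_fun setT (fun x => \int[m2]_(t in D) h (x, t)).
Proof.
move=> mh; apply: measurableT_comp; first exact: fine_measurable.
have mEh : measurable_fun setT (EFin \o h) by exact/measurable_EFinP.
under eq_fun do rewrite integralE.
apply: emeasurable_funB.
- have mp : measurable_fun setT (EFin \o h)^\+%E by exact: measurable_funepos.
  have := measurable_integral_param mp (funepos_ge0 _).
  by congr measurable_fun; apply/funext => x; apply: eq_integral => t _; rewrite !funeposE.
- have mp : measurable_fun setT (EFin \o h)^\-%E by exact: measurable_funeneg.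
  have := measurable_integral_param mp (funeneg_ge0 _).
  by congr measurable_fun; apply/funext => x; apply: eq_integral => t _; rewrite !funenegE.
Qed.

End ParametricIntegral.

Section Translation.
Variable R : realType.
Notation leb := (@lebesgue_measure R).
Notation mu := (mu2 R).

Definition subc (u : R) : measurableTypeR R -> measurableTypeR R := fun x => x - u.

Lemma measurable_subc u : measurable_fun setT (subc u).
Proof. exact: measurable_funB. Qed.

HB.instance Definition _ u := isMeasurableFun.Build _ _ _ _ (subc u) (measurable_subc u).

Lemma lebesgue_measure_shift u (A : set (measurableTypeR R)) : measurable A ->
  pushforward leb (subc u) A = leb A.
Proof.
move=> mA; apply/esym/lebesgue_measure_unique => //= _ [[a b]] _ <-.
rewrite /pushforward (_ : subc u @^-1` _ = `](a + u), (b + u)]%classic); last first.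
  by apply/seteqP; split => x; rewrite /subc/= !in_itv/= ltrBrDr lerBlDr.
by rewrite !lebesgue_measure_itv/= !lte_fin ltrD2r; case: ifP => // _; rewrite -!EFinD; congr EFin; ring.
Qed.

Lemma integral_shift u (g : R -> \bar R) : measurable_fun setT g ->
  (forall x, 0 <= g x)%E -> (\int[leb]_x g (x - u)%R = \int[leb]_x g x)%E.
Proof.
move=> mg g0; have := @ge0_integral_pushforward _ _ _ _ _ _ (measurable_subc u) leb setT g measurableT mg.
rewrite preimage_setT => <- //.
by apply: eq_measure_integral => A mA _; exact: lebesgue_measure_shift.
Qed.

Lemma integral2_shift u v (h : R * R -> \bar R) : measurable_fun setT h ->
  (forall x, 0 <= h x)%E -> (\int[mu]_p h (p.1 - u, p.2 - v)%R = \int[mu]_p h p)%E.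
Proof.
move=> mh h0.
have msh : measurable_fun setT (fun p : R * R => h (p.1 - u, p.2 - v)).
  apply: (measurableT_comp mh); apply/measurable_fun_pairP; split => /=.
    by apply: measurable_funB.
  by apply: measurable_funB.
rewrite !fubini_tonelli1//= /fubini_F.
pose H x := (\int[leb]_y h (x, y))%E.
have mH : measurable_fun setT H.
  by have := @measurable_fun_fubini_tonelli_F _ _ _ _ _ leb h mh h0.
have H0 x : (0 <= H x)%E by exact: integral_ge0.
rewrite -[RHS](integral_shift u mH H0).
apply: eq_integral => x _ /=.
rewrite -/(H (x - u)) /H -(@integral_shift v (fun y => h (x - u, y)))//.
exact: measurableT_comp.
Qed.

Lemma sqint_shift u v (f : R * R -> R) : measurable_fun setT f ->
  sqint mu setT (fun p => f (p.1 - u, p.2 - v)) = sqint mu setT f.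
Proof.
move=> mf; rewrite /sqint (integral2_shift u v (h := fun p => ((f p) ^+ 2)%:E))//.
- exact: measurable_sq.
- by move=> p; rewrite lee_fin sqr_ge0.
Qed.

End Translation.

(** * Truncated transforms *)

(* The library infers the sigma-finiteness of a product measure only for
   subprobabilities, hence the explicit packing. *)
Section PlaneMeasure.
Variable R : realType.

Lemma plane_sigma_finite : sigma_finite setT (mu2 R).
Proof.
exists (fun n => box (- n%:R) n%:R (- n%:R) n%:R); last first.
  by move=> n; split; [exact: measurable_box|exact: box_lty].
apply/esym; rewrite -subTset => x _.
near \oo => n; exists n => //; rewrite /box /=.
have h1 : `|x.1| < n%:R by near: n; exact: nbhs_infty_gtr.
have h2 : `|x.2| < n%:R by near: n; exact: nbhs_infty_gtr.
by move: h1 h2; rewrite !ltr_norml !in_itv/= => /andP[-> /ltW ->] /andP[-> /ltW ->].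
Unshelve. all: by end_near. Qed.

Definition plane : {sigma_finite_measure set (measurableTypeR R * measurableTypeR R)%type -> \bar R} :=
  HB.pack (mu2 R) (Measure_isSigmaFinite.Build _ _ _ (mu2 R) plane_sigma_finite).

End PlaneMeasure.

Section TruncatedTransform.
Variables (R : realType) (q : {poly R}).
Notation leb := (@lebesgue_measure R).
Notation mu := (mu2 R).
Implicit Types (f g : R * R -> R) (a b t : R) (p : R * R).

Definition shift_curve t p : R * R := (p.1 - t, p.2 - q.[t]).

Definition odd_diff f t p : R := f (shift_curve t p) - f (shift_curve (- t) p).

(** The Hilbert transform restricted to a <= |t| <= b, folded to positive t so that 1 / t only meets
    an odd difference. *)
Definition trunc a b f p : R := \int[leb]_(t in `[a, b]) (odd_diff f t p / t).

Lemma measurable_horner (p : {poly R}) : measurable_fun setT (horner p).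
Proof. exact: continuous_measurable_fun (@continuous_horner _ p). Qed.

Lemma measurable_shift_curve : measurable_fun setT (fun z : (R * R) * R => shift_curve z.2 z.1).
Proof.
apply/measurable_fun_pairP; split => /=.
  apply: measurable_funB => //; exact: (measurableT_comp measurable_fst measurable_fst).
apply: measurable_funB; first exact: (measurableT_comp measurable_snd measurable_fst).
by apply: measurableT_comp; [exact: measurable_horner|exact: measurable_snd].
Qed.

Lemma measurable_odd_diff f : measurable_fun setT f ->
  measurable_fun setT (fun z : (R * R) * R => odd_diff f z.2 z.1).
Proof.
move=> mf; apply: measurable_funB.
  exact: (measurableT_comp mf measurable_shift_curve).
have mN : measurable_fun setT (fun z : (R * R) * R => (z.1, - z.2)).
  apply/measurable_fun_pairP; split => /=; first exact: measurable_fst.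
  by apply: measurable_funN; exact: measurable_snd.
exact: (measurableT_comp mf (measurableT_comp measurable_shift_curve mN)).
Qed.

Lemma measurable_odd_diff2 f t : measurable_fun setT f -> measurable_fun setT (odd_diff f t).
Proof.
move=> mf; have h := measurable_odd_diff mf.
exact: (measurableT_comp h (pair2_measurable t)).
Qed.

Lemma measurable_odd_diff1 f p : measurable_fun setT f ->
  measurable_fun setT (fun t => odd_diff f t p).
Proof.
move=> mf; have h := measurable_odd_diff mf.
exact: (measurableT_comp h (pair1_measurable p)).
Qed.

Lemma measurable_invr : measurable_fun [set: R] (fun t : R => t^-1).
Proof.
have -> : [set: R] = [set 0] `|` [set~ 0] by rewrite setUv.
apply/measurable_funU => //; first exact: measurableC.
split; first exact: measurable_fun_set1.
apply: subspace_continuous_measurable_fun; first exact: measurableC.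
apply: continuous_in_subspaceT => x; rewrite inE /= => /eqP x0.
exact: inv_continuous.
Qed.

Lemma measurable_trunc_kernel f : measurable_fun setT f ->
  measurable_fun setT (fun z : (R * R) * R => odd_diff f z.2 z.1 / z.2).
Proof.
move=> mf; apply: measurable_funM; first exact: measurable_odd_diff.
by apply: measurableT_comp; [exact: measurable_invr|exact: measurable_snd].
Qed.

Lemma measurable_trunc a b f : measurable_fun setT f -> measurable_fun setT (trunc a b f).
Proof.
move=> mf; exact: (measurable_Rintegral_param leb (measurable_itv `[a, b]) (measurable_trunc_kernel mf)).
Qed.

Lemma segment_measure a b : a <= b -> leb `[a, b] = (b - a)%:E.
Proof.
move=> ab; rewrite lebesgue_measure_itv/= lte_fin; case: ltP => // ba.
by have -> : b = a by [apply/eqP; rewrite eq_le ab ba]; rewrite subrr.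
Qed.

Lemma measurable_shift1 t : measurable_fun setT (shift_curve t).
Proof. exact: (measurable_fun_pair1 t measurable_shift_curve). Qed.

Lemma sqint_shift_curve f t : measurable_fun setT f ->
  sqint mu setT (f \o shift_curve t) = sqint mu setT f.
Proof. exact: sqint_shift. Qed.

Lemma sqint_odd_diff f t : measurable_fun setT f ->
  (sqint mu setT (odd_diff f t) <= 4%:E * sqint mu setT f)%E.
Proof.
move=> mf; have ms s := measurableT_comp mf (measurable_shift1 s).
apply: le_trans (sqintB mu measurableT (ms t) (ms (- t))) _.
rewrite !sqint_shift_curve// -ge0_muleDl ?lee_fin// -EFinD.
by have -> : 2 + 2 = 4 :> R by ring.
Qed.

Lemma le_sq_trunc a b f p : 0 < a -> a <= b -> measurable_fun setT f ->
  (((trunc a b f p) ^+ 2)%:E <= ((b - a) / a ^+ 2)%:E *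
     \int[leb]_(t in `[a, b]) ((odd_diff f t p) ^+ 2)%:E)%E.
Proof.
move=> a0 ab mf.
have mo : measurable_fun setT (fun t => odd_diff f t p) by exact: measurable_odd_diff1.
have mk : measurable_fun `[a, b] (fun t => odd_diff f t p / t).
  by apply: measurable_funTS; apply: measurable_funM => //; exact: measurable_invr.
have ba0 : 0 <= b - a by rewrite subr_ge0.
have fin : (leb `[a, b] < +oo)%E by rewrite segment_measure// ltry.
have CS := @cauchy_schwarz_Rintegral _ _ _ leb _ _ (measurable_itv `[a, b]) fin mk.
apply: (le_trans CS).
rewrite [X in (X * _ <= _)%E](_ : _ = (b - a)%:E); last exact: segment_measure.
rewrite EFinM -muleA lee_wpmul2l ?lee_fin//.
rewrite -ge0_integralZl//; last 3 first.
- by apply: measurable_sq; exact: measurable_funTS.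
- by move=> t _; rewrite lee_fin sqr_ge0.
- by rewrite lee_fin invr_ge0 sqr_ge0.
apply: ge0_le_integral => //.
- by move=> t _; rewrite lee_fin sqr_ge0.
- exact: measurable_sq.
- by apply: measurable_funeM; apply: measurable_sq; exact: measurable_funTS.
- move=> t; rewrite /= in_itv/= => /andP[at_ _].
  rewrite -EFinM lee_fin exprMn mulrC ler_wpM2r ?sqr_ge0// exprVn lef_pV2 ?posrE ?exprn_gt0//.
    by rewrite lerXn2r// nnegrE ?(ltW a0)// (le_trans (ltW a0)).
  exact: lt_le_trans at_.
Qed.

Lemma measurable_odd_diff_sq f : measurable_fun setT f ->
  measurable_fun setT (fun z : (R * R) * R => ((odd_diff f z.2 z.1) ^+ 2)%:E : \bar R).
Proof. by move=> mf; apply: measurable_sq; exact: measurable_odd_diff. Qed.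

Lemma sqint_trunc a b f : 0 < a -> a <= b -> measurable_fun setT f ->
  (sqint mu setT (trunc a b f) <= ((b - a) / a ^+ 2)%:E *
     \int[leb]_(t in `[a, b]) sqint mu setT (odd_diff f t))%E.
Proof.
move=> a0 ab mf.
have c0 : 0 <= (b - a) / a ^+ 2 by rewrite divr_ge0 ?subr_ge0 ?exprn_ge0// ltW.
have ms := measurable_odd_diff_sq mf.
have z0 (z : (R * R) * R) : (0 <= ((odd_diff f z.2 z.1) ^+ 2)%:E)%E by rewrite lee_fin sqr_ge0.
have mI : measurable_fun setT (fun p => (\int[leb]_(t in `[a, b]) ((odd_diff f t p) ^+ 2)%:E)%E).
  exact: (measurable_integral_param leb (measurable_itv `[a, b]) ms z0).
rewrite -(tonelli_in (plane R) leb (measurable_itv `[a, b]) ms z0) -ge0_integralZl//; last first.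
- by move=> p _; apply: integral_ge0 => t _; rewrite lee_fin sqr_ge0.
apply: ge0_le_integral => //.
- by move=> p _; rewrite lee_fin sqr_ge0.
- by apply: measurable_sq; exact: measurable_trunc.
- exact: measurable_funeM.
- by move=> p _; exact: le_sq_trunc.
Qed.

Lemma measurable_sqint_odd_diff f : measurable_fun setT f ->
  measurable_fun setT (fun t => sqint mu setT (odd_diff f t)).
Proof.
move=> mf; apply: (@measurable_fun_fubini_tonelli_G _ _ _ _ _ (plane R)
  (fun z : (R * R) * R => ((odd_diff f z.2 z.1) ^+ 2)%:E) (measurable_odd_diff_sq mf)).
by move=> z; rewrite lee_fin sqr_ge0.
Qed.

(** Cauchy-Schwarz in t followed by Tonelli. The loss depends on the ratio b / a alone, so it is the
    same for all dyadic shells. *)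
Lemma le_sqint_trunc_unif a b f (c : \bar R) : 0 < a -> a <= b -> measurable_fun setT f ->
  (0 <= c)%E -> (forall t, a <= t <= b -> (sqint mu setT (odd_diff f t) <= c)%E) ->
  (sqint mu setT (trunc a b f) <= (((b - a) / a) ^+ 2)%:E * c)%E.
Proof.
move=> a0 ab mf c0 fc; apply: le_trans (sqint_trunc a0 ab mf) _.
have c1 : 0 <= (b - a) / a ^+ 2 by rewrite divr_ge0 ?subr_ge0 ?exprn_ge0// ltW.
apply: le_trans (_ : ((b - a) / a ^+ 2)%:E * \int[leb]_(t in `[a, b]) c <= _)%E.
  rewrite lee_wpmul2l ?lee_fin//; apply: ge0_le_integral => //.
  - by move=> t _; exact: sqint_ge0.
  - by apply: measurable_funTS; exact: measurable_sqint_odd_diff.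
rewrite integral_cst//= segment_measure// muleCA muleC -EFinM.
rewrite (_ : _ / _ * _ = ((b - a) / a) ^+ 2)//.
by field; rewrite gt_eqF.
Qed.

(** Not uniform in the truncation, but it shows square integrability and absorbs errors that can be
    made small after [a] and [b] are fixed. *)
Lemma sqint_trunc_crude a b f : 0 < a -> a <= b -> measurable_fun setT f ->
  (sqint mu setT (trunc a b f) <= (((b - a) / a) ^+ 2)%:E * (4%:E * sqint mu setT f))%E.
Proof.
move=> a0 ab mf; apply: le_sqint_trunc_unif => //.
  by rewrite mule_ge0 ?lee_fin// sqint_ge0.
by move=> t _; exact: sqint_odd_diff.
Qed.

Lemma trunc_L2r a b f : 0 < a -> a <= b -> L2r f -> L2r (trunc a b f).
Proof.
move=> a0 ab [mf sf]; split; first exact: measurable_trunc.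
apply: le_lt_trans (sqint_trunc_crude a0 ab mf) _.
by rewrite lte_mul_pinfty ?lee_fin ?sqr_ge0// lte_mul_pinfty.
Qed.

Definition trunc_integrable a b f p :=
  leb.-integrable `[a, b] (EFin \o (fun t => odd_diff f t p / t)).

(** By Tonelli the odd difference is square integrable in t for almost every p, hence integrable on
    a segment. Linearity of [trunc] on square integrable functions is therefore an almost everywhere
    statement. *)
Lemma trunc_integrable_ae a b f : 0 < a -> a <= b -> L2r f ->
  {ae mu, forall p, trunc_integrable a b f p}.
Proof.
move=> a0 ab [mf sf].
have ms := measurable_odd_diff_sq mf.
have z0 (z : (R * R) * R) : (0 <= ((odd_diff f z.2 z.1) ^+ 2)%:E)%E by rewrite lee_fin sqr_ge0.
pose S p := (\int[leb]_(t in `[a, b]) ((odd_diff f t p) ^+ 2)%:E)%E.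
have S0 p : (0 <= S p)%E by apply: integral_ge0 => t _; rewrite lee_fin sqr_ge0.
have mS : measurable_fun setT S.
  exact: (measurable_integral_param leb (measurable_itv `[a, b]) ms z0).
have iS : mu.-integrable setT S.
  apply/integrableP; split => //.
  under eq_integral do rewrite gee0_abs//.
  rewrite (tonelli_in (plane R) leb (measurable_itv `[a, b]) ms z0).
  apply: le_lt_trans (_ : \int[leb]_(t in `[a, b]) (4%:E * sqint mu setT f) < +oo)%E.
    apply: ge0_le_integral => //.
    - by move=> t _; exact: sqint_ge0.
    - by apply: measurable_funTS; exact: measurable_sqint_odd_diff.
    - by move=> t _; exact: sqint_odd_diff.
  rewrite integral_cst//= segment_measure// lte_mul_pinfty//.
  - by rewrite mule_ge0 ?lee_fin// sqint_ge0.
  - by rewrite ge0_fin_numE ?mule_ge0 ?lee_fin ?sqint_ge0// lte_mul_pinfty.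
  - by rewrite ltry.
have := integrable_ae measurableT iS; apply: filterS => p /(_ I) Sp.
have mo : measurable_fun setT (fun t => odd_diff f t p) by exact: measurable_odd_diff1.
have mk : measurable_fun `[a, b] (fun t => odd_diff f t p / t).
  by apply: measurable_funTS; apply: measurable_funM => //; exact: measurable_invr.
have i1 : leb.-integrable `[a, b] (EFin \o (fun t => odd_diff f t p)).
  have fin : (leb `[a, b] < +oo)%E by rewrite segment_measure// ltry.
  apply: (@sqint_integrable _ _ _ leb _ _ (measurable_itv `[a, b]) fin).
  - exact: measurable_funTS.
  - by rewrite -ge0_fin_numE// sqint_ge0.
have i2 := @integrableZl _ _ _ leb _ (measurable_itv `[a, b]) a^-1 _ i1.
apply: (@le_integrable _ _ _ leb _ (measurable_itv `[a, b]) _ _ _ _ i2) => //.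
  exact/measurable_EFinP.
move=> t; rewrite /= in_itv/= => /andP[at_ _]; rewrite lee_fin !normrM mulrC ler_wpM2r//.
rewrite !normfV lef_pV2 ?posrE ?normr_gt0 ?gt_eqF//; last exact: lt_le_trans at_.
by rewrite !ger0_norm// ?(ltW a0)// (le_trans (ltW a0)).
Qed.

Lemma trunc_lin a b c f g p : trunc_integrable a b f p -> trunc_integrable a b g p ->
  trunc a b (fun p => c * f p + g p) p = c * trunc a b f p + trunc a b g p.
Proof.
move=> fi gi; rewrite /trunc -RintegralZl// -RintegralD//.
  by apply: eq_Rintegral => t _; rewrite /odd_diff; ring.
exact: (@integrableZl _ _ _ leb _ (measurable_itv `[a, b]) c _ fi).
Qed.

Lemma trunc_split a b c f p : a <= b <= c -> trunc_integrable a c f p ->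
  trunc a c f p = trunc a b f p + trunc b c f p.
Proof.
move=> /andP[ab bc] fi; apply/eqP; rewrite addrC -subr_eq; apply/eqP.
rewrite /trunc Rintegral_itvB// Rintegral_itv_obnd_cbnd//.
by apply: integrableS fi => //; apply: subset_itv; rewrite bnd_simp.
Qed.

End TruncatedTransform.

(** * Trigonometric polynomials *)

Section Parseval.
Variable R : realType.
Notation leb := (@lebesgue_measure R).
Notation mu := (mu2 R).
Variables (l : R) (l0 : 0 < l).
Implicit Types (z : int * int) (p : R * R).

Notation half := (pi * l).
Definition cell : set (R * R) := box (- half) half (- half) half.

(** The argument of a character of the torus of period 2 pi l. *)
Definition phase z p : R := (z.1%:~R * p.1 + z.2%:~R * p.2) / l.

Lemma half_period_gt0 : 0 < half. Proof. by rewrite mulr_gt0// pi_gt0. Qed.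

Lemma sin_int_pi (k : int) : sin (k%:~R * pi) = 0 :> R.
Proof.
suff H (n : nat) : sin (n%:R * pi) = 0 :> R.
  case: k => n; first by rewrite -pmulrn H.
  by rewrite NegzE mulrNz mulNr sinN -pmulrn H oppr0.
elim: n => [|n IH]; first by rewrite mul0r sin0.
by rewrite -natr1 mulrDl mul1r sinD sinpi IH mul0r mulr0 addr0.
Qed.

Definition cosw (k : int) (x : R) : R := cos (k%:~R * x / l).
Definition sinw (k : int) (x : R) : R := sin (k%:~R * x / l).

Lemma cosw_phase z p : cos (phase z p) = cosw z.1 p.1 * cosw z.2 p.2 - sinw z.1 p.1 * sinw z.2 p.2.
Proof. by rewrite /phase mulrDl cosD. Qed.

Lemma sinw_phase z p : sin (phase z p) = sinw z.1 p.1 * cosw z.2 p.2 + cosw z.1 p.1 * sinw z.2 p.2.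
Proof. by rewrite /phase mulrDl sinD. Qed.

Lemma is_derive_lin (c x : R) : is_derive x 1 (fun x => c * x / l) (c / l).
Proof.
have := @is_derive_poly _ ((c / l) *: 'X) x.
rewrite derivZ derivX hornerZ hornerC mulr1.
have -> : horner ((c / l) *: 'X) = (fun x => c * x / l); last by [].
by apply/funext => y; rewrite hornerZ hornerX; ring.
Qed.

Lemma continuous_lin (c : R) : continuous (fun x : R => c * x / l).
Proof. by move=> x; apply/differentiable_continuous/derivable1_diffP; case: (is_derive_lin c x). Qed.

Lemma cosw_continuous k : continuous (cosw k).
Proof. by move=> x; apply: continuous_comp; [exact: continuous_lin|exact: continuous_cos]. Qed.

Lemma sinw_continuous k : continuous (sinw k).
Proof. by move=> x; apply: continuous_comp; [exact: continuous_lin|exact: continuous_sin]. Qed.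

Definition period : set R := `]- half, half]%classic.

Lemma measurable_period : measurable (period : set (measurableTypeR R)).
Proof. exact: measurable_itv. Qed.

Lemma period_measure : leb period = (2 * half)%:E.
Proof.
have h0 := half_period_gt0; rewrite lebesgue_measure_itv/= lte_fin ifT.
  by rewrite -EFinB; congr EFin; ring.
by rewrite -subr_gt0; lra.
Qed.

Lemma Rintegral_period (f F : R -> R) : (forall x : R, is_derive x 1 F (f x)) -> continuous f ->
  \int[leb]_(x in period) f x = F half - F (- half).
Proof.
move=> dF cf; have h0 := half_period_gt0.
have cf' x : - half <= x <= half -> {for x, continuous f} by move=> _; exact: cf.
rewrite Rintegral_itv_obnd_cbnd.
  apply: (@Rintegral_FTC2 _ f F) => //; first by rewrite lerNl; lra.
by apply: integrableS (segment_integrable cf') => //; exact: subset_itv_oc_cc.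
Qed.

Lemma integral_sinw k : \int[leb]_(x in period) sinw k x = 0.
Proof.
have [->|k0] := eqVneq k 0.
  rewrite (@eq_Rintegral _ _ _ _ _ (cst 0)) => [|x _]; last by rewrite /sinw mul0r mul0r sin0.
  by rewrite Rintegral_cst ?mul0r//; exact: measurable_period.
have kl : k%:~R / l != 0 by apply: mulf_neq0; [rewrite intr_eq0|rewrite invr_eq0 gt_eqF].
have dF (x : R) : is_derive x 1 (fun x => - (k%:~R / l)^-1 * cosw k x) (sinw k x).
  have dc := is_derive1_comp (is_derive_cos _) (is_derive_lin k%:~R x).
  have dz := @is_deriveZ _ _ _ (cosw k) (- (k%:~R / l)^-1) x 1 _ dc.
  apply: (is_derive_eq dz); rewrite /sinw /GRing.scale/=; set K := _ / l in kl *.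
  by field.
rewrite (Rintegral_period dF (@sinw_continuous k)).
by rewrite /cosw mulrN !mulNr cosN subrr.
Qed.

Lemma integral_cosw k : \int[leb]_(x in period) cosw k x = if k == 0 then 2 * half else 0.
Proof.
have h0 := half_period_gt0.
case: ifP => [/eqP ->|/negbT k0].
  rewrite (@eq_Rintegral _ _ _ _ _ (cst 1)) => [|x _]; last by rewrite /cosw mul0r mul0r cos0.
  rewrite Rintegral_cst; last exact: measurable_period.
  rewrite mul1r [fine _](_ : _ = fine (2 * half)%:E)//.
  by congr fine; exact: period_measure.
have kl : k%:~R / l != 0 by apply: mulf_neq0; [rewrite intr_eq0|rewrite invr_eq0 gt_eqF].
have dF (x : R) : is_derive x 1 (fun x => (k%:~R / l)^-1 * sinw k x) (cosw k x).
  have dc := is_derive1_comp (is_derive_sin _) (is_derive_lin k%:~R x).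
  have dz := @is_deriveZ _ _ _ (sinw k) ((k%:~R / l)^-1) x 1 _ dc.
  apply: (is_derive_eq dz); rewrite /cosw /GRing.scale/=; set K := _ / l in kl *.
  by field.
rewrite (Rintegral_period dF (@cosw_continuous k)).
have e : sinw k half = 0 by rewrite /sinw mulrA mulfK ?gt_eqF// sin_int_pi.
have e' : sinw k (- half) = 0 by rewrite /sinw mulrN mulNr sinN -[sin _]/(sinw k half) e oppr0.
by rewrite e e' mulr0 subrr.
Qed.

Lemma cell_lty : (mu cell < +oo)%E. Proof. exact: box_lty. Qed.

Lemma measurable_cell : measurable cell. Proof. exact: measurable_box. Qed.

Lemma indic_cell p : \1_cell p = \1_period p.1 * \1_period p.2 :> R.
Proof. by case: p => x y; rewrite !indicE in_setX/= -mulnb natrM. Qed.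

Lemma integral_cell_prod (u v : R -> R) M : continuous u -> continuous v ->
  (forall x, `|u x| <= M) -> (forall x, `|v x| <= M) ->
  mu.-integrable cell (EFin \o (fun p => u p.1 * v p.2)) /\
  \int[mu]_(p in cell) (u p.1 * v p.2) =
  (\int[leb]_(x in period) u x) * (\int[leb]_(x in period) v x).
Proof.
move=> cu cv uM vM.
have mu_ := continuous_measurable_fun cu; have mv := continuous_measurable_fun cv.
have muv : measurable_fun setT (fun p : R * R => u p.1 * v p.2).
  by apply: measurable_funM; [exact: (measurableT_comp mu_)|exact: (measurableT_comp mv)].
have iuv : mu.-integrable cell (EFin \o (fun p => u p.1 * v p.2)).
  apply: (@bounded_integrable _ _ _ _ _ _ (M * M)); [exact: measurable_cell|exact: cell_lty|exact: measurable_funTS|].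
  by move=> p _; rewrite normrM ler_pM.
split => //.
have fin : (leb period < +oo)%E by rewrite period_measure ltry.
have iu : leb.-integrable period (EFin \o u).
  by apply: (@bounded_integrable _ _ _ leb _ _ M measurable_period fin) => //; exact: measurable_funTS.
have iv : leb.-integrable period (EFin \o v).
  by apply: (@bounded_integrable _ _ _ leb _ _ M measurable_period fin) => //; exact: measurable_funTS.
pose I w x := w x * \1_period x : R.
have EI w : (\int[leb]_(x in period) (w x)%:E = \int[leb]_x (I w x)%:E)%E.
  by rewrite integral_mkcond epatch_indic.
have iI w : leb.-integrable period (EFin \o w) -> leb.-integrable setT (EFin \o I w).
  by move/(integrable_mkcond (EFin \o w) measurable_period).1; rewrite epatch_indic.
rewrite /Rintegral (_ : \int[mu]_(p in cell) (u p.1 * v p.2)%:E =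
   \int[mu]_p (I u p.1 * I v p.2)%:E)%E; last first.
  rewrite integral_mkcond epatch_indic; apply: eq_integral => p _ /=.
  rewrite -EFinM /I; congr EFin; rewrite indic_cell; ring.
have ii : mu.-integrable setT (fun p => (I u p.1 * I v p.2)%:E).
  have /integrable_mkcond := iuv; move=> /(_ measurable_cell).
  rewrite epatch_indic; congr integrable; apply/funext => p /=.
  rewrite -EFinM /I; congr EFin; rewrite indic_cell; ring.
rewrite -(integral12_prod_meas1 ii) /fubini_F /=.
have E1 x : (\int[leb]_y (I u x * I v y)%:E = (I u x)%:E * (\int[leb]_(y in period) v y)%:E)%E.
  rewrite /Rintegral fineK ?(integrable_fin_num _ iv)//; last exact: measurable_period.
  rewrite EI -integralZl//; last exact: iI.
under eq_integral => x _ do rewrite E1.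
rewrite integralZr//; last exact: iI.
by rewrite -EI -(fineK (integrable_fin_num measurable_period iu)) -EFinM.
Qed.

Lemma integral_phase z :
  [/\ mu.-integrable cell (EFin \o (fun p => cos (phase z p))),
      mu.-integrable cell (EFin \o (fun p => sin (phase z p))),
      \int[mu]_(p in cell) cos (phase z p) = (if z == 0 then (2 * half) ^+ 2 else 0)
    & \int[mu]_(p in cell) sin (phase z p) = 0].
Proof.
have c1 k x : `|cosw k x| <= 1 by exact: cos_max.
have s1 k x : `|sinw k x| <= 1 by exact: sin_max.
have cc := cosw_continuous; have cs := sinw_continuous.
have [i1 e1] := integral_cell_prod (cc z.1) (cc z.2) (c1 _) (c1 _).
have [i2 e2] := integral_cell_prod (cs z.1) (cs z.2) (s1 _) (s1 _).
have [i3 e3] := integral_cell_prod (cs z.1) (cc z.2) (s1 _) (c1 _).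
have [i4 e4] := integral_cell_prod (cc z.1) (cs z.2) (c1 _) (s1 _).
have mc := measurable_cell.
split.
- rewrite (_ : EFin \o _ = ((EFin \o (fun p => (cosw z.1 p.1 * cosw z.2 p.2)%R)) \-
    (EFin \o (fun p => (sinw z.1 p.1 * sinw z.2 p.2)%R)))%E).
    exact: (@integrableB _ _ _ mu _ mc _ _ i1 i2).
  by apply/funext => p /=; rewrite cosw_phase.
- rewrite (_ : EFin \o _ = ((EFin \o (fun p => (sinw z.1 p.1 * cosw z.2 p.2)%R)) \+
    (EFin \o (fun p => (cosw z.1 p.1 * sinw z.2 p.2)%R)))%E).
    exact: (@integrableD _ _ _ mu _ mc _ _ i3 i4).
  by apply/funext => p /=; rewrite sinw_phase.
- under eq_Rintegral do rewrite cosw_phase.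
  rewrite RintegralB// e1 e2 !integral_cosw !integral_sinw mulr0 subr0.
  have -> (w : int * int) : (w == 0) = (w.1 == 0) && (w.2 == 0) by case: w.
  by case: (z.1 == 0); case: (z.2 == 0); rewrite /= ?mulr0 ?mul0r// expr2.
- under eq_Rintegral do rewrite sinw_phase.
  by rewrite RintegralD// e3 e4 !integral_sinw mul0r mulr0 addr0.
Qed.

End Parseval.

Lemma Rintegral_sum_seq d (T : measurableType d) (R : realType)
    (mu : {measure set T -> \bar R}) (D : set T) (I : Type) (s : seq I) (F : I -> T -> R) :
  measurable D -> (forall i, mu.-integrable D (EFin \o F i)) ->
  mu.-integrable D (EFin \o (fun x => \sum_(i <- s) F i x)) /\
  \int[mu]_(x in D) (\sum_(i <- s) F i x) = \sum_(i <- s) \int[mu]_(x in D) F i x.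
Proof.
move=> mD iF; elim: s => [|i s [IH1 IH2]].
  have e : (fun x : T => \sum_(i <- [::]) F i x) = cst 0 by apply/funext => x; rewrite big_nil.
  rewrite e big_nil; split; first exact: integrable0.
  by rewrite Rintegral_cst// mul0r.
have e : (fun x : T => \sum_(j <- i :: s) F j x) = (fun x => F i x + \sum_(j <- s) F j x).
  by apply/funext => x; rewrite big_cons.
rewrite e; split; first exact: (integrableD mD (iF i) IH1).
by rewrite RintegralD// IH2 big_cons.
Qed.

Section TrigPolynomials.
Variable R : realType.
Notation leb := (@lebesgue_measure R).
Notation mu := (mu2 R).
Variables (l : R) (l0 : 0 < l).
Implicit Types (z w : int * int) (p : R * R) (A B : int * int -> R) (u : seq (int * int)).

Notation ph := (phase l).
Notation cell := (cell l).

Lemma phaseB z w p : ph (z - w) p = ph z p - ph w p.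
Proof. by rewrite /phase /= !rmorphB/=; field; rewrite gt_eqF. Qed.

Lemma phaseD z w p : ph (z + w) p = ph z p + ph w p.
Proof. by rewrite /phase /= !rmorphD/=; field; rewrite gt_eqF. Qed.

Lemma phaseN z p : ph (- z) p = - ph z p.
Proof. by rewrite /phase /= !rmorphN/=; field; rewrite gt_eqF. Qed.

(** Real part of the sum of (A z + i B z) exp (i [ph z p]); [trig_im] is the imaginary part. *)
Definition trig_re u A B p : R :=
  \sum_(z <- u) (A z * cos (ph z p) - B z * sin (ph z p)).

Definition trig_im u A B p : R :=
  \sum_(z <- u) (A z * sin (ph z p) + B z * cos (ph z p)).

Lemma trig_sqE u A B p : trig_re u A B p ^+ 2 + trig_im u A B p ^+ 2 =
  \sum_(z <- u) \sum_(w <- u) ((A z * A w + B z * B w) * cos (ph (z - w) p) +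
                               (A z * B w - B z * A w) * sin (ph (z - w) p)).
Proof.
rewrite !expr2 /trig_re /trig_im !big_distrlr/= -big_split/=; apply: eq_bigr => z _.
rewrite -big_split/=; apply: eq_bigr => w _.
by rewrite phaseB cosB sinB; ring.
Qed.

Lemma parseval u A B : uniq u ->
  mu.-integrable cell (EFin \o (fun p => trig_re u A B p ^+ 2 + trig_im u A B p ^+ 2)) /\
  \int[mu]_(p in cell) (trig_re u A B p ^+ 2 + trig_im u A B p ^+ 2) =
  (2 * (pi * l)) ^+ 2 * \sum_(z <- u) (A z ^+ 2 + B z ^+ 2).
Proof.
move=> uu.
pose F z w p : R := (A z * A w + B z * B w) * cos (ph (z - w) p) +
                   (A z * B w - B z * A w) * sin (ph (z - w) p).
have mc := measurable_cell l.
have iF z w : mu.-integrable cell (EFin \o F z w) /\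
   \int[mu]_(p in cell) F z w p = if z == w then (A z ^+ 2 + B z ^+ 2) * (2 * (pi * l)) ^+ 2 else 0.
  have [i1 i2 e1 e2] := integral_phase l0 (z - w).
  have j1 := @integrableZl _ _ _ mu _ mc (A z * A w + B z * B w) _ i1.
  have j2 := @integrableZl _ _ _ mu _ mc (A z * B w - B z * A w) _ i2.
  split; first exact: (@integrableD _ _ _ mu _ mc _ _ j1 j2).
  rewrite /F RintegralD// RintegralZl// RintegralZl// e1 e2 mulr0 addr0 subr_eq0.
  by case: eqP => [->|_]; rewrite ?mulr0// !expr2.
have iF2 z : mu.-integrable cell (EFin \o (fun p => \sum_(w <- u) F z w p)).
  by have [] := @Rintegral_sum_seq _ _ _ mu _ _ u (F z) mc (fun w => (iF z w).1).
have E : (fun p => trig_re u A B p ^+ 2 + trig_im u A B p ^+ 2) =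
   (fun p => \sum_(z <- u) \sum_(w <- u) F z w p) by apply/funext => p; exact: trig_sqE.
have [I1 I2] := @Rintegral_sum_seq _ _ _ mu _ _ u (fun z p => \sum_(w <- u) F z w p) mc iF2.
rewrite E; split => //; rewrite I2 mulr_sumr; apply: eq_big_seq => z zu.
have [_ ->] := @Rintegral_sum_seq _ _ _ mu _ _ u (F z) mc (fun w => (iF z w).1).
rewrite (bigD1_seq z)//= (iF z z).2 eqxx big1 ?addr0 1?mulrC// => w wz.
by rewrite (iF z w).2 eq_sym (negPf wz).
Qed.

Variable q : {poly R}.

(** What a character loses along the curve: moving by (t, q(t)) multiplies it by exp (- i phi(t)),
    with phi this polynomial. *)
Definition phase_poly z : {poly R} := (z.1%:~R / l) *: 'X + (z.2%:~R / l) *: q.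

Lemma phase_shift z t p : ph z (shift_curve q t p) = ph z p - (phase_poly z).[t].
Proof. by rewrite /phase /phase_poly /= !hornerE; field; rewrite gt_eqF. Qed.

(** [mult_re - i mult_im] is the symbol of [trunc q a b] at frequency [z]. The shift by pi / 2
    presents the sine integral as a cosine one, so one estimate serves both. *)
Definition mult_re a b z : R := osc_sym (phase_poly z) a b.
Definition mult_im a b z : R := osc_sym (phase_poly z - (pi / 2)%:P) a b.

Lemma cos_subpihalf (x : R) : cos (x - pi / 2) = sin x.
Proof. by rewrite cosB cos_pihalf sin_pihalf mulr0 add0r mulr1. Qed.

Lemma trunc_trig_re a b u A B p : 0 < a -> a <= b ->
  trunc q a b (trig_re u A B) p =
  trig_re u (fun z => A z * mult_re a b z + B z * mult_im a b z)
            (fun z => B z * mult_re a b z - A z * mult_im a b z) p.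
Proof.
move=> a0 ab; rewrite /trunc /odd_diff.
pose C z t : R := (cos (phase_poly z).[t] - cos (phase_poly z).[- t]) / t.
pose D z t : R := (cos (phase_poly z - (pi / 2)%:P).[t] - cos (phase_poly z - (pi / 2)%:P).[- t]) / t.
pose F z t : R := (A z * cos (ph z p) - B z * sin (ph z p)) * C z t +
                 (A z * sin (ph z p) + B z * cos (ph z p)) * D z t.
have pos t : a <= t <= b -> 0 < t by case/andP => + _; exact: lt_le_trans.
have iC P : leb.-integrable `[a, b] (EFin \o (fun t => (cos P.[t] - cos P.[- t]) / t)).
  by apply: segment_integrable => t /pos; exact: osc_sym_continuous.
have mab : measurable (`[a, b]%classic : set (measurableTypeR R)) by exact: measurable_itv.
have iF z : leb.-integrable `[a, b] (EFin \o F z) /\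
   \int[leb]_(t in `[a, b]) F z t = (A z * cos (ph z p) - B z * sin (ph z p)) * mult_re a b z +
     (A z * sin (ph z p) + B z * cos (ph z p)) * mult_im a b z.
  have j1 := @integrableZl _ _ _ leb _ mab (A z * cos (ph z p) - B z * sin (ph z p)) _ (iC (phase_poly z)).
  have j2 := @integrableZl _ _ _ leb _ mab (A z * sin (ph z p) + B z * cos (ph z p)) _ (iC (phase_poly z - (pi / 2)%:P)).
  split; first exact: (@integrableD _ _ _ leb _ mab _ _ j1 j2).
  rewrite /F RintegralD//; congr (_ + _).
    exact: (@RintegralZl _ _ _ leb _ (C z) _ mab (iC (phase_poly z))).
  exact: (@RintegralZl _ _ _ leb _ (D z) _ mab (iC (phase_poly z - (pi / 2)%:P))).
transitivity (\int[leb]_(t in `[a, b]) (\sum_(z <- u) F z t)); last first.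
  have [_ ->] := @Rintegral_sum_seq _ _ _ leb _ _ u F mab (fun z => (iF z).1).
  by rewrite /trig_re; apply: eq_bigr => z _; rewrite (iF z).2; ring.
apply: eq_Rintegral => t _; rewrite /trig_re -sumrB mulr_suml; apply: eq_bigr => z _.
rewrite /F /C /D !phase_shift !hornerD !hornerN !hornerC !cos_subpihalf !cosB !sinB.
by rewrite mulrA mulrA -mulrDl; congr (_ / _); ring.
Qed.

End TrigPolynomials.

Section TrigClass.
Variable R : realType.
Notation leb := (@lebesgue_measure R).
Notation mu := (mu2 R).
Variables (l : R) (l0 : 0 < l).
Implicit Types (F G : R * R -> R) (p : R * R) (s : seq ((R * R) * (int * int))).

Notation ph := (phase l).
Notation cell := (cell l).

Definition term_re (x : (R * R) * (int * int)) p : R :=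
  x.1.1 * cos (ph x.2 p) - x.1.2 * sin (ph x.2 p).
Definition term_im (x : (R * R) * (int * int)) p : R :=
  x.1.1 * sin (ph x.2 p) + x.1.2 * cos (ph x.2 p).

(* Real trigonometric polynomials of period [2 * pi * l], presented as sums of
   complex exponentials whose imaginary part cancels. *)
Definition is_trig F := exists s, forall p,
  \sum_(x <- s) term_re x p = F p /\ \sum_(x <- s) term_im x p = 0.

Lemma is_trig_cst c : is_trig (cst c).
Proof.
exists [:: ((c, 0), (0, 0))] => p; rewrite !big_seq1 /term_re /term_im /phase /=.
by rewrite mulr0z !mul0r addr0 mul0r cos0 sin0 !mulr0 subr0 mulr1 addr0.
Qed.

Lemma is_trigD F G : is_trig F -> is_trig G -> is_trig (fun p => F p + G p).
Proof.
move=> [s Hs] [t Ht]; exists (s ++ t) => p; rewrite !big_cat/=.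
by have [-> ->] := Hs p; have [-> ->] := Ht p; rewrite addr0.
Qed.

Lemma is_trigM F G : is_trig F -> is_trig G -> is_trig (fun p => F p * G p).
Proof.
move=> [s Hs] [t Ht].
pose m (x y : (R * R) * (int * int)) :=
  ((x.1.1 * y.1.1 - x.1.2 * y.1.2, x.1.1 * y.1.2 + x.1.2 * y.1.1), x.2 + y.2).
exists [seq m x y | x <- s, y <- t] => p; rewrite !big_allpairs_dep/=.
have [s1 s2] := Hs p; have [t1 t2] := Ht p.
have mre x y : term_re (m x y) p = term_re x p * term_re y p - term_im x p * term_im y p.
  by rewrite /term_re /term_im /m /= (phaseD l0) cosD sinD; ring.
have mim x y : term_im (m x y) p = term_re x p * term_im y p + term_im x p * term_re y p.
  by rewrite /term_re /term_im /m /= (phaseD l0) cosD sinD; ring.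
split.
  under eq_bigr => x _ do (under eq_bigr => y _ do rewrite mre; rewrite sumrB -!mulr_sumr).
  by rewrite sumrB -!mulr_suml s1 s2 t1 t2 mulr0 subr0.
under eq_bigr => x _ do (under eq_bigr => y _ do rewrite mim; rewrite big_split/= -!mulr_sumr).
by rewrite big_split/= -!mulr_suml s1 s2 t1 t2 mulr0 mul0r addr0.
Qed.

Lemma is_trigX F n : is_trig F -> is_trig (fun p => F p ^+ n).
Proof.
move=> tF; elim: n => [|n IH].
  by have := is_trig_cst 1; congr is_trig; apply/funext => p; rewrite expr0.
by have := is_trigM tF IH; congr is_trig; apply/funext => p; rewrite exprS.
Qed.

Lemma is_trigZ c F : is_trig F -> is_trig (fun p => c * F p).
Proof. exact: is_trigM (is_trig_cst c). Qed.

Lemma is_trig_cos z c : is_trig (fun p => cos (ph z p - c)).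
Proof.
exists [:: ((cos c / 2, - sin c / 2), z); ((cos c / 2, sin c / 2), - z)] => p.
rewrite !big_cons !big_nil /term_re /term_im /= !(phaseN l0) cosN sinN cosB.
by split; field.
Qed.

(** Products create repeated frequencies; these are merged here because Parseval's identity needs
    distinct ones. *)
Lemma is_trig_normal F : is_trig F ->
  exists u A B, [/\ uniq u, F = trig_re l u A B & forall p, trig_im l u A B p = 0].
Proof.
move=> [s Hs]; pose u := undup [seq x.2 | x <- s].
pose A z : R := \sum_(x <- s | x.2 == z) x.1.1.
pose B z : R := \sum_(x <- s | x.2 == z) x.1.2.
have merge (t : (R * R) * (int * int) -> R) :
    \sum_(x <- s) t x = \sum_(z <- u) \sum_(x <- s | x.2 == z) t x.
  under [RHS]eq_bigr do rewrite big_mkcond.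
  rewrite exchange_big/=; apply: eq_big_seq => x xs.
  rewrite (bigD1_seq x.2) ?undup_uniq//=; last by rewrite mem_undup map_f.
  by rewrite eqxx big1 ?addr0// => z /negPf; rewrite eq_sym => ->.
exists u, A, B; split; first exact: undup_uniq.
- apply/funext => p; rewrite -(Hs p).1 merge; apply: eq_bigr => z _.
  rewrite /A /B !mulr_suml -sumrB; apply: eq_bigr => x /eqP <-//.
- move=> p; rewrite -(Hs p).2 merge; apply: eq_bigr => z _.
  rewrite /A /B !mulr_suml -big_split; apply: eq_bigr => x /eqP <-//.
Qed.

Lemma measurable_phase z : measurable_fun setT (ph z).
Proof.
apply: measurable_funM => //; apply: measurable_funD; apply: measurable_funM => //.
Qed.

Lemma measurable_trig_re u A B : measurable_fun setT (trig_re l u A B).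
Proof.
apply: measurable_sum => z; apply: measurable_funB; apply: measurable_funM => //.
  by apply: measurableT_comp; [exact: continuous_measurable_fun (@continuous_cos R)|exact: measurable_phase].
by apply: measurableT_comp; [exact: continuous_measurable_fun (@continuous_sin R)|exact: measurable_phase].
Qed.

Lemma measurable_trig_im u A B : measurable_fun setT (trig_im l u A B).
Proof.
apply: measurable_sum => z; apply: measurable_funD; apply: measurable_funM => //.
  by apply: measurableT_comp; [exact: continuous_measurable_fun (@continuous_sin R)|exact: measurable_phase].
by apply: measurableT_comp; [exact: continuous_measurable_fun (@continuous_cos R)|exact: measurable_phase].
Qed.

Lemma is_trig_measurable F : is_trig F -> measurable_fun setT F.
Proof. by case/is_trig_normal => u [A [B [_ -> _]]]; exact: measurable_trig_re. Qed.

Lemma is_trig_bounded F : is_trig F -> exists M, forall p, `|F p| <= M.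
Proof.
case/is_trig_normal => u [A [B [_ -> _]]]; exists (\sum_(z <- u) (`|A z| + `|B z|)) => p.
apply: le_trans (ler_norm_sum _ _ _) _; apply: ler_sum => z _.
rewrite (le_trans (ler_normB _ _))// !normrM lerD// ler_piMr// ?cos_max ?sin_max//.
Qed.

End TrigClass.

Section TruncTrig.
Variable R : realType.
Notation leb := (@lebesgue_measure R).
Notation mu := (mu2 R).

(** The first frequency contributes a linear monomial, hence one exponent more; the constant
    disappears on differentiation. *)
Lemma sparse_phase_poly k (l : R) (q : {poly R}) z c : sparse k ('X * q^`()) ->
  sparse k.+1 ('X * (phase_poly l q z - c%:P)^`()).
Proof.
move=> [s sk sq]; exists (1%N :: s) => //.
move=> i; rewrite derivB derivC subr0 derivD !derivZ derivX mulrDr -!scalerAr mulr1.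
rewrite coefD !coefZ coefX inE; case: (i == 1%N) => //=.
by rewrite mulr0n mulr0 add0r mulf_eq0 negb_or => /andP[_ /sq].
Qed.

Variables (k : nat) (q : {poly R}) (Bd : R).
Hypothesis sq : sparse k ('X * q^`()).
Hypothesis oscB : forall P a b, sparse k.+1 ('X * P^`()) -> 0 < a -> a <= b ->
  `|osc_sym P a b| <= Bd.

(** Parseval's identity before and after the multiplier. The factor 2 comes from bounding real and
    imaginary parts of the symbol separately by [Bd]. *)
Lemma trig_trunc_bound l F a b : 0 < l -> is_trig l F -> 0 < a -> a <= b ->
  (sqint mu (cell l) (trunc q a b F) <= (2 * Bd ^+ 2)%:E * sqint mu (cell l) F)%E.
Proof.
move=> l0 tF a0 ab; have [u [A [B [uu FE F0]]]] := is_trig_normal tF.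
have mc := measurable_cell l.
set A' := fun z => A z * mult_re l q a b z + B z * mult_im l q a b z.
set B' := fun z => B z * mult_re l q a b z - A z * mult_im l q a b z.
have TE : trunc q a b F = trig_re l u A' B'.
  by rewrite FE; apply/funext => p; exact: trunc_trig_re.
have [i1 e1] := parseval l0 A B uu.
have [i2 e2] := parseval l0 A' B' uu.
have toE (G : R * R -> R) : (forall p, 0 <= G p) -> mu.-integrable (cell l) (EFin \o G) ->
    (\int[mu]_(p in cell l) (G p)%:E = (\int[mu]_(p in cell l) G p)%:E)%E.
  by move=> G0 iG; rewrite /Rintegral fineK//; exact: (@integrable_fin_num _ _ _ mu _ mc _ iG).
have S1 : sqint mu (cell l) F = ((2 * (pi * l)) ^+ 2 * \sum_(z <- u) (A z ^+ 2 + B z ^+ 2))%:E.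
  rewrite -e1 -toE//; last by move=> p; rewrite addr_ge0 ?sqr_ge0.
  by apply: eq_integral => p _; rewrite FE F0 expr0n/= addr0.
have S2 : (sqint mu (cell l) (trunc q a b F) <=
   ((2 * (pi * l)) ^+ 2 * \sum_(z <- u) (A' z ^+ 2 + B' z ^+ 2))%:E)%E.
  rewrite -e2 -toE//; last by move=> p; rewrite addr_ge0 ?sqr_ge0.
  apply: ge0_le_integral => //.
  - by move=> p _; rewrite lee_fin sqr_ge0.
  - by apply: measurable_sq; rewrite TE; apply: measurable_funTS; exact: measurable_trig_re.
  - apply/measurable_EFinP; apply: measurable_funTS; apply: measurable_funD; apply: measurable_funX.
      exact: measurable_trig_re.
    exact: measurable_trig_im.
  - by move=> p _; rewrite lee_fin TE lerDl sqr_ge0.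
apply: (le_trans S2); rewrite S1 -EFinM lee_fin [leRHS]mulrCA ler_wpM2l ?sqr_ge0//.
rewrite mulr_sumr; apply: ler_sum => z _.
have h1 : mult_re l q a b z ^+ 2 <= Bd ^+ 2.
  rewrite -(real_normK (num_real _)) lerXn2r ?nnegrE//; last first.
    apply: oscB => //; have := @sparse_phase_poly k l q z 0 sq; by rewrite subr0.
  apply: le_trans (normr_ge0 _) (oscB (P := phase_poly l q z) _ a0 ab).
  by have := @sparse_phase_poly k l q z 0 sq; rewrite subr0.
have h2 : mult_im l q a b z ^+ 2 <= Bd ^+ 2.
  have h3 := oscB (@sparse_phase_poly k l q z (pi / 2) sq) a0 ab.
  by rewrite -(real_normK (num_real _)) lerXn2r ?nnegrE// (le_trans _ h3).
have -> : A' z ^+ 2 + B' z ^+ 2 =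
    (mult_re l q a b z ^+ 2 + mult_im l q a b z ^+ 2) * (A z ^+ 2 + B z ^+ 2).
  by rewrite /A' /B'; ring.
by rewrite ler_wpM2r ?addr_ge0 ?sqr_ge0//; lra.
Qed.

Lemma trunc_integrable_bounded a b (F : R * R -> R) M p : 0 < a -> measurable_fun setT F ->
  (forall p, `|F p| <= M) -> trunc_integrable q a b F p.
Proof.
move=> a0 mF FM.
have mab : measurable (`[a, b]%classic : set (measurableTypeR R)) by exact: measurable_itv.
have fin : (leb `[a, b] < +oo)%E.
  by rewrite lebesgue_measure_itv/=; case: ifP; rewrite ?ltry// -EFinD ltry.
apply: (@bounded_integrable _ _ _ leb _ _ (2 * M / a) mab fin).
  apply: measurable_funTS; apply: measurable_funM; last exact: measurable_invr.
  exact: measurable_odd_diff1.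
move=> t; rewrite /= in_itv/= => /andP[at_ _].
have t0 : 0 < t by exact: lt_le_trans at_.
rewrite normrM normfV (gtr0_norm t0) ler_pM ?invr_ge0 ?(ltW t0)//; last by rewrite lef_pV2 ?posrE.
by rewrite (le_trans (ler_normB _ _))// mulr2n mulrDl mul1r lerD.
Qed.

End TruncTrig.

(** * Trigonometric approximation *)

Section Threshold.
Variable R : realType.
Implicit Types h r x : R.

Lemma bernoulli_ge x m : 0 <= x <= 1 -> 1 - m%:R * x <= (1 - x) ^+ m.
Proof.
move=> /andP[x0 x1]; elim: m => [|m IH]; first by rewrite mul0r subr0 expr0.
rewrite exprS -natr1; have := ler_wpM2l (_ : 0 <= 1 - x) IH.
rewrite subr_ge0 => /(_ x1); apply: le_trans.
have : 0 <= m%:R * x * x by rewrite !mulr_ge0.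
by lra.
Qed.

Lemma bernoulli_le x m : 0 <= x <= 1 -> (1 - x) ^+ m * (1 + m%:R * x) <= 1.
Proof.
move=> /andP[x0 x1].
have H : 1 + m%:R * x <= (1 + x) ^+ m.
  elim: m => [|m IH]; first by rewrite mul0r addr0 expr0.
  rewrite exprS -natr1; have := ler_wpM2l (_ : 0 <= 1 + x) IH.
  rewrite addr_ge0// => /(_ isT); apply: le_trans.
  have : 0 <= m%:R * x * x by rewrite !mulr_ge0.
  by lra.
apply: le_trans (_ : (1 - x) ^+ m * (1 + x) ^+ m <= 1).
  by rewrite ler_wpM2l// exprn_ge0// subr_ge0.
rewrite -exprMn exprn_ile1//; last by nra.
by rewrite mulr_ge0 ?subr_ge0// addr_ge0.
Qed.

(* Brosowski-Deutsch: as [n] grows these polynomials in [h] tend to [0] below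
   the level [r] and to [1] above it. *)
Definition sharpen r n h : R := 1 - (1 - h ^+ n) ^+ Num.truncn (r ^- n).

Lemma sharpen_bound r n h : 0 <= h <= 1 -> 0 <= sharpen r n h <= 1.
Proof.
move=> /andP[h0 h1]; rewrite /sharpen.
have a : 0 <= 1 - h ^+ n by rewrite subr_ge0 exprn_ile1.
have b : 1 - h ^+ n <= 1 by rewrite gerBl exprn_ge0.
by rewrite subr_ge0 exprn_ile1//= gerBl exprn_ge0.
Qed.

(** By Bernoulli's inequality [sharpen r n h] is at most r^-n h^n. *)
Lemma sharpen_cvg0 r h : 0 <= h -> h < r -> r <= 1 -> sharpen r n h @[n --> \oo] --> (0 : R).
Proof.
move=> h0 hr r1; have r0 : 0 < r by exact: le_lt_trans hr.
have g0 : (h / r) ^+ n @[n --> \oo] --> (0 : R).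
  by apply: cvg_expr; rewrite ger0_norm ?divr_ge0 ?(ltW r0)// ltr_pdivrMr// mul1r.
apply: (@squeeze_cvgr _ _ _ _ (cst 0) (fun n => (h / r) ^+ n)) => //; last exact: cvg_cst.
apply: nearW => n.
have h01 : 0 <= h <= 1 by rewrite h0 (le_trans (ltW hr)).
have /andP[-> _] := sharpen_bound r n h01; rewrite /sharpen /=.
have hn : 0 <= h ^+ n <= 1 by rewrite exprn_ge0// exprn_ile1//; case/andP: h01.
have := bernoulli_ge (Num.truncn (r ^- n)) hn.
have rn0 : 0 <= r ^- n by rewrite invr_ge0 exprn_ge0// ltW.
have := truncn_itv rn0 => /andP[tr _].
have := ler_wpM2r (exprn_ge0 n h0) tr.
rewrite expr_div_n [r ^- n * _]mulrC.
by lra.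
Qed.

(** With m the truncated exponent, (1 - h^n)^m is at most 1 / (1 + m h^n). Since r^-n < m + 1 and
    h^n <= 1, this is at most (r / h)^n: the unit lost by truncation is absorbed by the 1. *)
Lemma sharpen_cvg1 r h : 0 < r -> r < h -> h <= 1 -> sharpen r n h @[n --> \oo] --> (1 : R).
Proof.
move=> r0 rh h1; have h0 : 0 < h by exact: lt_trans rh.
have g0 : 1 - (r / h) ^+ n @[n --> \oo] --> (1 : R).
  rewrite -[X in _ --> X]subr0; apply: cvgB; first exact: cvg_cst.
  by apply: cvg_expr; rewrite ger0_norm ?divr_ge0 ?(ltW r0)// ?(ltW h0)// ltr_pdivrMr// mul1r.
apply: (@squeeze_cvgr _ _ _ _ (fun n => 1 - (r / h) ^+ n) (cst 1)) => //; last exact: cvg_cst.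
apply: nearW => n.
have h01 : 0 <= h <= 1 by rewrite (ltW h0).
have /andP[_ ->] := sharpen_bound r n h01; rewrite andbT /sharpen lerD2l lerN2.
have hn : 0 <= h ^+ n <= 1 by rewrite exprn_ge0 ?exprn_ile1// ltW.
have := bernoulli_le (Num.truncn (r ^- n)) hn.
have rn0 : 0 <= r ^- n by rewrite invr_ge0 exprn_ge0// ltW.
have := truncn_itv rn0 => /andP[_]; rewrite -natr1.
set m := (Num.truncn _)%:R; set e := (1 - h ^+ n) ^+ _ => tr le1.
have e0 : 0 <= e by rewrite exprn_ge0// subr_ge0; case/andP: hn.
have H : (h / r) ^+ n <= 1 + m * h ^+ n.
  have := ler_wpM2r (exprn_ge0 n (ltW h0)) (ltW tr).
  rewrite expr_div_n [r ^- n * _]mulrC; case/andP: hn => *; lra.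
have hr0 : 0 < (h / r) ^+ n by rewrite exprn_gt0// divr_gt0.
have -> : (r / h) ^+ n = ((h / r) ^+ n)^-1 by rewrite -exprVn invf_div.
rewrite -[leRHS]mul1r ler_pdivlMr//.
by apply: le_trans le1; rewrite ler_wpM2l.
Qed.

End Threshold.

Section BoxApproximation.
Variable R : realType.
Notation leb := (@lebesgue_measure R).
Notation mu := (mu2 R).
Variables (l : R) (l0 : 0 < l).

Notation half := (pi * l).

(** A trigonometric polynomial with values in [0, 1] that decreases with the distance to [c] up to
    half a period; intervals arise as its superlevel sets. *)
Definition bump (c x : R) : R := (1 + cos ((x - c) / l)) / 2.

Lemma bump01 c x : 0 <= bump c x <= 1.
Proof.
have := cos_geN1 ((x - c) / l); have := cos_le1 ((x - c) / l).
by rewrite /bump => h1 h2; apply/andP; split; lra.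
Qed.

(** A difference of cosines as a product of sines: within one period the signs of the two factors
    locate x with respect to al and be. *)
Lemma bump_level (al be x : R) :
  bump ((al + be) / 2) x - bump ((al + be) / 2) be =
  sin ((x - al) / (2 * l)) * sin ((be - x) / (2 * l)).
Proof.
pose y := (x - (al + be) / 2) / l; pose th := (be - (al + be) / 2) / l.
have e1 : (x - al) / (2 * l) = (th + y) / 2 by rewrite /th /y; field; rewrite gt_eqF.
have e2 : (be - x) / (2 * l) = (th - y) / 2 by rewrite /th /y; field; rewrite gt_eqF.
have : cos y - cos th = 2 * (sin ((th + y) / 2) * sin ((th - y) / 2)).
  have -> : cos y = cos ((th + y) / 2 - (th - y) / 2) by congr cos; field.
  have -> : cos th = cos ((th + y) / 2 + (th - y) / 2) by congr cos; field.
  by rewrite cosB cosD; ring.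
by rewrite e1 e2 /bump -/y -/th; lra.
Qed.

Definition axis_trig (f : R -> R) :=
  is_trig l (fun p => f p.1) /\ is_trig l (fun p => f p.2).

Lemma axis_trig_bump c : axis_trig (bump c).
Proof.
have H z : is_trig l (fun p => (1 + cos (phase l z p - c / l)) * 2^-1).
  apply: is_trigM (is_trig_cst _ _) => //; apply: is_trigD; first exact: is_trig_cst.
  exact: is_trig_cos.
split; [have := H (1, 0)|have := H (0, 1)]; congr is_trig; apply/funext => p.
- by rewrite /bump /phase /= mulr1z mulr0z mul1r mul0r addr0 -mulrBl.
- by rewrite /bump /phase /= mulr1z mulr0z mul1r mul0r add0r -mulrBl.
Qed.

Lemma axis_trig_sharpen r n f : axis_trig f -> axis_trig (fun x => sharpen r n (f x)).
Proof.
have H F : is_trig l F -> is_trig l (fun p => sharpen r n (F p)).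
  move=> tF; have t1 := is_trigX l0 n tF.
  have t2 := is_trigD (is_trig_cst l 1) (is_trigZ l0 (-1) t1).
  have t3 := is_trigD (is_trig_cst l 1) (is_trigZ l0 (-1) (is_trigX l0 (Num.truncn (r ^- n)) t2)).
  by move: t3; congr is_trig; apply/funext => p; rewrite /sharpen /= !mulN1r.
by move=> [/H t1 /H t2]; split.
Qed.

(** A bump centred at the midpoint is sharpened at its value at the endpoints. Excluded are the
    endpoints, where it meets the threshold exactly, and [half], which periodicity identifies with
    [- half]. *)
Lemma interval_approx (a b : R) : exists (w : nat -> R -> R) (al be : R),
  [/\ forall n, axis_trig (w n), forall n x, `|w n x| <= 1
   & forall x, - half < x <= half -> x != al -> x != be -> x != half ->
       w n x @[n --> \oo] --> (\1_(`]a, b]%classic) x : R)].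
Proof.
have h0 : 0 < half := half_period_gt0 l0.
pose al := Num.max a (- half); pose be := Num.min b half.
have inE' x : - half < x <= half -> \1_(`]a, b]%classic) x = ((al < x <= be)%R)%:R :> R.
  move=> /andP[x1 x2]; rewrite indicE; congr (_%:R : R); congr nat_of_bool.
  by rewrite mem_setE in_itv/= /al /be gt_max x1 andbT le_min x2 andbT.
have [bal|alb] := leP be al.
  exists (fun _ _ => 0), al, be; split.
  - by move=> _; split; exact: is_trig_cst.
  - by move=> _ x; rewrite normr0.
  - move=> x xp _ _ _; rewrite inE' //; have -> : (al < x <= be) = false.
      by apply/negP => /andP[h1 h2]; move: (lt_le_trans h1 h2); rewrite ltNge bal.
    exact: cvg_cst.
have alge : - half <= al by rewrite le_max lexx orbT.
have bele : be <= half by rewrite ge_min lexx orbT.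
(* If the interval fills the period, the threshold [r] below would be 0 and nothing could be
   sharpened; the constant 1 serves instead. *)
have [full|nfull] := leP (2 * half) (be - al).
  exists (fun _ _ => 1), al, be; split.
  - by move=> _; split; exact: is_trig_cst.
  - by move=> _ x; rewrite normr1.
  - move=> x /[dup] xp /andP[x1 x2] _ _ _; rewrite inE' //; have -> : al < x <= be by apply/andP; split; lra.
    exact: cvg_cst.
pose c := (al + be) / 2; pose th := (be - c) / l.
have thE : th = (be - al) / 2 / l by rewrite /th /c; field; rewrite gt_eqF.
have th0 : 0 < th by rewrite thE !divr_gt0// subr_gt0.
have thpi : th < pi by rewrite thE ltr_pdivrMr//; lra.
have sth : 0 < sin th by apply: sin_gt0_pi; rewrite th0.
pose r := bump c be.
have r0 : 0 < r.
  have h : -1 != cos th.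
    apply/eqP => h; have := cos2Dsin2 th; rewrite -h sqrrN expr1n.
    by move=> /eqP; rewrite -subr_eq0 addrAC subrr add0r sqrf_eq0 gt_eqF.
  have : -1 < cos th by rewrite lt_neqAle h cos_geN1.
  by rewrite /r /bump -/th; lra.
have r1 : r <= 1 by have /andP[] := bump01 c be.
exists (fun n x => sharpen r n (bump c x)), al, be; split.
- by move=> n; apply: axis_trig_sharpen; exact: axis_trig_bump.
- by move=> n x; have /andP[s0 s1] := sharpen_bound r n (bump01 c x); rewrite ger0_norm.
move=> x /[dup] xp /andP[x1 x2] xal xbe xh; rewrite inE'//.
have x2' : x < half by rewrite lt_neqAle xh.
have /andP[b0 b1] := bump01 c x.
have lev := bump_level al be x; rewrite -/c -/r in lev.
have l2 : 0 < 2 * l by rewrite mulr_gt0.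
have spos y : 0 < y < 2 * half -> 0 < sin (y / (2 * l)).
  by move=> /andP[y0 y1]; apply: sin_gt0_pi; rewrite divr_gt0//= ltr_pdivrMr//; lra.
have [xla|alx] := ltP x al.
  have -> /= : (al < x) = false by apply/negbTE; rewrite -leNgt ltW.
  apply: sharpen_cvg0 => //; rewrite -subr_lt0 lev.
  have s1 : sin ((x - al) / (2 * l)) < 0.
    rewrite -(opprB al x) mulNr sinN oppr_lt0 spos//; apply/andP; split; lra.
  by rewrite nmulr_rlt0// spos//; apply/andP; split; lra.
have {}alx : al < x by rewrite lt_neqAle eq_sym xal.
have [xlb|bex] := ltP x be.
  rewrite alx (ltW xlb) /=; apply: sharpen_cvg1 => //; rewrite -subr_gt0 lev.
  by rewrite mulr_gt0// spos//; apply/andP; split; lra.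
have {}bex : be < x by rewrite lt_neqAle eq_sym xbe.
rewrite alx /= leNgt bex /=.
apply: sharpen_cvg0 => //; rewrite -subr_lt0 lev.
have s1 : sin ((be - x) / (2 * l)) < 0.
  rewrite -(opprB x be) mulNr sinN oppr_lt0 spos//; apply/andP; split; lra.
by rewrite pmulr_rlt0// spos//; apply/andP; split; lra.
Qed.

Lemma line_null (e : R) : mu ([set e] `*` setT) = 0%E /\ mu (setT `*` [set e]) = 0%E.
Proof.
split; rewrite product_measure1E//= ?lebesgue_measure_set1 ?mul0e ?mule0//.
Qed.

Lemma box_approx (a b c d e : R) : 0 < e ->
  exists F, is_trig l F /\ (sqint mu (cell l) (F \- \1_(box a b c d))%R <= e%:E)%E.
Proof.
move=> e0; have [w1 [al1 [be1 [t1 n1 c1]]]] := interval_approx a b.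
have [w2 [al2 [be2 [t2 n2 c2]]]] := interval_approx c d.
have mc := measurable_cell l; have mb := measurable_box a b c d.
pose F n p : R := w1 n p.1 * w2 n p.2.
have tF n : is_trig l (F n) by apply: is_trigM => //; [exact: (t1 n).1|exact: (t2 n).2].
pose I : R * R -> R := \1_(cell l).
have mI : measurable_fun setT I by exact: measurable_indic.
pose B : R * R -> R := \1_(box a b c d).
have mB : measurable_fun setT B by exact: measurable_indic.
have H : L2lim mu (fun n p => F n p * I p) (fun p => B p * I p).
  apply: (@dominated_L2lim_ae _ _ _ mu _ _ I).
  - by move=> n; apply: measurable_funM => //; exact: is_trig_measurable (tF n).
  - exact: measurable_funM.
  - exact: mI.
  - by rewrite sqint_indic// setTI; exact: cell_lty.
    (* Convergence can fail only on finitely many lines parallel to the axes, which are null. *)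
    pose N (x : R) : set (R * R) := ([set x] `*` setT) `|` (setT `*` [set x]).
    have negN x : mu.-negligible (N x).
      have [h1 h2] := line_null x; apply: negligibleU.
        by exists ([set x] `*` setT); split => //; exact: measurableX.
      by exists (setT `*` [set x]); split => //; exact: measurableX.
    have neg : mu.-negligible (N al1 `|` N be1 `|` N al2 `|` N be2 `|` N half).
      by apply: negligibleU => //; apply: negligibleU => //; apply: negligibleU => //; apply: negligibleU.
    apply: negligibleS neg => -[x y] /= nc; apply: contrapT => nE; apply: nc.
    have [Ip|Ip] := pselect (cell l (x, y)); last first.
      rewrite /I indicE memNset// mulr0; under eq_fun do rewrite mulr0.
      exact: cvg_cst.
    rewrite /I indicE mem_set// mulr1; under eq_fun do rewrite mulr1.
    have [/= px py] : (- half < x <= half) /\ (- half < y <= half).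
      by move: Ip; rewrite /cell /box /= !in_itv.
    have NE z : (N z `<=` N al1 `|` N be1 `|` N al2 `|` N be2 `|` N half) -> x != z /\ y != z.
      by move=> Nz; split; apply/eqP => xz; apply: nE; apply: Nz; [left|right]; rewrite /= xz.
    have [a1 _] : x != al1 /\ y != al1 by apply: NE => p; rewrite /setU/=; tauto.
    have [a2 _] : x != be1 /\ y != be1 by apply: NE => p; rewrite /setU/=; tauto.
    have [_ a3] : x != al2 /\ y != al2 by apply: NE => p; rewrite /setU/=; tauto.
    have [_ a4] : x != be2 /\ y != be2 by apply: NE => p; rewrite /setU/=; tauto.
    have [a5 a6] : x != half /\ y != half by apply: NE => p; rewrite /setU/=; tauto.
    rewrite /F /B (_ : \1_(box a b c d) (x, y) = \1_(`]a, b]%classic) x * \1_(`]c, d]%classic) y).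
      by apply: cvgM; [exact: c1|exact: c2].
    by rewrite !indicE in_setX/= -mulnb natrM.
  - move=> n p; rewrite /I indicE; case: (_ \in _); rewrite ?mulr0 ?normr0// mulr1 /F normrM.
    by rewrite -[1%:R]mulr1 ler_pM.
  - move=> p; rewrite /I /B !indicE; case: (_ \in cell l); case: (_ \in _); rewrite ?mulr0 ?mulr1 ?normr0 ?normr1//.
have [n _ /(_ n (leqnn n)) Hn] := H e e0.
exists (F n); split => //; apply: le_trans Hn.
apply: eq_leW.
rewrite /sqint integral_mkcond epatch_indic; apply: eq_integral => p _ /=.
rewrite -EFinM -mulrBl exprMn; congr (_%:E); rewrite -/(B p) -/(I p).
by congr (_ * _); rewrite /I indicE; case: (_ \in _); rewrite ?expr1n ?expr0n.
Qed.

(** The error is measured on one cell only, [F] being periodic. *)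
Definition trig_approx (f : R * R -> R) := forall e, 0 < e ->
  exists F, is_trig l F /\ (sqint mu (cell l) (F \- f)%R <= e%:E)%E.

Lemma L2r_trig_approx f : L2r f -> trig_approx f.
Proof.
have mc := measurable_cell l.
have mdiff F g : is_trig l F -> measurable_fun setT g -> measurable_fun (cell l) (F \- g).
  by move=> tF mg; apply: measurable_funTS; apply: measurable_funB => //; exact: is_trig_measurable tF.
suff : L2r f -> L2r f /\ trig_approx f by move=> H /H[].
apply: (@L2_ind _ (fun f => L2r f /\ trig_approx f)).
- move=> a b c d; split; last by move=> e; exact: box_approx.
  by apply: L2r_indic; [exact: measurable_box|exact: box_lty].
- move=> c g h [Lg Hg] [Lh Hh]; split; first exact: L2r_lin.
  move=> e e0.
  have c0 : 0 < 1 + c ^+ 2 by have := sqr_ge0 c; lra.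
  have eps1 : 0 < e / 4 / (1 + c ^+ 2) by rewrite !divr_gt0.
  have eps2 : 0 < e / 4 by rewrite divr_gt0.
  have [F [tF HF]] := Hg _ eps1; have [G [tG HG]] := Hh _ eps2.
  exists (fun p => c * F p + G p); split.
    by apply: is_trigD => //; exact: is_trigZ.
  have -> : ((fun p => c * F p + G p) \- (fun p => c * g p + h p))%R =
    ((fun p => c * (F \- g)%R p) \+ (G \- h))%R by apply/funext => p /=; ring.
  have m1 := mdiff _ _ tF Lg.1; have m2 := mdiff _ _ tG Lh.1.
  apply: le_trans (sqintD mu mc (measurable_funM (measurable_cst c) m1) m2) _.
  rewrite sqintZ//.
  apply: le_trans (_ : 2%:E * ((c ^+ 2)%:E * (e / 4 / (1 + c ^+ 2))%:E) + 2%:E * (e / 4)%:E <= _)%E.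
    by rewrite leeD// lee_wpmul2l ?lee_fin// lee_wpmul2l ?lee_fin ?sqr_ge0.
  rewrite -!EFinM -EFinD lee_fin.
  have : c ^+ 2 * (e / 4 / (1 + c ^+ 2)) <= e / 4.
    by rewrite mulrCA ler_piMr ?(ltW eps2)// ler_pdivrMr// mul1r lerDr.
  lra.
- move=> g Lg Hg; split => // e e0.
  have e4 : 0 < e / 4 by rewrite divr_gt0.
  have [h [Lh [_ Hh] hg]] := Hg _ e4; have [F [tF HF]] := Hh _ e4.
  exists F; split => //.
  have -> : (F \- g)%R = ((F \- h) \+ (h \- g))%R by apply/funext => p /=; ring.
  have m1 := mdiff _ _ tF Lh.1.
  have m2 : measurable_fun (cell l) (h \- g) by apply: measurable_funTS; exact: measurable_funB Lh.1 Lg.1.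
  apply: le_trans (sqintD mu mc m1 m2) _.
  apply: le_trans (_ : 2%:E * (e / 4)%:E + 2%:E * (e / 4)%:E <= _)%E.
    rewrite leeD// lee_wpmul2l ?lee_fin//; apply: le_trans hg.
    by apply: sqint_subset => //; exact: measurable_funB Lh.1 Lg.1.
  by rewrite -!EFinM -EFinD lee_fin; lra.
Qed.

End BoxApproximation.

(** * The uniform bound *)

Section TruncBound.
Variable R : realType.
Notation leb := (@lebesgue_measure R).
Notation mu := (mu2 R).
Variables (k : nat) (q : {poly R}) (Bd : R).
Hypothesis sq : sparse k ('X * q^`()).
Hypothesis oscB : forall P a b, sparse k.+1 ('X * P^`()) -> 0 < a -> a <= b ->
  `|osc_sym P a b| <= Bd.
Implicit Types f : R * R -> R.

Notation square M := (box (- M) M (- M) M).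

(* Transference: on a bounded square and for bounded [t] the curve stays in a
   large period cell, where [f] is close to a trigonometric polynomial. *)
Lemma sqint_trunc_square a b M f : 0 < a -> a <= b -> L2r f ->
  (sqint mu (square M) (trunc q a b f) <= (8 * Bd ^+ 2)%:E * sqint mu setT f)%E.
Proof.
move=> a0 ab [mf sf]; have b0 : 0 < b by exact: lt_le_trans ab.
have [K HK] := poly_itv_bound q (- b) b.
(* Half the side of the cell: room for the square, a horizontal move of at most [b] and a vertical
   one of at most [K]. *)
pose L := `|M| + b + `|K| + 1; have L0 : 0 < L.
  by rewrite /L; have := normr_ge0 M; have := normr_ge0 K; lra.
pose l := L / pi; have l0 : 0 < l by rewrite divr_gt0// pi_gt0.
have piL : pi * l = L by rewrite /l mulrC divfK// gt_eqF// pi_gt0.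
have mc := measurable_cell l; have ms : measurable (square M) := measurable_box _ _ _ _.
have inc p t : square M p -> - b <= t <= b -> cell l (shift_curve q t p).
  move=> [/=]; rewrite !in_itv/= => /andP[p1 p2] /andP[p3 p4] /[dup] tb /andP[t1 t2].
  have := HK t tb; rewrite ler_norml => /andP[q1 q2].
  rewrite /cell /box /shift_curve /= !in_itv/= piL /L.
  have := ler_norm M; have := ler_norm K; move=> hK hM.
  by split; apply/andP; split; lra.
have sqc : square M `<=` cell l.
  by move=> p sp; have := inc p 0 sp; rewrite /cell /box /= !in_itv/= piL /L;
    move: sp; rewrite /box /= !in_itv/= => -[/andP[p1 p2] /andP[p3 p4]] _;
    have := ler_norm M; have := normr_ge0 K; move=> hK hM;
    split; apply/andP; split; lra.
pose S := fine (sqint mu setT f).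
have SE : sqint mu setT f = S%:E by rewrite fineK// ge0_fin_numE ?sqint_ge0.
have S0 : 0 <= S by rewrite fine_ge0// sqint_ge0.
pose Kab := ((b - a) / a) ^+ 2 * 4.
have Kab0 : 0 <= Kab by rewrite mulr_ge0// sqr_ge0.
have cB0 : 0 <= Bd ^+ 2 := sqr_ge0 Bd.
(* The error [e / A] ends up with coefficient 2 Kab through the remainder and 8 Bd^2 through [F].
   The 8 is 2 Bd^2 with a factor 2 for each of the splittings f = g + F (on the square) and F = (F -
   f) + f. *)
pose A := 2 * Kab + 8 * Bd ^+ 2 + 1; have A0 : 0 < A by rewrite /A; lra.
rewrite SE -EFinM; apply/lee_addgt0Pr => e e0.
have eA : 0 < e / A by rewrite divr_gt0.
have [F [tF HF]] := L2r_trig_approx l0 (conj mf sf) eA.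
have mF := is_trig_measurable tF.
(* Cut off to the cell, the remainder is small on the whole plane, where the crude bound applies;
   seen from the square the cut-off is invisible, since the curve stays in the cell. *)
pose g p := \1_(cell l) p * (f p - F p).
have mI : measurable_fun setT (\1_(cell l) : R * R -> R) by exact: measurable_indic.
have mfF : measurable_fun setT (f \- F)%R by exact: measurable_funB.
have mg : measurable_fun setT g by exact: measurable_funM.
have sg : (sqint mu setT g <= (e / A)%:E)%E.
  apply: le_trans HF; apply: eq_leW.
  rewrite sqintC /sqint [RHS]integral_mkcond epatch_indic; apply: eq_integral => p _ /=.
  rewrite /g -EFinM exprMn mulrC; congr (_ * _)%:E.
  by rewrite indicE; case: (_ \in _); rewrite ?expr1n ?expr0n.
have Lg : L2r g by split => //; apply: le_lt_trans sg _; rewrite ltry.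
have [N NF] := is_trig_bounded tF.
have mT h : measurable_fun setT h -> measurable_fun setT (trunc q a b h) by exact: measurable_trunc.
have -> : sqint mu (square M) (trunc q a b f) =
    sqint mu (square M) (trunc q a b g \+ trunc q a b F)%R.
  apply: (ae_eq_sqint_in (mu := mu)) => //; first exact: mT.
    by apply: measurable_funD; exact: mT.
  apply: negligibleS (trunc_integrable_ae q a0 ab Lg) => p; apply: contra_not => ip sp /=.
  have iF := trunc_integrable_bounded q b p a0 mF NF.
  have := trunc_lin 1 ip iF; rewrite mul1r => <-.
  apply: eq_Rintegral => t; rewrite inE /= in_itv/= => /andP[at_ tb].
  congr (_ / _); rewrite /odd_diff /g.
  have i1 : cell l (shift_curve q t p) by apply: inc => //; apply/andP; split; lra.
  have i2 : cell l (shift_curve q (- t) p) by apply: inc => //; apply/andP; split; lra.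
  by rewrite !indicE !mem_set// !mul1r; ring.
apply: le_trans (sqintD mu ms (measurable_funTS (mT _ mg)) (measurable_funTS (mT _ mF))) _.
have b1 : (sqint mu (square M) (trunc q a b g) <= (Kab * (e / A))%:E)%E.
  apply: le_trans (sqint_subset mu ms measurableT (@subsetT _ _) (mT _ mg)) _.
  apply: le_trans (sqint_trunc_crude q a0 ab mg) _.
  by rewrite muleA -EFinM [X in (_ <= X)%E]EFinM lee_wpmul2l// lee_fin.
have b2 : (sqint mu (cell l) F <= (2 * (e / A) + 2 * S)%:E)%E.
  have -> : F = ((F \- f) \+ f)%R by apply/funext => p /=; ring.
  apply: le_trans (sqintD mu mc _ (measurable_funTS mf)) _.
    by apply: measurable_funTS; exact: measurable_funB.
  apply: le_trans (_ : 2%:E * (e / A)%:E + 2%:E * S%:E <= _)%E; last by rewrite -!EFinM -EFinD.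
  rewrite leeD// lee_wpmul2l//.
  rewrite -SE; exact: (sqint_subset mu mc measurableT (@subsetT _ _) mf).
have b3 : (sqint mu (square M) (trunc q a b F) <= (2 * Bd ^+ 2 * (2 * (e / A) + 2 * S))%:E)%E.
  apply: le_trans (sqint_subset mu ms mc sqc (measurable_funTS (mT _ mF))) _.
  apply: le_trans (trig_trunc_bound sq oscB l0 tF a0 ab) _.
  apply: le_trans (_ : (2 * Bd ^+ 2)%:E * (2 * (e / A) + 2 * S)%:E <= _)%E; last by rewrite -EFinM.
  by rewrite lee_wpmul2l// lee_fin mulr_ge0.
apply: le_trans (_ : 2%:E * (Kab * (e / A))%:E +
  2%:E * (2 * Bd ^+ 2 * (2 * (e / A) + 2 * S))%:E <= _)%E.
  by rewrite leeD// lee_wpmul2l.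
rewrite -!EFinM -!EFinD lee_fin.
have ue : A * (e / A) = e by rewrite mulrC divfK// gt_eqF.
rewrite -[X in _ <= _ + X]ue; move: (e / A) (ltW eA) => u u0; rewrite /A; lra.
Qed.

Lemma sqint_trunc_bound a b f : 0 < a -> a <= b -> L2r f ->
  (sqint mu setT (trunc q a b f) <= (8 * Bd ^+ 2)%:E * sqint mu setT f)%E.
Proof.
move=> a0 ab Lf; have mT := measurable_trunc q a b Lf.1.
have mI n : measurable_fun setT (\1_(square n%:R) : R * R -> R).
  by apply: measurable_indic; exact: measurable_box.
apply: (@fatou_bound _ _ _ mu setT
  (fun n p => ((trunc q a b f p * \1_(square n%:R) p) ^+ 2)%:E)) => //.
- by move=> n; apply: measurable_sq; exact: (measurable_funM mT (mI n)).
- by move=> n p _; rewrite lee_fin sqr_ge0.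
- move=> p _; apply: cvg_near_cst; near=> n; rewrite indicE mem_set ?mulr1//.
  rewrite /box /=.
  have h1 : `|p.1| < n%:R by near: n; exact: nbhs_infty_gtr.
  have h2 : `|p.2| < n%:R by near: n; exact: nbhs_infty_gtr.
  by move: h1 h2; rewrite !ltr_norml !in_itv/= => /andP[-> /ltW ->] /andP[-> /ltW ->].
- apply: nearW => n; apply: le_trans (sqint_trunc_square n%:R a0 ab Lf).
  apply: eq_leW.
  rewrite /sqint [RHS]integral_mkcond epatch_indic; apply: eq_integral => p _ /=.
  rewrite -EFinM exprMn; congr (_ * _)%:E.
  by rewrite indicE; case: (_ \in _); rewrite ?expr1n ?expr0n.
Unshelve. all: by end_near. Qed.

End TruncBound.

(** * Convergence of the truncations *)

Section BoxShells.
Variables (R : realType) (q : {poly R}).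
Notation leb := (@lebesgue_measure R).
Notation mu := (mu2 R).
Hypothesis q0 : q.[0] = 0.
Implicit Types (a b c d t : R) (p : R * R).

Lemma mu_box a b c d : a <= b -> c <= d -> mu (box a b c d) = ((b - a) * (d - c))%:E.
Proof.
have H (u v : R) : u <= v -> leb `]u, v] = (v - u)%:E.
  move=> uv; rewrite lebesgue_measure_itv/= lte_fin; case: ltP => // vu.
  by have -> : v = u by [apply/eqP; rewrite eq_le uv vu]; rewrite subrr.
move=> ab cd; rewrite product_measure1E//= EFinM.
by congr (_ * _)%E; exact: H.
Qed.

Lemma horner_le_linear : exists2 K, 0 <= K & forall t, `|t| <= 1 -> `|q.[t]| <= K * `|t|.
Proof.
have /factor_theorem[r qE] : root q 0 by apply/rootP.
have [K HK] := poly_disk_bound r 1; exists `|K| => // t t1.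
rewrite qE hornerM hornerXsubC subr0 normrM ler_wpM2r//.
by apply: le_trans (HK _ t1) (ler_norm _).
Qed.

Lemma interval_stable a b x v t : `|v| <= t ->
  ~~ (a - t < x <= a + t) -> ~~ (b - t < x <= b + t) -> (a < x - v <= b) = (a < x <= b).
Proof.
rewrite ler_norml !negb_and -!ltNge -!leNgt => /andP[v1 v2] h1 h2.
congr andb; [case/orP: h1 => h|case/orP: h2 => h]; apply/idP/idP => k; lra.
Qed.

Lemma indic_box a b c d p : \1_(box a b c d) p = ((a < p.1 <= b) && (c < p.2 <= d))%:R :> R.
Proof. by rewrite indicE /box in_setX !mem_setE !in_itv. Qed.

Lemma odd_diff_box_le1 a b c d t p : `|odd_diff q (\1_(box a b c d)) t p| <= 1.
Proof.
rewrite /odd_diff !indicE; do 2 case: (_ \in _);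
  by rewrite ?subrr ?subr0 ?sub0r ?normrN ?normr0 ?normr1.
Qed.

(** Both shifts move p by at most t horizontally and K t vertically, so the two indicators can
    differ only near an edge of the box. [B1] and [B2] surround the vertical edges, [B3] and [B4]
    the horizontal ones; their total area is the stated bound. *)
Lemma odd_diff_box_near a b c d : a <= b -> c <= d -> exists2 C, 0 <= C &
  forall t, 0 < t <= 1 -> (sqint mu setT (odd_diff q (\1_(box a b c d)) t) <= (C * t)%:E)%E.
Proof.
move=> ab cd; have [K K0 HK] := horner_le_linear.
exists (8 * (d - c + 2 * K + 2) + 4 * (K + 1) * (b - a + 4)).
  by rewrite addr_ge0// ?mulr_ge0//; lra.
move=> t /andP[t0 t1].
have qt s : `|s| = t -> `|q.[s]| <= K * t.
  by move=> st; rewrite -st; apply: HK; rewrite st.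
have := qt t (gtr0_norm t0); have := qt (- t) (etrans (normrN t) (gtr0_norm t0)).
set w := q.[t]; set w' := q.[- t]; rewrite !ler_norml => /andP[v1 v2] /andP[v3 v4].
have Kt : K * t <= K by rewrite ler_piMr.
have Kt0 : 0 <= K * t by rewrite mulr_ge0// ltW.
pose B1 := box (a - 2 * t) (a + 2 * t) (c - K - 1) (d + K + 1).
pose B2 := box (b - 2 * t) (b + 2 * t) (c - K - 1) (d + K + 1).
pose B3 := box (a - 2) (b + 2) (c - K * t - t) (c + K * t + t).
pose B4 := box (a - 2) (b + 2) (d - K * t - t) (d + K * t + t).
have mB : measurable (B1 `|` B2 `|` B3 `|` B4).
  by apply: measurableU; [apply: measurableU; [apply: measurableU|]|]; exact: measurable_box.
have mI : measurable_fun setT (\1_(box a b c d) : R * R -> R).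
  by apply: measurable_indic; exact: measurable_box.
have mI' : measurable_fun setT (\1_(B1 `|` B2 `|` B3 `|` B4) : R * R -> R).
  exact: measurable_indic.
apply: (@le_trans _ _ (sqint mu setT (\1_(B1 `|` B2 `|` B3 `|` B4) : R * R -> R))).
  apply: (le_sqint mu measurableT (measurable_odd_diff2 q t mI) mI') => p _.
  have [pB|pB] := pselect ((B1 `|` B2 `|` B3 `|` B4) p).
    by rewrite [in leRHS]indicE mem_set// normr1 odd_diff_box_le1.
  rewrite (_ : odd_diff _ _ _ _ = 0) ?normr0//.
  rewrite /odd_diff !indic_box /shift_curve /= -/w -/w'.
  have N1 : ~ B1 p by move=> h; apply: pB; left; left; left.
  have N2 : ~ B2 p by move=> h; apply: pB; left; left; right.
  have N3 : ~ B3 p by move=> h; apply: pB; left; right.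
  have N4 : ~ B4 p by move=> h; apply: pB; right.
  move: N1 N2 N3 N4 {pB}; rewrite /B1 /B2 /B3 /B4 /box /= !in_itv/=.
  case: p => x y /= N1 N2 N3 N4.
  apply/eqP; rewrite subr_eq0; apply/eqP; congr (_%:R : R); congr nat_of_bool.
  have [yin|yout] := boolP (c - K - 1 < y <= d + K + 1); last first.
    have far v : `|v| <= K * t -> (c < y - v <= d) = false.
      rewrite ler_norml => /andP[u1 u2]; apply: contraNF yout => /andP[u3 u4].
      by clear -K0 Kt u1 u2 u3 u4; apply/andP; split; lra.
    by rewrite !far ?andbF// qt// ?normrN gtr0_norm.
  have [xin|xout] := boolP (a - 2 < x <= b + 2); last first.
    have far v : `|v| <= t -> (a < x - v <= b) = false.
      rewrite ler_norml => /andP[u1 u2]; apply: contraNF xout => /andP[u3 u4].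
      by clear -t1 u1 u2 u3 u4; apply/andP; split; lra.
    by rewrite !far ?normrN ?gtr0_norm.
  have C1 : ~~ (a - t < x <= a + t).
    apply/negP => h; apply: N1; split => //; clear -h t0.
    by case/andP: h => h1 h2; apply/andP; split; lra.
  have C2 : ~~ (b - t < x <= b + t).
    apply/negP => h; apply: N2; split => //; clear -h t0.
    by case/andP: h => h1 h2; apply/andP; split; lra.
  have C3 : ~~ (c - K * t < y <= c + K * t).
    apply/negP => h; apply: N3; split => //; clear -h t0.
    by case/andP: h => h1 h2; apply/andP; split; lra.
  have C4 : ~~ (d - K * t < y <= d + K * t).
    apply/negP => h; apply: N4; split => //; clear -h t0.
    by case/andP: h => h1 h2; apply/andP; split; lra.
  have E1 v : `|v| <= t -> (a < x - v <= b) = (a < x <= b) by move=> vt; exact: interval_stable vt C1 C2.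
  have E2 v : `|v| <= K * t -> (c < y - v <= d) = (c < y <= d).
    by move=> vt; exact: interval_stable vt C3 C4.
  by rewrite !E2 ?qt// ?normrN ?gtr0_norm// !E1 ?normrN ?gtr0_norm.
rewrite sqint_indic// setTI.
have mB1 := measurable_box (a - 2 * t) (a + 2 * t) (c - K - 1) (d + K + 1).
have mB2 := measurable_box (b - 2 * t) (b + 2 * t) (c - K - 1) (d + K + 1).
have mB3 := measurable_box (a - 2) (b + 2) (c - K * t - t) (c + K * t + t).
have mB4 := measurable_box (a - 2) (b + 2) (d - K * t - t) (d + K * t + t).
have U2 (A B : set (measurableTypeR R * measurableTypeR R)%type) : measurable A -> measurable B -> (mu (A `|` B) <= mu A + mu B)%E.
  by move=> mA mB'; exact: (@measureU2 _ _ _ (plane R)).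
apply: le_trans (U2 _ _ _ mB4) _; first by apply: measurableU => //; exact: measurableU.
apply: le_trans (leeD (U2 _ _ _ mB3) (lexx _)) _; first exact: measurableU.
apply: le_trans (leeD (leeD (U2 _ _ mB1 mB2) (lexx _)) (lexx _)) _.
have mub x1 x2 y1 y2 : x1 <= x2 /\ y1 <= y2 -> mu (box x1 x2 y1 y2) = ((x2 - x1) * (y2 - y1))%:E.
  by case=> ? ?; exact: mu_box.
rewrite /B1 /B2 /B3 /B4 !{}mub; [|by split; lra|by split; lra|by split; lra|by split; lra].
rewrite -!EFinD lee_fin; apply: eq_leW; ring.
Qed.

(** For given p, the first coordinate confines t to two intervals of length b - a. Cauchy-Schwarz on
    this set, of measure at most [V], instead of the whole shell of length 3 A gains the factor 1 /
    A. *)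
Lemma trunc_box_far a b c d : a <= b -> c <= d -> exists2 C, 0 <= C &
  forall A, 0 < A -> (sqint mu setT (trunc q A (4 * A) (\1_(box a b c d))) <= (C / A)%:E)%E.
Proof.
move=> ab cd; pose f := \1_(box a b c d) : R * R -> R.
have mf : measurable_fun setT f by apply: measurable_indic; exact: measurable_box.
have ms := measurable_odd_diff_sq q mf.
have z0 (z : (R * R) * R) : (0 <= ((odd_diff q f z.2 z.1) ^+ 2)%:E)%E by rewrite lee_fin sqr_ge0.
pose V := 2 * (b - a); have V0 : 0 <= V by rewrite /V; lra.
exists (V * (3 * (4 * ((b - a) * (d - c))))); first by rewrite !mulr_ge0//; lra.
move=> A A0; have A4 : A <= 4 * A by lra.
pose D := `[A, 4 * A]%classic : set (measurableTypeR R).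
have mD : measurable D by exact: measurable_itv.
have mI : measurable_fun setT (fun p => (\int[leb]_(t in D) ((odd_diff q f t p) ^+ 2)%:E)%E).
  exact: (measurable_integral_param leb mD ms z0).
apply: (@le_trans _ _ (\int[mu]_p ((V / A ^+ 2)%:E * \int[leb]_(t in D) ((odd_diff q f t p) ^+ 2)%:E))%E).
  apply: ge0_le_integral => //.
  - by move=> p _; rewrite lee_fin sqr_ge0.
  - by apply: measurable_sq; exact: measurable_trunc.
  - exact: measurable_funeM.
  move=> p _.
  pose E := (`[p.1 - b, p.1 - a] `|` `[a - p.1, b - p.1])%classic : set (measurableTypeR R).
  have mE : measurable E by apply: measurableU; exact: measurable_itv.
  have mDE : measurable (D `&` E) by exact: measurableI.
  have leE : (leb (D `&` E) <= V%:E)%E.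
    apply: le_trans (le_measure leb _ _ (@subIsetr _ D E)) _; rewrite ?inE//.
    apply: le_trans (measureU2 _ _ _) _; try exact: measurable_itv.
    rewrite [X in (X + _)%E](_ : _ = (p.1 - a - (p.1 - b))%:E); last by apply: segment_measure; lra.
    rewrite [X in (_ + X)%E](_ : _ = (b - p.1 - (a - p.1))%:E); last by apply: segment_measure; lra.
    by rewrite -EFinD lee_fin /V; lra.
  have fin : (leb (D `&` E) < +oo)%E by apply: le_lt_trans leE _; rewrite ltry.
  have mk0 : measurable_fun setT (fun t => odd_diff q f t p / t).
    by apply: measurable_funM; [exact: measurable_odd_diff1|exact: measurable_invr].
  have mk : measurable_fun (D `&` E) (fun t => odd_diff q f t p / t) by exact: measurable_funTS.
  have -> : trunc q A (4 * A) f p = \int[leb]_(t in D `&` E) (odd_diff q f t p / t).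
    rewrite /trunc Rintegral_mkcond [RHS]Rintegral_mkcond; apply: eq_Rintegral => t _.
    rewrite !patchE in_setI -/D; case: (t \in D) => //=; case: ifPn => // /negP tE.
    rewrite (_ : odd_diff _ _ _ _ = 0) ?mul0r// /odd_diff /f !indic_box /shift_curve /=.
    have n1 : ~ (a < p.1 - t <= b).
      by move=> /andP[h1 h2]; apply: tE; rewrite inE; left; rewrite /= in_itv/=; apply/andP; split; lra.
    have n2 : ~ (a < p.1 - - t <= b).
      by move=> /andP[h1 h2]; apply: tE; rewrite inE; right; rewrite /= in_itv/=; apply/andP; split; lra.
    by move/negP/negbTE: n1 => ->; move/negP/negbTE: n2 => ->; rewrite subrr.
  apply: le_trans (@cauchy_schwarz_Rintegral _ _ _ leb _ _ mDE fin mk) _.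
  rewrite EFinM -muleA lee_pmul//; first exact: sqint_ge0.
  rewrite -ge0_integralZl//; last 3 first.
  - by apply: measurable_sq; apply: measurable_funTS; exact: measurable_odd_diff1.
  - by move=> t _; rewrite lee_fin sqr_ge0.
  - by rewrite lee_fin invr_ge0 sqr_ge0.
  have mo : measurable_fun D (fun t => ((A ^- 2)%:E * ((odd_diff q f t p) ^+ 2)%:E)%E).
    by apply: measurable_funeM; apply: measurable_sq; apply: measurable_funTS; exact: measurable_odd_diff1.
  apply: (@le_trans _ _ (sqint leb D (fun t => odd_diff q f t p / t))).
    by apply: sqint_subset => //; exact: measurable_funTS.
  apply: ge0_le_integral => //.
  - by move=> t _; rewrite lee_fin sqr_ge0.
  - by apply: measurable_sq; exact: measurable_funTS.
  - move=> t; rewrite /D /= in_itv/= => /andP[At _].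
    have t0 : 0 < t by exact: lt_le_trans At.
    rewrite -EFinM lee_fin exprMn mulrC ler_wpM2r ?sqr_ge0// exprVn.
    by rewrite lef_pV2 ?posrE ?exprn_gt0// lerXn2r// nnegrE ltW.
rewrite ge0_integralZl//; last 2 first.
- by move=> p _; apply: integral_ge0 => t _; rewrite lee_fin sqr_ge0.
- by rewrite lee_fin divr_ge0// sqr_ge0.
rewrite (tonelli_in (plane R) leb mD ms z0).
apply: le_trans (_ : (V / A ^+ 2)%:E * \int[leb]_(t in D) (4 * ((b - a) * (d - c)))%:E <= _)%E.
  rewrite lee_wpmul2l ?lee_fin ?divr_ge0 ?sqr_ge0//; apply: ge0_le_integral => //.
  - by move=> t _; exact: sqint_ge0.
  - by apply: measurable_funTS; exact: measurable_sqint_odd_diff.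
  - move=> t _; apply: le_trans (sqint_odd_diff q t mf) _.
    by rewrite /f sqint_indic ?setTI ?mu_box//; exact: measurable_box.
rewrite integral_cst//= segment_measure// -!EFinM lee_fin; apply: eq_leW.
by field; rewrite gt_eqF.
Qed.

End BoxShells.

(** * The operator on real-valued functions, as a square-mean limit *)

Section RealTransform.
Variables (R : realType) (q : {poly R}).
Notation leb := (@lebesgue_measure R).
Notation mu := (mu2 R).
Variable C : R.
Hypothesis q0 : q.[0] = 0.
Hypothesis C0 : 0 <= C.
Hypothesis truncC : forall a b f, 0 < a -> a <= b -> L2r f ->
  (sqint mu setT (trunc q a b f) <= C%:E * sqint mu setT f)%E.
Implicit Types (f g : R * R -> R) (a b c t : R) (p : R * R).

Definition dyadic_trunc n f := trunc q (4 ^- n) (4 ^+ n) f.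

Lemma pow4_gt0 n : 0 < (4 : R) ^+ n. Proof. by rewrite exprn_gt0. Qed.
Lemma pow4V_gt0 n : 0 < (4 : R) ^- n. Proof. by rewrite invr_gt0 pow4_gt0. Qed.
Lemma pow4_ge1 n : 1 <= (4 : R) ^+ n. Proof. by rewrite exprn_ege1// ler1n. Qed.
Lemma pow4V_le1 n : (4 : R) ^- n <= 1. Proof. by rewrite invf_le1 ?pow4_gt0 ?pow4_ge1. Qed.
Lemma pow4V_le n : (4 : R) ^- n <= 4 ^+ n.
Proof. exact: le_trans (pow4V_le1 n) (pow4_ge1 n). Qed.
Lemma pow4_le m n : (m <= n)%N -> (4 : R) ^+ m <= 4 ^+ n.
Proof. by move=> mn; rewrite ler_weXn2l// ler1n. Qed.
Lemma pow4V_anti m n : (m <= n)%N -> (4 : R) ^- n <= 4 ^- m.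
Proof. by move=> mn; rewrite lef_pV2 ?posrE ?pow4_gt0 ?pow4_le. Qed.

#[local] Hint Resolve pow4_gt0 pow4V_gt0 pow4_ge1 pow4V_le1 pow4V_le : core.

(* The ratio [1 / 4] between the shells beats the factor [2] lost at each use
   of [(x + y) ^ 2 <= 2 x ^ 2 + 2 y ^ 2]. *)
Lemma sqint_dyadic_sum (U : nat -> nat -> R * R -> R) D : 0 <= D ->
  (forall m n, measurable_fun setT (U m n)) ->
  (forall m n p, (m < n)%N -> U m n p = U m m.+1 p + U m.+1 n p) ->
  (forall n p, U n n p = 0) ->
  (forall n, (sqint mu setT (U n n.+1) <= (D * 4 ^- n)%:E)%E) ->
  forall m n, (m <= n)%N -> (sqint mu setT (U m n) <= (4 * D * 4 ^- m)%:E)%E.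
Proof.
move=> D0 mU US U0 UD m n /subnK <-; move: (n - m)%N => j {n}.
elim: j m => [|j IH] m.
  rewrite add0n; have -> : U m m = (fun=> 0) by apply/funext => p; exact: U0.
  rewrite /sqint; under eq_integral do rewrite expr0n.
  by rewrite integral0 lee_fin !mulr_ge0// ltW.
have jm : (m < j.+1 + m)%N by rewrite addSn ltnS leq_addl.
have -> : U m (j.+1 + m)%N = (U m m.+1 \+ U m.+1 (j + m.+1)%N)%R.
  by apply/funext => p /=; rewrite (US _ _ _ jm) addSnnS.
apply: le_trans (sqintD mu measurableT (mU _ _) (mU _ _)) _.
(* The constant 4 is the solution of c = 2 + 2 c / 4. *)
apply: (@le_trans _ _ (2%:E * (D * 4 ^- m)%:E + 2%:E * (4 * D * 4 ^- m.+1)%:E)%E).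
  by rewrite leeD// lee_wpmul2l.
rewrite -!EFinM -EFinD lee_fin; apply: eq_leW.
rewrite exprS invfM; field; by rewrite gt_eqF.
Qed.

Definition dyadic_cauchy f := forall e, 0 < e -> exists N, forall m n, (N <= m)%N -> (N <= n)%N ->
  (sqint mu setT (dyadic_trunc m f \- dyadic_trunc n f)%R <= e%:E)%E.

Lemma measurable_dyadic_trunc n f : measurable_fun setT f -> measurable_fun setT (dyadic_trunc n f).
Proof. exact: measurable_trunc. Qed.

Lemma trunc_diag a f p : trunc q a a f p = 0.
Proof. by rewrite /trunc set_itv1 Rintegral_set1. Qed.

Lemma dyadic_cauchy_box x1 x2 y1 y2 : dyadic_cauchy \1_(box x1 x2 y1 y2).
Proof.
wlog [x12 y12] : x1 x2 y1 y2 / x1 <= x2 /\ y1 <= y2.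
  have E (u v : R) : v <= u -> `]u, v]%classic = set0 :> set R.
    by move=> vu; rewrite set_itv_ge// bnd_simp -leNgt.
  move=> H; have [h|h] := leP x1 x2; last first.
    have -> : box x1 x2 y1 y2 = box x1 x1 y1 y1.
      by rewrite /box (E x1 x2 (ltW h)) (E x1 x1)// !set0X.
    exact: H.
  have [k|k] := leP y1 y2; first exact: H.
  have -> : box x1 x2 y1 y2 = box x1 x2 y1 y1; last exact: H.
  by rewrite /box (E y1 y2 (ltW k)) (E y1 y1)// !setX0.
pose f := \1_(box x1 x2 y1 y2) : R * R -> R.
have mf : measurable_fun setT f by apply: measurable_indic; exact: measurable_box.
have f1 p : `|f p| <= 1 by rewrite /f indicE; case: (_ \in _); rewrite ?normr0 ?normr1.
have mT a b := measurable_trunc q a b mf.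
have iT a b p : 0 < a -> trunc_integrable q a b f p.
  by move=> a0; exact: trunc_integrable_bounded a0 mf f1.
have [C1 C10 H1] := odd_diff_box_near q0 x12 y12.
have [C2 C20 H2] := trunc_box_far q x12 y12.
have near m n : (m <= n)%N ->
    (sqint mu setT (trunc q (4 ^- n) (4 ^- m) f) <= (4 * (9 * C1) * 4 ^- m)%:E)%E.
  apply: (@sqint_dyadic_sum (fun m n => trunc q (4 ^- n) (4 ^- m) f)) => //.
  - by rewrite mulr_ge0.
  - move=> {}m {}n p mn; rewrite addrC; apply: trunc_split; last exact: iT.
    by rewrite !pow4V_anti.
  - by move=> {}n p; rewrite trunc_diag.
  (* On a shell of ratio 4 the quotient (b - a) / a equals 3, whence the factor 9. *)
  - move=> {}n; apply: le_trans (_ : (((4 ^- n - 4 ^- n.+1) / 4 ^- n.+1) ^+ 2)%:E * (C1 * 4 ^- n)%:E <= _)%E.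
      apply: le_sqint_trunc_unif => //; first by rewrite pow4V_anti.
        by rewrite lee_fin mulr_ge0// ltW.
      move=> t /andP[t1 t2]; apply: le_trans (H1 t _) _.
        by rewrite (lt_le_trans _ t1)//= (le_trans t2).
      by rewrite lee_fin ler_wpM2l.
    rewrite -EFinM lee_fin; apply: eq_leW.
    rewrite (exprS (4 : R) n); move: (4 ^+ n) (pow4_gt0 n) => u u0.
    have -> : (u^-1 - (4 * u)^-1) / (4 * u)^-1 = 3 by field; rewrite gt_eqF.
    by ring.
have far m n : (m <= n)%N ->
    (sqint mu setT (trunc q (4 ^+ m) (4 ^+ n) f) <= (4 * C2 * 4 ^- m)%:E)%E.
  apply: (@sqint_dyadic_sum (fun m n => trunc q (4 ^+ m) (4 ^+ n) f)) => //.
  - by move=> {}m {}n p mn; apply: trunc_split; [rewrite !pow4_le|exact: iT].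
  - by move=> {}n p; rewrite trunc_diag.
  - by move=> {}n; rewrite exprS; exact: H2.
pose K := 2 * (4 * (9 * C1)) + 2 * (4 * C2).
have K0 : 0 <= K by rewrite /K; lra.
have main m n : (n <= m)%N ->
    (sqint mu setT (dyadic_trunc m f \- dyadic_trunc n f)%R <= (K * 4 ^- n)%:E)%E.
  move=> nm; have -> : (dyadic_trunc m f \- dyadic_trunc n f)%R =
      (trunc q (4 ^- m) (4 ^- n) f \+ trunc q (4 ^+ n) (4 ^+ m) f)%R.
    apply/funext => p /=; rewrite /dyadic_trunc.
    have e1 : (4 : R) ^- m <= (4 : R) ^- n <= (4 : R) ^+ m.
      by rewrite pow4V_anti//= (le_trans (pow4V_le1 _)).
    have e2 : (4 : R) ^- n <= (4 : R) ^+ n <= (4 : R) ^+ m by rewrite pow4V_le pow4_le.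
    rewrite (trunc_split e1 (iT _ _ p (pow4V_gt0 m))) (trunc_split e2 (iT _ _ p (pow4V_gt0 n))).
    by ring.
  apply: le_trans (sqintD mu measurableT (mT _ _) (mT _ _)) _.
  apply: (@le_trans _ _ (2%:E * (4 * (9 * C1) * 4 ^- n)%:E + 2%:E * (4 * C2 * 4 ^- n)%:E)%E).
    by apply: leeD; apply: lee_wpmul2l => //; [exact: near|exact: far].
  by rewrite -!EFinM -EFinD lee_fin /K; apply: eq_leW; ring.
move=> e e0.
have : K * 4 ^- n @[n --> \oo] --> (0 : R).
  rewrite -[X in _ --> X](mulr0 K); apply: cvgMr.
  under eq_fun do rewrite -exprVn.
  by apply: cvg_expr; rewrite ger0_norm; lra.
move=> /cvgrPdist_le/(_ e e0)[N _ HN]; exists N.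
have fin i : (N <= i)%N -> K * 4 ^- i <= e.
  by move=> /HN /=; rewrite sub0r normrN ger0_norm// mulr_ge0// ltW.
move=> m n Nm Nn; have [nm|mn] := leqP n m.
  by apply: le_trans (main _ _ nm) _; rewrite lee_fin fin.
by rewrite sqintC; apply: le_trans (main _ _ (ltnW mn)) _; rewrite lee_fin fin.
Qed.

Lemma dyadic_trunc_lin n c f g : L2r f -> L2r g ->
  {ae mu, forall p, dyadic_trunc n (fun p => c * f p + g p) p =
                    c * dyadic_trunc n f p + dyadic_trunc n g p}.
Proof.
move=> Lf Lg.
apply: (ae_imp2 (mu := mu) (trunc_integrable_ae q (pow4V_gt0 n) (pow4V_le n) Lf)
  (trunc_integrable_ae q (pow4V_gt0 n) (pow4V_le n) Lg)) => p i1 i2.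
exact: trunc_lin.
Qed.

Lemma dyadic_trunc_L2r n f : L2r f -> L2r (dyadic_trunc n f).
Proof. exact: trunc_L2r. Qed.

Lemma dyadic_trunc_bound n f : L2r f ->
  (sqint mu setT (dyadic_trunc n f) <= C%:E * sqint mu setT f)%E.
Proof. exact: truncC. Qed.

Lemma dyadic_cauchy_lin c f g : L2r f -> L2r g -> dyadic_cauchy f -> dyadic_cauchy g ->
  dyadic_cauchy (fun p => c * f p + g p).
Proof.
move=> Lf Lg Hf Hg e e0.
have c0 : 0 < 1 + c ^+ 2 by have := sqr_ge0 c; lra.
have [N1 H1] : exists N, forall m n, (N <= m)%N -> (N <= n)%N ->
    (sqint mu setT (dyadic_trunc m f \- dyadic_trunc n f)%R <= (e / 4 / (1 + c ^+ 2))%:E)%E.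
  by apply: Hf; rewrite !divr_gt0.
have [N2 H2] : exists N, forall m n, (N <= m)%N -> (N <= n)%N ->
    (sqint mu setT (dyadic_trunc m g \- dyadic_trunc n g)%R <= (e / 4)%:E)%E.
  by apply: Hg; rewrite !divr_gt0.
exists (maxn N1 N2) => m n; rewrite !geq_max => /andP[m1 m2] /andP[n1 n2].
have mT n' h : L2r h -> measurable_fun setT (dyadic_trunc n' h).
  by move=> Lh; exact: (dyadic_trunc_L2r n' Lh).1.
have mB h : L2r h -> measurable_fun setT (dyadic_trunc m h \- dyadic_trunc n h)%R.
  by move=> Lh; exact: (measurable_funB (mT m _ Lh) (mT n _ Lh)).
have Lfg := L2r_lin c Lf Lg.
have mcB : measurable_fun setT (fun p => c * (dyadic_trunc m f \- dyadic_trunc n f)%R p).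
  exact: (measurable_funM (measurable_cst c) (mB _ Lf)).
have -> : sqint mu setT (dyadic_trunc m (fun p => c * f p + g p) \- dyadic_trunc n (fun p => c * f p + g p))%R =
   sqint mu setT ((fun p => c * (dyadic_trunc m f \- dyadic_trunc n f)%R p) \+
     (dyadic_trunc m g \- dyadic_trunc n g))%R.
  apply: ae_eq_sqint; [exact: mB|exact: (measurable_funD mcB (mB _ Lg))|].
  apply: (ae_imp2 (mu := mu) (dyadic_trunc_lin m c Lf Lg) (dyadic_trunc_lin n c Lf Lg)) => p i1 i2 /=.
  by rewrite i1 i2; ring.
apply: le_trans (sqintD mu measurableT mcB (mB _ Lg)) _.
rewrite sqintZ//; last exact: mB.
apply: le_trans (_ : 2%:E * ((c ^+ 2)%:E * (e / 4 / (1 + c ^+ 2))%:E) + 2%:E * (e / 4)%:E <= _)%E.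
  apply: leeD; apply: lee_wpmul2l => //; last exact: H2.
  by apply: lee_wpmul2l; [rewrite lee_fin sqr_ge0|exact: H1].
rewrite -!EFinM -EFinD lee_fin.
have : c ^+ 2 * (e / 4 / (1 + c ^+ 2)) <= e / 4.
  by rewrite mulrCA ler_piMr ?divr_ge0 ?(ltW e0)// ler_pdivrMr// mul1r lerDr.
lra.
Qed.

Lemma L2r_dyadic_cauchy f : L2r f -> dyadic_cauchy f.
Proof.
suff : L2r f -> L2r f /\ dyadic_cauchy f by move=> H /H[].
apply: (@L2_ind _ (fun f => L2r f /\ dyadic_cauchy f)).
- move=> x1 x2 y1 y2; split; last exact: dyadic_cauchy_box.
  by apply: L2r_indic; [exact: measurable_box|exact: box_lty].
- move=> c g h [Lg Hg] [Lh Hh]; split; first exact: L2r_lin.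
  exact: dyadic_cauchy_lin.
- move=> g Lg Hg; split => // e e0.
  (* [g] is replaced by an approximant [h] with Cauchy truncations; each truncation of the
     difference costs C u, uniformly in its index. *)
  pose u := e / (4 + 16 * C).
  have u0 : 0 < u by rewrite divr_gt0// ltr_pwDl// mulr_ge0.
  have uE : e = 4 * u + 16 * C * u by rewrite /u; field; rewrite gt_eqF// ltr_pwDl// mulr_ge0.
  have [h [Lh [_ Ch] hg]] := Hg u u0.
  pose d := (fun p => -1 * g p + h p).
  have Ld : L2r d by exact: L2r_lin.
  have sd : (sqint mu setT d <= u%:E)%E.
    by move: hg; congr (_ <= _)%E; congr sqint; apply/funext => p; rewrite /d /=; ring.
  have [N HN] := Ch u u0; exists N => m n Nm Nn.
  have mT n' k : L2r k -> measurable_fun setT (dyadic_trunc n' k).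
    by move=> Lk; exact: (dyadic_trunc_L2r n' Lk).1.
  have mB k : L2r k -> measurable_fun setT (dyadic_trunc m k \- dyadic_trunc n k)%R.
    by move=> Lk; exact: (measurable_funB (mT m _ Lk) (mT n _ Lk)).
  have -> : sqint mu setT (dyadic_trunc m g \- dyadic_trunc n g)%R =
     sqint mu setT ((dyadic_trunc m h \- dyadic_trunc n h) \- (dyadic_trunc m d \- dyadic_trunc n d))%R.
    apply: ae_eq_sqint; [exact: mB|exact: (measurable_funB (mB _ Lh) (mB _ Ld))|].
    apply: (ae_imp2 (mu := mu) (dyadic_trunc_lin m (-1) Lg Lh) (dyadic_trunc_lin n (-1) Lg Lh)) => p i1 i2 /=.
    by rewrite i1 i2; ring.
  apply: le_trans (sqintB mu measurableT (mB _ Lh) (mB _ Ld)) _.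
  have bd n' : (sqint mu setT (dyadic_trunc n' d) <= (C * u)%:E)%E.
    by apply: le_trans (dyadic_trunc_bound n' Ld) _; rewrite EFinM lee_wpmul2l.
  apply: le_trans (_ : 2%:E * u%:E + 2%:E * (2%:E * (C * u)%:E + 2%:E * (C * u)%:E) <= _)%E.
    apply: leeD; apply: lee_wpmul2l => //; first exact: HN.
    apply: le_trans (sqintB mu measurableT (mT _ _ Ld) (mT _ _ Ld)) _.
    by apply: leeD; apply: lee_wpmul2l.
  rewrite !(=^~ EFinM, =^~ EFinD) lee_fin uE.
  have Cu : 0 <= C * u by rewrite mulr_ge0// ltW.
  by move: u u0 Cu {uE hg sd HN bd} => u u0 Cu; lra.
Qed.

(** The limit is determined only up to a null set, so a representative is chosen; linearity and
    compatibility below hold almost everywhere. *)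
Definition real_transform f : R * R -> R :=
  xget (fun=> 0) [set g | measurable_fun setT g /\ L2lim mu (dyadic_trunc ^~ f) g].

Lemma real_transformP f : L2r f ->
  measurable_fun setT (real_transform f) /\ L2lim mu (dyadic_trunc ^~ f) (real_transform f).
Proof.
move=> Lf; have mT n := (dyadic_trunc_L2r n Lf).1.
have [g mg lg] := @riesz_fischer _ _ _ mu (dyadic_trunc ^~ f) mT (L2r_dyadic_cauchy Lf).
by apply: (xgetPex (fun=> 0) (P := [set g | measurable_fun setT g /\ L2lim mu (dyadic_trunc ^~ f) g])); exists g.
Qed.

Lemma real_transform_bound f : L2r f ->
  (sqint mu setT (real_transform f) <= (2 * C)%:E * sqint mu setT f)%E.
Proof.
move=> Lf; have [mH lH] := real_transformP Lf; rewrite EFinM -muleA.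
have c0 : (0 <= C%:E * sqint mu setT f)%E by rewrite mule_ge0 ?lee_fin ?sqint_ge0.
have mT n := (dyadic_trunc_L2r n Lf).1.
have bT : \forall n \near \oo, (sqint mu setT (dyadic_trunc n f) <= C%:E * sqint mu setT f)%E.
  by apply: nearW => n; exact: dyadic_trunc_bound.
exact: (@L2lim_sqint_le _ _ _ mu (dyadic_trunc ^~ f) _ _ c0 mH mT lH bT).
Qed.

Lemma real_transform_L2r f : L2r f -> L2r (real_transform f).
Proof.
move=> Lf; split; first exact: (real_transformP Lf).1.
apply: le_lt_trans (real_transform_bound Lf) _.
by rewrite lte_mul_pinfty ?lee_fin ?mulr_ge0//; exact: Lf.2.
Qed.

Lemma real_transform_lin c f g : L2r f -> L2r g ->
  {ae mu, forall p, real_transform (fun p => c * f p + g p) p =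
                    c * real_transform f p + real_transform g p}.
Proof.
move=> Lf Lg; have [mf lf] := real_transformP Lf; have [mg lg] := real_transformP Lg.
have Lfg := L2r_lin c Lf Lg; have [mh lh] := real_transformP Lfg.
have mT n k : L2r k -> measurable_fun setT (dyadic_trunc n k).
  by move=> Lk; exact: (dyadic_trunc_L2r n Lk).1.
pose h p := c * real_transform f p + real_transform g p.
have mh' : measurable_fun setT h.
  exact: (measurable_funD (measurable_funM (measurable_cst c) mf) mg).
suff s0 : sqint mu setT (real_transform (fun p => c * f p + g p) \- h)%R = 0%E.
  have := sqint_eq0 (mu := mu) (measurable_funB mh mh') s0.
  by apply: negligibleS => p; apply: contra_not => /= /eqP; rewrite subr_eq0 => /eqP.
apply/eqP; rewrite eq_le sqint_ge0 andbT; apply/lee_addgt0Pr => e e0; rewrite add0e.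
have c0 : 0 < 1 + c ^+ 2 by have := sqr_ge0 c; lra.
pose u := e / (6 + 4 * c ^+ 2).
have u0 : 0 < u by rewrite divr_gt0//; have := sqr_ge0 c; lra.
have uE : e = 6 * u + 4 * c ^+ 2 * u by rewrite /u; field; rewrite gt_eqF//; have := sqr_ge0 c; lra.
have [n [Hf Hg Hh]] : exists n, [/\ (sqint mu setT (dyadic_trunc n f \- real_transform f)%R <= u%:E)%E,
    (sqint mu setT (dyadic_trunc n g \- real_transform g)%R <= u%:E)%E &
    (sqint mu setT (dyadic_trunc n (fun p => c * f p + g p) \-
       real_transform (fun p => c * f p + g p))%R <= u%:E)%E].
  have [n1 _ H1] := lf u u0; have [n2 _ H2] := lg u u0; have [n3 _ H3] := lh u u0.
  exists (n1 + n2 + n3)%N; split; [apply: H1|apply: H2|apply: H3] => /=; lia.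
set A := dyadic_trunc n f; set B := dyadic_trunc n g.
have mAf : measurable_fun setT (A \- real_transform f)%R := measurable_funB (mT n _ Lf) mf.
have mBg : measurable_fun setT (B \- real_transform g)%R := measurable_funB (mT n _ Lg) mg.
have mcA : measurable_fun setT (fun p => c * (A \- real_transform f)%R p).
  exact: (measurable_funM (measurable_cst c) mAf).
have mDh := measurable_funB (mT n _ Lfg) mh.
have mS := measurable_funD mcA mBg.
have -> : sqint mu setT (real_transform (fun p => c * f p + g p) \- h)%R =
  sqint mu setT (((fun p => c * (A \- real_transform f)%R p) \+ (B \- real_transform g)) \-
    (dyadic_trunc n (fun p => c * f p + g p) \- real_transform (fun p => c * f p + g p)))%R.
  apply: ae_eq_sqint; [exact: measurable_funB mh mh'|exact: measurable_funB mS mDh|].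
  apply: negligibleS (dyadic_trunc_lin n c Lf Lg) => p.
  apply: contra_not; rewrite -/A -/B /h /= => ->.
  by move: (A p) (B p) (real_transform _ p) (real_transform _ p) (real_transform _ p) => *; ring.
apply: le_trans (sqintB mu measurableT mS mDh) _.
apply: (@le_trans _ _ (2%:E * (2%:E * ((c ^+ 2)%:E * u%:E) + 2%:E * u%:E) + 2%:E * u%:E)%E).
  apply: leeD; apply: lee_wpmul2l; [by []| |by []|exact: Hh].
  apply: le_trans (sqintD mu measurableT mcA mBg) _.
  rewrite (sqintZ mu c measurableT mAf).
  apply: leeD; apply: lee_wpmul2l; [by []| |by []|exact: Hg].
  by apply: lee_wpmul2l; [rewrite lee_fin sqr_ge0|exact: Hf].
rewrite !(=^~ EFinM, =^~ EFinD) lee_fin uE.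
by apply: eq_leW; ring.
Qed.

(** The difference has zero square integral, and by the norm bound so has its transform; linearity
    concludes. *)
Lemma real_transform_ae f g : L2r f -> L2r g -> {ae mu, forall p, f p = g p} ->
  {ae mu, forall p, real_transform f p = real_transform g p}.
Proof.
move=> Lf Lg fg; pose d p := -1 * g p + f p.
have Ld : L2r d by exact: L2r_lin.
have d0 : sqint mu setT d = 0%E.
  rewrite (_ : 0%E = sqint mu setT (fun=> 0)); last first.
    by rewrite /sqint; under eq_integral do rewrite expr0n; rewrite integral0.
  apply: ae_eq_sqint => //; first exact: Ld.1.
  by apply: negligibleS fg => p; apply: contra_not => /= h; rewrite /d h; ring.
have H0 : sqint mu setT (real_transform d) = 0%E.
  apply/eqP; rewrite eq_le sqint_ge0 andbT.
  by apply: le_trans (real_transform_bound Ld) _; rewrite d0 mule0.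
have L := real_transform_lin 1 Ld Lg.
have E : (fun p => 1 * d p + g p) = f by apply/funext => p; rewrite /d; ring.
rewrite E in L.
apply: (ae_imp2 (mu := mu) L (sqint_eq0 (mu := mu) (real_transformP Ld).1 H0)) => p i1 i2 /=.
by rewrite i1 i2 mulr0 add0r.
Qed.

End RealTransform.

(** * The complex operator *)

Section ComplexTransform.
Local Open Scope complex_scope.
Variables (R : realType).
Notation leb := (@lebesgue_measure R).
Notation mu := (mu2 R).
Implicit Types f g : R * R -> R[i].

Lemma norm2E f : measurable_fun setT (re_part f) -> measurable_fun setT (im_part f) ->
  norm2 f = ((sqint mu setT (re_part f) + sqint mu setT (im_part f)) `^ (2^-1))%E.
Proof.
move=> mr mi; rewrite /norm2 unlock; congr poweR.
rewrite /sqint -ge0_integralD//; first last.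
- exact: measurable_sq.
- by move=> p _; rewrite lee_fin sqr_ge0.
- exact: measurable_sq.
- by move=> p _; rewrite lee_fin sqr_ge0.
apply: eq_integral => p _ /=; rewrite -EFinD; congr EFin.
rewrite /re_part /im_part; case: (f p) => u v /=.
rewrite ger0_norm ?sqrtr_ge0// powR_mulrn ?sqrtr_ge0// sqr_sqrtr//.
by rewrite addr_ge0 ?sqr_ge0.
Qed.

Lemma L2P f : L2 f <-> L2r (re_part f) /\ L2r (im_part f).
Proof.
split=> [[mr mi]|[[mr sr] [mi si]]].
  rewrite norm2E// => /lty_poweRy h.
  have n2 : (2^-1 : R) != 0 by rewrite invr_neq0// pnatr_eq0.
  by split; split => //; apply: le_lt_trans (h n2); rewrite ?leeDl ?leeDr ?sqint_ge0.
by split => //; rewrite norm2E//; apply: poweR_lty; rewrite lte_add_pinfty.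
Qed.

Variable q : {poly R}.
Variable C : R.
Hypothesis q0 : q.[0] = 0.
Hypothesis C0 : 0 <= C.
Hypothesis truncC : forall a b (f : R * R -> R), 0 < a -> a <= b -> L2r f ->
  (sqint mu setT (trunc q a b f) <= C%:E * sqint mu setT f)%E.

(** The kernel is real, so real and imaginary parts do not interact and their square integrals
    simply add up: complex values cost no constant. *)
Definition complex_transform f : R * R -> R[i] := fun p =>
  real_transform q (re_part f) p +i* real_transform q (im_part f) p.

Lemma complex_transform_L2 f : L2 f -> L2 (complex_transform f).
Proof.
by move=> /L2P[Lr Li]; apply/L2P; split; exact: (real_transform_L2r q0 C0 truncC).
Qed.

Lemma complex_transform_bound f : L2 f ->
  (norm2 (complex_transform f) <= (Num.sqrt (2 * C))%:E * norm2 f)%E.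
Proof.
move=> Lf; have [mr' mi' _] := complex_transform_L2 Lf.
have /L2P[Lr Li] := Lf.
have C2 : 0 <= 2 * C by rewrite mulr_ge0.
rewrite (norm2E mr' mi') (norm2E Lr.1 Li.1).
set S := (sqint mu setT (re_part f) + sqint mu setT (im_part f))%E.
have S0 : (0 <= S)%E by rewrite adde_ge0// sqint_ge0.
have -> : ((Num.sqrt (2 * C))%:E = (2 * C)%:E `^ (2^-1))%E by rewrite poweR_EFin powR12_sqrt.
rewrite -poweRM ?lee_fin//; apply: gt0_ler_poweR; rewrite ?invr_ge0//.
- by rewrite in_itv/= leey andbT adde_ge0// sqint_ge0.
- by rewrite in_itv/= leey andbT mule_ge0.
rewrite /S ge0_muleDr ?sqint_ge0//; apply: leeD.
  exact: (real_transform_bound q0 C0 truncC).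
exact: (real_transform_bound q0 C0 truncC).
Qed.

Lemma complex_transform_operator : L2_operator complex_transform.
Proof.
split; first exact: complex_transform_L2.
- move=> f g /L2P[fr fi] /L2P[gr gi] fg.
  have h1 : {ae mu, forall p, re_part f p = re_part g p}.
    by apply: negligibleS fg => p; apply: contra_not => /= h; rewrite /re_part /im_part (h I).
  have h2 : {ae mu, forall p, im_part f p = im_part g p}.
    by apply: negligibleS fg => p; apply: contra_not => /= h; rewrite /re_part /im_part (h I).
  have k1 := real_transform_ae q0 C0 truncC fr gr h1.
  have k2 := real_transform_ae q0 C0 truncC fi gi h2.
  apply: (ae_imp2 k1 k2) => p i1 i2 _.
  by rewrite /complex_transform i1 i2.
(* Multiplication by u + i v mixes the two parts, so complex linearity is assembled from four real
   instances. *)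
- move=> c f g /L2P[fr fi] /L2P[gr gi]; case: c => u v.
  have Lvr := L2r_lin (- v) fi gr; have Lvi := L2r_lin v fr gi.
  have l1 := real_transform_lin q0 C0 truncC u fr Lvr.
  have l2 := real_transform_lin q0 C0 truncC (- v) fi gr.
  have l3 := real_transform_lin q0 C0 truncC u fi Lvi.
  have l4 := real_transform_lin q0 C0 truncC v fr gi.
  apply: (ae_imp2 (ae_imp2 l1 l2 (fun p => @conj _ _)) (ae_imp2 l3 l4 (fun p => @conj _ _))).
  move=> p [i1 i2] [i3 i4] _; rewrite /complex_transform.
  have -> : re_part (fun p => (u +i* v) * f p + g p) =
      (fun p => u * re_part f p + (- v * im_part f p + re_part g p)).
    by apply/funext => z; rewrite /re_part /im_part; case: (f z) (g z) => ? ? [? ?] /=; ring.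
  have -> : im_part (fun p => (u +i* v) * f p + g p) =
      (fun p => u * im_part f p + (v * re_part f p + im_part g p)).
    by apply/funext => z; rewrite /re_part /im_part; case: (f z) (g z) => ? ? [? ?] /=; ring.
  have E1 := etrans i1 (congr1 (fun z => _ + z) i2).
  have E2 := etrans i3 (congr1 (fun z => _ + z) i4).
  refine (etrans (f_equal2 (@Complex R) E1 E2) _).
  move: (real_transform _ (re_part f) p) (real_transform _ (im_part f) p).
  move: (real_transform _ (re_part g) p) (real_transform _ (im_part g) p) => a b a' b'.
  by apply/eqP; rewrite eq_complex /=; apply/andP; split; apply/eqP; ring.
Qed.

End ComplexTransform.

(** * Principal values *)

Section Masks.
Context d (T : measurableType d) (R : realType) (mu : {measure set T -> \bar R}).

Lemma integrable_measurable (F : T -> R) : mu.-integrable setT (EFin \o F) -> measurable_fun setT F.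
Proof. by move=> /integrableP[mF _]; exact/measurable_EFinP. Qed.

Lemma mask_cvg (F : T -> R) (m : nat -> T -> R) : mu.-integrable setT (EFin \o F) ->
  (forall n, measurable_fun setT (m n)) -> (forall n t, `|m n t| <= 1) ->
  (forall t, F t * m n t @[n --> \oo] --> F t) ->
  \int[mu]_t (F t * m n t) @[n --> \oo] --> \int[mu]_t F t.
Proof.
move=> iF mm m1 Fm; have mF := integrable_measurable iF.
have mE : measurable_fun setT (EFin \o F) by exact/measurable_EFinP.
have iN := integrable_norm iF.
have mFm n : measurable_fun setT (EFin \o (fun t => F t * m n t)).
  by apply/measurable_EFinP; exact: measurable_funM.
have c1 : {ae mu, forall t, setT t -> (fun n => (F t * m n t)%:E) @ \oo --> (F t)%:E}.
  by apply: aeW => t _; apply: cvg_EFin; [exact: nearW|exact: Fm].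
have c2 : {ae mu, forall t n, setT t -> (`|(F t * m n t)%:E| <= (`|F t|)%:E)%E}.
  by apply: aeW => t n _; rewrite lee_fin normrM ler_piMr.
have [_ _ H] := dominated_convergence measurableT mFm mE c1 iN c2.
by apply: fine_cvg; rewrite fineK//; exact: integrable_fin_num.
Qed.

End Masks.

Section PrincipalValue.
Variable R : realType.
Notation leb := (@lebesgue_measure R).
Implicit Types (F h m : R -> R) (t : R).

Definition reflect : measurableTypeR R -> measurableTypeR R := -%R.

Lemma measurable_reflect : measurable_fun setT reflect.
Proof. exact: measurable_funN. Qed.

HB.instance Definition _ := isMeasurableFun.Build _ _ _ _ reflect measurable_reflect.

Lemma lebesgue_measure_reflect (A : set (measurableTypeR R)) : measurable A ->
  pushforward leb reflect A = leb A.
Proof.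
move=> mA; apply/esym/lebesgue_measure_unique => //= _ [[a b]] _ <-.
rewrite /pushforward opp_preimage_itvbndbnd/= !lebesgue_measure_itv/=.
by rewrite !lte_fin ltrN2 opprK addrC.
Qed.

Lemma ge0_integral_oppr (F : R -> \bar R) : measurable_fun setT F -> (forall x, 0 <= F x)%E ->
  (\int[leb]_x F (- x)%R = \int[leb]_x F x)%E.
Proof.
move=> mF F0; have := @ge0_integral_pushforward _ _ _ _ _ _ measurable_reflect leb setT F measurableT mF.
rewrite preimage_setT => <- //.
by apply: eq_measure_integral => A mA _; exact: lebesgue_measure_reflect.
Qed.

Lemma Rintegral_oppr F : measurable_fun setT F -> \int[leb]_t F (- t) = \int[leb]_t F t.
Proof.
move=> mF; rewrite /Rintegral; congr fine; rewrite integralE [RHS]integralE.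
have mE : measurable_fun setT (EFin \o F) by exact/measurable_EFinP.
have mp : measurable_fun setT (EFin \o F)^\+%E by exact: measurable_funepos.
have mn : measurable_fun setT (EFin \o F)^\-%E by exact: measurable_funeneg.
rewrite -(ge0_integral_oppr mp (funepos_ge0 _)) -(ge0_integral_oppr mn (funeneg_ge0 _)).
by congr (_ - _)%E; apply: eq_integral => t _; rewrite ?funeposE ?funenegE.
Qed.

Lemma integrable_oneDsqrV : leb.-integrable setT (EFin \o (fun t : R => (1 + t ^+ 2)^-1)).
Proof.
have mf : measurable_fun setT (fun t : R => ((1 + t ^+ 2)^-1)%:E : \bar R).
  by apply/measurable_EFinP; exact: continuous_measurable_fun (@continuous_oneDsqrV R).
have f0 t : (0 <= ((1 + t ^+ 2)^-1)%:E :> \bar R)%E.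
  by rewrite lee_fin invr_ge0 addr_ge0// sqr_ge0.
apply/integrableP; split => //.
under eq_integral do rewrite (gee0_abs (f0 _)).
have half : (\int[leb]_(t in `[0%R, +oo[) ((1 + t ^+ 2)^-1)%:E < +oo)%E.
  by rewrite integral0y_oneDsqr ltry.
have mD : measurable (`[0%R, +oo[%classic : set (measurableTypeR R)) by exact: measurable_itv.
rewrite -(setUv `[0%R, +oo[%classic) ge0_integral_setU//; last 3 first.
- exact: measurableC.
- by rewrite setUv.
- by apply/disj_setPS => t [].
apply: lte_add_pinfty => //; apply: le_lt_trans half.
rewrite (ge0_integration_by_substitution0 (f := fun t => ((1 + t ^+ 2)^-1)%:E))//.
under [leRHS]eq_integral do rewrite sqrrN.
apply: ge0_subset_integral => //; [exact: measurableC|exact: measurable_funTS|].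
by move=> t /=; rewrite !in_itv/= andbT => /negP; rewrite -ltNge => /ltW.
Qed.

Definition decays h := exists M, forall t, `|h t| <= M * (1 + t ^+ 2)^-1.

Lemma decays_integrable h : measurable_fun setT h -> decays h ->
  leb.-integrable setT (EFin \o h).
Proof.
move=> mh [M hM].
have iM := @integrableZl _ _ _ leb _ measurableT M _ integrable_oneDsqrV.
apply: (@le_integrable _ _ _ leb _ measurableT _ _ _ _ iM); first exact/measurable_EFinP.
by move=> t _; rewrite lee_fin (le_trans (hM t))// ler_norm.
Qed.

(** Integrable on the line although h(t) / t need not be. Both kinds of truncation are half its
    integral against an even indicator, hence have the same limit by dominated convergence. Its
    value at 0 is 0, by the convention on inverses. *)
Definition odd_quotient h t := (h t - h (- t)) / t.

Lemma odd_quotient0 h : odd_quotient h 0 = 0.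
Proof. by rewrite /odd_quotient invr0 mulr0. Qed.

Lemma odd_quotientN h t : odd_quotient h (- t) = odd_quotient h t.
Proof. by rewrite /odd_quotient opprK invrN mulrN -mulNr opprB. Qed.

Lemma measurable_odd_quotient h : measurable_fun setT h -> measurable_fun setT (odd_quotient h).
Proof.
move=> mh; apply: measurable_funM; last exact: measurable_invr.
by apply: measurable_funB => //; exact: (measurableT_comp mh measurable_reflect).
Qed.

(** For |t| <= d subtract v from both values of h and use the Lipschitz bound; beyond d use the
    decay of h and |t| >= d. *)
Lemma odd_quotient_decays h (v K d : R) : 0 < d -> decays h ->
  (forall t, `|t| <= d -> `|h t - v| <= K * `|t|) -> decays (odd_quotient h).
Proof.
move=> d0 [M hM] hK; exists (2 * `|K| * (1 + d ^+ 2) + 2 * `|M| / d) => t.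
have t2 : 0 < 1 + t ^+ 2 by have := sqr_ge0 t; lra.
have A0 : 0 <= 2 * `|K| * (1 + d ^+ 2).
  by rewrite !mulr_ge0//; have := sqr_ge0 d; lra.
have B0 : 0 <= 2 * `|M| / d by rewrite divr_ge0 ?mulr_ge0// ltW.
have [->|tn0] := eqVneq t 0.
  by rewrite odd_quotient0 normr0 mulr_ge0 ?addr_ge0// invr_ge0 expr0n addr0.
have nt : 0 < `|t| by rewrite normr_gt0.
rewrite /odd_quotient normrM normfV ler_pdivrMr// mulrAC ler_pdivlMr//.
have [td|dt] := leP `|t| d.
  have e1 := hK t td; have e2 := hK (- t).
  rewrite normrN in e2; have {}e2 := e2 td.
  have e3 : `|h t - h (- t)| <= 2 * `|K| * `|t|.
    have -> : h t - h (- t) = (h t - v) - (h (- t) - v) by ring.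
    apply: le_trans (ler_normB _ _) _.
    have := ler_wpM2r (ltW nt) (ler_norm K); lra.
  apply: le_trans (_ : 2 * `|K| * `|t| * (1 + d ^+ 2) <= _).
    apply: ler_pM => //; first exact: ltW.
    by rewrite lerD2l -(real_normK (num_real t)) lerXn2r ?nnegrE ?(ltW d0).
  rewrite [leRHS]mulrDl mulrAC lerDl mulr_ge0//.
have e1 := hM t; have e2 := hM (- t); rewrite sqrrN in e2.
have e3 : `|h t - h (- t)| <= 2 * `|M| / (1 + t ^+ 2).
  apply: le_trans (ler_normB _ _) _.
  have : M * (1 + t ^+ 2)^-1 <= `|M| * (1 + t ^+ 2)^-1 by rewrite ler_wpM2r ?ler_norm// invr_ge0 ltW.
  lra.
rewrite -ler_pdivlMr//; apply: le_trans e3 _; rewrite ler_wpM2r ?invr_ge0 ?(ltW t2)//.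
apply: le_trans (_ : 2 * `|M| / d * `|t| <= _).
  have h1 : 1 <= `|t| / d by rewrite ler_pdivlMr// mul1r ltW.
  have -> : 2 * `|M| / d * `|t| = 2 * `|M| * (`|t| / d) by ring.
  by rewrite ler_peMr// mulr_ge0.
by rewrite ler_wpM2r ?(ltW nt)// lerDr.
Qed.

Lemma measurable_away (e : R) : measurable (away e : set (measurableTypeR R)).
Proof.
have -> : away e = (`]e, +oo[ `|` `]-oo, (- e)[)%classic :> set R.
  apply/seteqP; split => t; rewrite /away /= !in_itv/= andbT real_ltr_normr ?num_real//.
    by move=> /orP[|h]; [left|right; rewrite ltrNr].
  by move=> [->//|h]; apply/orP; right; rewrite ltrNr.
by apply: measurableU; exact: measurable_itv.
Qed.

Lemma away_integrable h (e : R) : 0 < e -> measurable_fun setT h -> decays h ->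
  leb.-integrable (away e) (EFin \o (fun t => h t / t)).
Proof.
move=> e0 mh dh; have ih := decays_integrable mh dh.
have ma := measurable_away e.
have i1 : leb.-integrable (away e) (EFin \o h) by exact: integrableS ih.
have i2 := @integrableZl _ _ _ leb _ ma e^-1 _ i1.
apply: (@le_integrable _ _ _ leb _ ma _ _ _ _ i2).
  apply/measurable_EFinP; apply: measurable_funTS.
  by apply: measurable_funM => //; exact: measurable_invr.
move=> t /= et; have nt : 0 < `|t| by exact: lt_trans et.
by rewrite lee_fin !normrM mulrC ler_wpM2r// !normfV (gtr0_norm e0) lef_pV2 ?posrE// ltW.
Qed.

Lemma indic_even (A : set R) t : (forall s, A s -> A (- s)) -> \1_A (- t) = \1_A t :> R.
Proof.
move=> AN; rewrite !indicE; congr (_%:R : R); congr nat_of_bool.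
apply/idP/idP; rewrite !inE => h; last exact: AN.
by rewrite -(opprK t); exact: AN.
Qed.

Lemma Rintegral_indic (A : set (measurableTypeR R)) F :
  \int[leb]_(t in A) F t = \int[leb]_t (F t * \1_A t).
Proof.
rewrite Rintegral_mkcond; apply: eq_Rintegral => t _.
by rewrite patchE indicE; case: (_ \in _); rewrite ?mulr1 ?mulr0.
Qed.

Lemma integrable_indic (A : set (measurableTypeR R)) F : measurable A ->
  leb.-integrable A (EFin \o F) -> leb.-integrable setT (EFin \o (fun t => F t * \1_A t)).
Proof.
move=> mA /(integrable_mkcond _ mA).1; apply: eq_integrable => // t _.
by rewrite patchE /= indicE; case: (_ \in _); rewrite ?mulr1 ?mulr0.
Qed.

Lemma Rintegral_sym F : leb.-integrable setT (EFin \o F) ->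
  \int[leb]_t (F t + F (- t)) = 2 * \int[leb]_t F t.
Proof.
move=> iF; have mF := integrable_measurable iF.
have mFN : measurable_fun setT (fun t => F (- t)) by exact: (measurableT_comp mF measurable_reflect).
have iFN : leb.-integrable setT (EFin \o (fun t => F (- t))).
  have /integrableP[_ f1] := iF; apply/integrableP; split; first exact/measurable_EFinP.
  rewrite (ge0_integral_oppr (F := fun t => `|(F t)%:E|%E))//.
  by apply: measurableT_comp => //; exact/measurable_EFinP.
by rewrite RintegralD// Rintegral_oppr//; ring.
Qed.

Lemma Rintegral_away h (e : R) : 0 < e -> measurable_fun setT h -> decays h ->
  \int[leb]_(t in away e) (h t / t) = 2^-1 * \int[leb]_t (odd_quotient h t * \1_(away e) t).
Proof.
move=> e0 mh dh; have ma := measurable_away e.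
pose F t := h t / t * \1_(away e) t.
have iF : leb.-integrable setT (EFin \o F) by apply: integrable_indic => //; exact: away_integrable.
rewrite Rintegral_indic -/F; have n2 : (2 : R) != 0 by rewrite pnatr_eq0.
apply: (mulfI n2); rewrite mulrA mulfV// mul1r.
have -> : \int[leb]_t (odd_quotient h t * \1_(away e) t) = \int[leb]_t (F t + F (- t)).
  apply: eq_Rintegral => t _; rewrite /F indic_even; last by move=> s; rewrite /away /= normrN.
  by rewrite /odd_quotient invrN; ring.
exact/esym/Rintegral_sym.
Qed.

Lemma Rintegral_odd_segment h (a b : R) : 0 < a -> measurable_fun setT (odd_quotient h) ->
  leb.-integrable setT (EFin \o odd_quotient h) ->
  \int[leb]_(t in `[a, b]) ((h t - h (- t)) / t) =
  2^-1 * \int[leb]_t (odd_quotient h t * \1_[set t | a <= `|t| <= b] t).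
Proof.
move=> a0 mo io.
have mab : measurable (`[a, b]%classic : set (measurableTypeR R)) by exact: measurable_itv.
pose F t := odd_quotient h t * \1_(`[a, b]%classic) t.
have iF : leb.-integrable setT (EFin \o F).
  by apply: integrable_indic => //; exact: integrableS io.
rewrite Rintegral_indic -/F; have n2 : (2 : R) != 0 by rewrite pnatr_eq0.
apply: (mulfI n2); rewrite mulrA mulfV// mul1r.
have -> : \int[leb]_t (odd_quotient h t * \1_[set t | a <= `|t| <= b] t) = \int[leb]_t (F t + F (- t)).
  apply: eq_Rintegral => t _; rewrite /F odd_quotientN -mulrDr; congr (_ * _).
  rewrite !indicE -natrD; congr (_%:R : R).
  have -> : (t \in [set s | a <= `|s| <= b]) = (a <= `|t| <= b) by apply/idP/idP; rewrite inE.
  rewrite !mem_setE !in_itv/=; have [t0|t0] := leP 0 t.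
    rewrite ger0_norm// (_ : (a <= - t) = false) ?addn0//.
    by apply/negbTE; rewrite -ltNge; lra.
  rewrite ltr0_norm// (_ : (a <= t) = false) ?add0n//.
  by apply/negbTE; rewrite -ltNge; lra.
exact/esym/Rintegral_sym.
Qed.

Section Limits.
Variables (h : R -> R) (v K d : R).
Hypotheses (mh : measurable_fun setT h) (dh : decays h) (d0 : 0 < d).
Hypothesis hK : forall t, `|t| <= d -> `|h t - v| <= K * `|t|.

Let mo : measurable_fun setT (odd_quotient h).
Proof. exact: measurable_odd_quotient. Qed.

Let io : leb.-integrable setT (EFin \o odd_quotient h).
Proof. exact: decays_integrable mo (odd_quotient_decays d0 dh hK). Qed.

Lemma odd_quotient_mask_cvg (A : nat -> set (measurableTypeR R)) :
  (forall n, measurable (A n)) -> (forall t, t != 0 -> \forall n \near \oo, A n t) ->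
  2^-1 * (\int[leb]_t (odd_quotient h t * \1_(A n) t)) @[n --> \oo] -->
  2^-1 * \int[leb]_t odd_quotient h t.
Proof.
move=> mA At; apply: cvgMr.
have m1 n : measurable_fun setT (\1_(A n) : R -> R) by exact: (measurable_indic (mA n)).
apply: (@mask_cvg _ _ _ leb (odd_quotient h) (fun n => \1_(A n)) io m1) => [n t|t].
  by rewrite indicE; case: (_ \in _); rewrite ?normr0 ?normr1.
have [->|t0] := eqVneq t 0.
  by rewrite odd_quotient0; under eq_fun do rewrite mul0r; exact: cvg_cst.
apply: cvg_near_cst; apply: filterS (At t t0) => n An.
by rewrite indicE mem_set// mulr1.
Qed.

Lemma away_cvg :
  \int[leb]_(t in away e) (h t / t) @[e --> 0^'+] --> 2^-1 * \int[leb]_t odd_quotient h t.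
Proof.
apply/cvg_at_rightP => u [u0 uc].
under eq_fun do rewrite Rintegral_away//.
apply: (@odd_quotient_mask_cvg (fun n => away (u n))) => [n|t t0]; first exact: measurable_away.
have nt : 0 < `|t| by rewrite normr_gt0.
move/cvgrPdist_lt : uc => /(_ _ nt); apply: filterS => n.
by rewrite sub0r normrN; apply: le_lt_trans; exact: ler_norm.
Qed.

Lemma dyadic_cvg :
  \int[leb]_(t in `[4 ^- n, 4 ^+ n]) ((h t - h (- t)) / t) @[n --> \oo] -->
  2^-1 * \int[leb]_t odd_quotient h t.
Proof.
have p4 n : 0 < (4 : R) ^- n by rewrite invr_gt0 exprn_gt0.
under eq_fun do rewrite Rintegral_odd_segment//.
apply: (@odd_quotient_mask_cvg (fun n => [set t | 4 ^- n <= `|t| <= 4 ^+ n])) => [n|t t0].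
  have mn : measurable_fun setT (fun t : R => `|t|) by exact: measurableT_comp.
  have mi : measurable (`[4 ^- n, 4 ^+ n]%classic : set (measurableTypeR R)) by exact: measurable_itv.
  have := mn measurableT _ mi; rewrite setTI.
  by congr measurable; apply/seteqP; split => t /=; rewrite in_itv.
have nt : 0 < `|t| by rewrite normr_gt0.
have c1 : (4 : R) ^- n @[n --> \oo] --> (0 : R).
  under eq_fun do rewrite -exprVn.
  by apply: cvg_expr; rewrite ger0_norm; lra.
have nt' : 0 < `|t|^-1 by rewrite invr_gt0.
move/cvgrPdist_lt : c1 => c1; near=> n.
have h1 : `|0 - (4 : R) ^- n| < `|t| by near: n; exact: c1.
have h2 : `|0 - (4 : R) ^- n| < `|t|^-1 by near: n; exact: c1.
move: h1 h2; rewrite sub0r normrN ger0_norm ?(ltW (p4 _))// => h1 h2.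
rewrite /= (ltW h1) /=; move: h2; rewrite ltf_pV2 ?posrE ?exprn_gt0//; exact: ltW.
Unshelve. all: by end_near. Qed.

End Limits.

End PrincipalValue.

(** * Schwartz functions *)

Section PlaneFunctions.
Variable R : realType.
Notation leb := (@lebesgue_measure R).
Notation mu := (mu2 R).
Implicit Types (u : R * R -> R) (p : R * R) (x y t M : R).

(* [u] is the pointwise limit of the functions obtained by rounding the second
   coordinate, which are measurable because they have countably many slices. *)
Lemma continuous_measurable_plane u : continuous u -> measurable_fun setT u.
Proof.
move=> cu; pose r n y : R := (Num.floor (n.+1%:R * y))%:~R / n.+1%:R.
pose v n p := u (p.1, r n p.2).
have vu p : v ^~ p @ \oo --> u p.
  have rc : r n p.2 @[n --> \oo] --> p.2.
    apply/cvgrPdist_le => e e0; near=> n.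
    have n0 : 0 < n.+1%:R :> R by rewrite ltr0n.
    have /andP[f1 f2] := floor_itv (n.+1%:R * p.2).
    rewrite intrD in f2.
    have -> : p.2 - r n p.2 = (n.+1%:R * p.2 - (Num.floor (n.+1%:R * p.2))%:~R) / n.+1%:R.
      by rewrite /r mulrBl mulrAC mulfV ?mul1r// gt_eqF.
    rewrite ger0_norm; last by rewrite divr_ge0 ?subr_ge0// ltW.
    rewrite ler_pdivrMr//; apply: le_trans (_ : 1 <= _); first by lra.
    rewrite -ler_pdivrMl// mulr1; apply: (@le_trans _ _ n%:R); last by rewrite ler_nat.
    by near: n; exact: nbhs_infty_ger.
  have c : (fun n => (p.1, r n p.2)) @ \oo --> p.
    by apply: (@cvg_pair _ _ _ \oo (nbhs p.1) (nbhs p.2)) => //; exact: cvg_cst.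
  exact: cvg_comp c (cu p).
have mv n : measurable_fun setT (v n).
  have n0 : 0 < n.+1%:R :> R by rewrite ltr0n.
  move=> _ B mB; rewrite setTI.
  pose s (k : int) : set (measurableTypeR R) := `[k%:~R / n.+1%:R, (k + 1)%:~R / n.+1%:R[%classic.
  have -> : v n @^-1` B =
      \bigcup_(k in [set: int]) (((fun x => u (x, k%:~R / n.+1%:R)) @^-1` B) `*` s k).
    apply/seteqP; split => [[x y] /= Bv|[x y] [k _] [/= Bx]].
      exists (Num.floor (n.+1%:R * y)) => //; split => //=.
      rewrite /s /= in_itv/= ler_pdivrMr// ltr_pdivlMr//.
      by have /andP[f1 f2] := floor_itv (n.+1%:R * y); rewrite ![y * _]mulrC f1.
    rewrite /s /= in_itv/= ler_pdivrMr// ltr_pdivlMr// => /andP[k1 k2].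
    rewrite /v /r /= (_ : Num.floor (n.+1%:R * y) = k)//.
    by apply: floor_def; rewrite ![_ * y]mulrC k1.
  apply: countable_bigcupT_measurable => // k; apply: measurableX; last exact: measurable_itv.
  have cs : continuous (fun x => u (x, k%:~R / n.+1%:R)).
    move=> x; pose y : R := k%:~R / n.+1%:R.
    have c : (fun x => (x, y)) @ x --> (x, y); last exact: cvg_comp c (cu _).
    by apply: (@cvg_pair R R R (nbhs x) (nbhs x) (nbhs y)); [exact: cvg_id|exact: cvg_cst].
  by have := continuous_measurable_fun cs measurableT mB; rewrite setTI.
by apply: (measurable_fun_cvg mv) => p _; exact: vu.
Unshelve. all: by end_near. Qed.

Definition plane_decays u := exists M, forall x y,
  (1 + x ^+ 2) * (1 + y ^+ 2) * `|u (x, y)| <= M.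

Lemma plane_decays_L2r u : measurable_fun setT u -> plane_decays u -> L2r u.
Proof.
move=> mu_ [M uM]; split => //.
pose a x : R := (1 + x ^+ 2)^-1.
have a0 x : 0 < 1 + x ^+ 2 by have := sqr_ge0 x; lra.
have a1 x : 0 < a x by rewrite invr_gt0.
have ale1 x : a x <= 1 by rewrite invf_le1// lerDl sqr_ge0.
have ma : measurable_fun [set: R] a.
  exact: continuous_measurable_fun (@continuous_oneDsqrV R).
have ia : leb.-integrable setT (EFin \o a) := integrable_oneDsqrV R.
pose w p : \bar R := (a p.1 * a p.2)%:E.
have mw : measurable_fun setT w.
  apply/measurable_EFinP; apply: measurable_funM.
    exact: (measurableT_comp ma measurable_fst).
  exact: (measurableT_comp ma measurable_snd).
have w0 p : (0 <= w p)%E by rewrite lee_fin mulr_ge0// ltW.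
apply: (@le_lt_trans _ _ (\int[mu]_p ((M ^+ 2)%:E * w p))%E).
  apply: ge0_le_integral => //.
  - by move=> p _; rewrite lee_fin sqr_ge0.
  - exact: measurable_sq.
  - exact: measurable_funeM.
  - move=> [x y] _; rewrite /w -EFinM lee_fin /=.
    have h : `|u (x, y)| <= M * (a x * a y).
      rewrite -invfM ler_pdivlMr ?mulr_gt0// mulrC; exact: uM.
    rewrite -(real_normK (num_real (u (x, y)))).
    apply: (@le_trans _ _ ((M * (a x * a y)) ^+ 2)).
      by rewrite lerXn2r ?nnegrE// (le_trans _ h).
    rewrite exprMn ler_wpM2l ?sqr_ge0// expr2 ler_piMl ?mulr_ge0 ?(ltW (a1 _))//.
    by rewrite mulr_ile1// ltW.
rewrite ge0_integralZl//; last by rewrite lee_fin sqr_ge0.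
rewrite lte_mul_pinfty ?lee_fin ?sqr_ge0//.
rewrite fubini_tonelli1//= /fubini_F.
have I1 : (\int[leb]_x (a x)%:E < +oo)%E.
  have /integrableP[_] := ia; congr (_ < _)%E; apply: eq_integral => x _ /=.
  by rewrite ger0_norm// ltW.
have I0 : (0 <= \int[leb]_x (a x)%:E)%E by apply: integral_ge0 => x _; rewrite lee_fin ltW.
have E x : (\int[leb]_y w (x, y) = (\int[leb]_y (a y)%:E) * (a x)%:E)%E.
  rewrite muleC -ge0_integralZl//.
  - exact/measurable_EFinP.
  - by move=> y _; rewrite lee_fin ltW.
  - by rewrite lee_fin ltW.
under eq_integral do rewrite E.
rewrite ge0_integralZl//.
- by rewrite lte_mul_pinfty// ge0_fin_numE.
- exact/measurable_EFinP.
- by move=> y _; rewrite lee_fin ltW.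
Qed.

Variable q : {poly R}.
Hypothesis q0 : q.[0] = 0.

(** The decay comes from the first coordinate x - t, through 1 + t^2 <= 2 (1 + x^2) (1 + (x -
    t)^2). *)
Lemma curve_decays u p : plane_decays u -> decays (fun t => u (shift_curve q t p)).
Proof.
move=> [M uM]; exists (2 * (1 + p.1 ^+ 2) * M) => t; rewrite /shift_curve.
have t0 : 0 < 1 + t ^+ 2 by have := sqr_ge0 t; lra.
have x0 : 0 < 1 + p.1 ^+ 2 by have := sqr_ge0 p.1; lra.
have s0 : 0 < 1 + (p.1 - t) ^+ 2 by have := sqr_ge0 (p.1 - t); lra.
have M0 : 0 <= M.
  apply: le_trans (uM 0 0); rewrite expr0n addr0 mulr1 mul1r//.
have h : (1 + (p.1 - t) ^+ 2) * `|u (p.1 - t, p.2 - q.[t])| <= M.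
  apply: le_trans (uM (p.1 - t) (p.2 - q.[t])).
  by rewrite ler_wpM2r// ler_peMr ?(ltW s0)// lerDl sqr_ge0.
have k : 1 + t ^+ 2 <= 2 * (1 + p.1 ^+ 2) * (1 + (p.1 - t) ^+ 2).
  have := sqr_ge0 (2 * p.1 - t); have := sqr_ge0 (p.1 * (p.1 - t)); nra.
rewrite ler_pdivlMr//.
apply: le_trans (_ : 2 * (1 + p.1 ^+ 2) * ((1 + (p.1 - t) ^+ 2) * `|u (p.1 - t, p.2 - q.[t])|) <= _).
  by rewrite mulrA mulrC ler_wpM2r.
by rewrite ler_wpM2l// mulr_ge0// ltW.
Qed.

(** The curve is at p for t = 0 because q(0) = 0, and a function differentiable at 0 is Lipschitz
    there with respect to its value at 0. *)
Lemma curve_lipschitz u p : differentiable u p -> exists K d, 0 < d /\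
  forall t, `|t| <= d -> `|u (shift_curve q t p) - u p| <= K * `|t|.
Proof.
move=> du; pose g t : R := u (shift_curve q t p).
have c0 : shift_curve q 0 p = p by rewrite /shift_curve q0 !subr0 -surjective_pairing.
have dc : differentiable (fun t => shift_curve q t p) (0 : R).
  apply: differentiable_pair.
    by apply: differentiableB => //.
  apply: differentiableB => //.
  by apply/derivable1_diffP; exact: derivable_horner.
have dg : derivable g (0 : R) 1.
  by apply/derivable1_diffP; apply: differentiable_comp => //; rewrite c0.
have := dg; rewrite /derivable /=; set l := lim _.
move=> /cvgrPdist_le /(_ 1 ltr01) [d /= d0 Hd].
exists (`|l| + 1), (d / 2); split; first by rewrite divr_gt0.
move=> t td; have [->|t0] := eqVneq t 0; first by rewrite c0 subrr normr0 mulr0.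
have := Hd t; rewrite /= sub0r normrN => /(_ _ t0).
have td' : `|t| < d by lra.
move=> /(_ td'); rewrite scaler1 addr0 /g /= c0 => H.
have nt : 0 < `|t| by rewrite normr_gt0.
rewrite -ler_pdivrMr// mulrC -normfV -normrM.
set a := t^-1 * _; have -> : a = l - (l - a) by ring.
by apply: le_trans (ler_normB _ _) _; rewrite lerD2l.
Qed.

End PlaneFunctions.

Section Schwartz.
Variable R : realType.
Notation leb := (@lebesgue_measure R).
Notation mu := (mu2 R).
Implicit Types (f : R * R -> R[i]) (u : R * R -> R).

Definition tame u := (forall p, differentiable u p) /\ plane_decays u.

Lemma normc_ge (z : R[i]) : `|complex.Re z| <= Normc.normc z /\ `|complex.Im z| <= Normc.normc z.
Proof.
case: z => a b /=; rewrite -!sqrtr_sqr !ler_sqrt ?addr_ge0 ?sqr_ge0//.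
by rewrite lerDl lerDr !sqr_ge0.
Qed.

Lemma schwartz_tame f : schwartz f -> tame (re_part f) /\ tame (im_part f).
Proof.
move=> [sm de].
(* The weight (1 + x^2) (1 + y^2) expands into four of the Schwartz weights, with no derivative. *)
have [M00 H00] := de 0%N 0%N [::]; have [M20 H20] := de 2%N 0%N [::].
have [M02 H02] := de 0%N 2%N [::]; have [M22 H22] := de 2%N 2%N [::].
have H x y : (1 + x ^+ 2) * (1 + y ^+ 2) * Normc.normc (f (x, y)) <= M00 + M20 + M02 + M22.
  have := H00 x y; have := H20 x y; have := H02 x y; have := H22 x y.
  have E (z : R) : `|z ^+ 2| = z ^+ 2 by rewrite ger0_norm// sqr_ge0.
  rewrite !expr0 !mul1r !mulr1 normr1 !mul1r (ger0_norm (mulr_ge0 (sqr_ge0 x) (sqr_ge0 y))) !E /=; lra.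
have w x y : 0 <= (1 + x ^+ 2) * (1 + y ^+ 2) :> R by rewrite mulr_ge0// addr_ge0// sqr_ge0.
split; split=> [p|]; [exact: (sm [::] p).1| |exact: (sm [::] p).2|].
  exists (M00 + M20 + M02 + M22) => x y; apply: le_trans (H x y).
  by rewrite ler_wpM2l//; exact: (normc_ge _).1.
exists (M00 + M20 + M02 + M22) => x y; apply: le_trans (H x y).
by rewrite ler_wpM2l//; exact: (normc_ge _).2.
Qed.

Lemma tame_measurable u : tame u -> measurable_fun setT u.
Proof. by move=> [du _]; apply: continuous_measurable_plane => p; exact: differentiable_continuous. Qed.

Lemma tame_L2r u : tame u -> L2r u.
Proof. by move=> tu; apply: plane_decays_L2r; [exact: tame_measurable|exact: tu.2]. Qed.

Variable q : {poly R}.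
Hypothesis q0 : q.[0] = 0.

Definition pv u p : R := 2^-1 * \int[leb]_t odd_quotient (fun t => u (shift_curve q t p)) t.

Lemma measurable_along_curve u p : tame u -> measurable_fun setT (fun t => u (shift_curve q t p)).
Proof.
move=> tu; exact: (measurableT_comp (tame_measurable tu) (measurable_fun_pair2 p (measurable_shift_curve q))).
Qed.

Lemma tame_away u p : tame u ->
  (forall e, 0 < e -> leb.-integrable (away e) (EFin \o (fun t => u (shift_curve q t p) / t))) /\
  \int[leb]_(t in away e) (u (shift_curve q t p) / t) @[e --> 0^'+] --> pv u p.
Proof.
move=> tu; have mh := measurable_along_curve p tu; have dh := curve_decays q p tu.2.
split=> [e e0|]; first exact: away_integrable.
have [K [d [d0 hK]]] := curve_lipschitz q0 (tu.1 p).
exact: away_cvg mh dh d0 hK.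
Qed.

Lemma tame_dyadic u p : tame u -> dyadic_trunc q n u p @[n --> \oo] --> pv u p.
Proof.
move=> tu; have mh := measurable_along_curve p tu; have dh := curve_decays q p tu.2.
have [K [d [d0 hK]]] := curve_lipschitz q0 (tu.1 p).
exact: dyadic_cvg mh dh d0 hK.
Qed.

Variable Q : R -> R.
Hypothesis Qq : forall t, Q t = q.[t].

Lemma re_im_integrand f x y t :
  complex.Re (hilbert_integrand Q f x y t) = re_part f (shift_curve q t (x, y)) / t /\
  complex.Im (hilbert_integrand Q f x y t) = im_part f (shift_curve q t (x, y)) / t.
Proof.
rewrite /hilbert_integrand -(fmorphV (real_complex R)) /re_part /im_part /shift_curve /= Qq.
by case: (f _) => a b /=; rewrite !mulr0 subr0 add0r.
Qed.

Lemma truncated_reE f x y e : truncated_re Q f x y e =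
  \int[leb]_(t in away e) (re_part f (shift_curve q t (x, y)) / t).
Proof. by apply: eq_Rintegral => t _; exact: (re_im_integrand f x y t).1. Qed.

Lemma truncated_imE f x y e : truncated_im Q f x y e =
  \int[leb]_(t in away e) (im_part f (shift_curve q t (x, y)) / t).
Proof. by apply: eq_Rintegral => t _; exact: (re_im_integrand f x y t).2. Qed.

Lemma truncated_cvg f p : schwartz f ->
  truncated_re Q f p.1 p.2 e @[e --> 0^'+] --> pv (re_part f) p /\
  truncated_im Q f p.1 p.2 e @[e --> 0^'+] --> pv (im_part f) p.
Proof.
case: p => x y /schwartz_tame[tr ti]; split.
  under eq_fun do rewrite truncated_reE; exact: (tame_away (x, y) tr).2.
under eq_fun do rewrite truncated_imE; exact: (tame_away (x, y) ti).2.
Qed.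

Lemma schwartz_hilbert_defined f x y : schwartz f -> hilbert_defined Q f x y.
Proof.
move=> sf; have [c1 c2] := truncated_cvg (x, y) sf; have [tr ti] := schwartz_tame sf.
split; [|by apply/cvg_ex; eexists; exact: c1|by apply/cvg_ex; eexists; exact: c2].
move=> e e0; have i1 := (tame_away (x, y) tr).1 e e0; have i2 := (tame_away (x, y) ti).1 e e0.
split.
  move: i1; congr (_.-integrable _ _); apply/funext => t /=.
  by rewrite (re_im_integrand f x y t).1.
move: i2; congr (_.-integrable _ _); apply/funext => t /=.
by rewrite (re_im_integrand f x y t).2.
Qed.

Lemma hilbertE f p : schwartz f ->
  hilbert Q f p = ((pv (re_part f) p) +i* (pv (im_part f) p))%C.
Proof.
move=> sf; have [c1 c2] := truncated_cvg p sf.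
by rewrite /hilbert (cvg_lim (@Rhausdorff R) c1) (cvg_lim (@Rhausdorff R) c2).
Qed.

Variable C : R.
Hypothesis C0 : 0 <= C.
Hypothesis truncC : forall a b (f : R * R -> R), 0 < a -> a <= b -> L2r f ->
  (sqint mu setT (trunc q a b f) <= C%:E * sqint mu setT f)%E.

(** The dyadic truncations converge to the left side in square mean and to the right side
    pointwise. *)
Lemma real_transform_tame u : tame u -> {ae mu, forall p, real_transform q u p = pv u p}.
Proof.
move=> tu; have Lu := tame_L2r tu.
have [mH lH] := real_transformP q0 C0 truncC Lu.
have mT n : measurable_fun setT (dyadic_trunc q n u).
  by apply: measurable_dyadic_trunc; exact: Lu.1.
have pT p : (fun n => dyadic_trunc q n u) ^~ p @ \oo --> pv u p by exact: tame_dyadic.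
have := @L2lim_pointwise_unique _ _ _ mu (fun n => dyadic_trunc q n u) _ (pv u) mT mH lH pT.
exact.
Qed.

Lemma complex_transform_hilbert f : schwartz f ->
  ae_eq mu setT (complex_transform q f) (hilbert Q f).
Proof.
move=> sf; have [tr ti] := schwartz_tame sf.
apply: (ae_imp2 (real_transform_tame tr) (real_transform_tame ti)) => p i1 i2 _.
by rewrite hilbertE// /complex_transform i1 i2.
Qed.

End Schwartz.

Theorem corollary1p2 (R : realType) (d : nat) (hd : (1 <= d)%N) :
  exists C : R, forall (a : 'I_d -> R) (alpha : 'I_d -> nat),
    (forall i, (0 < alpha i)%N) ->
    let Q := sparse_poly a alpha in
    (forall f : R * R -> R[i], schwartz f ->
       forall x y : R, hilbert_defined Q f x y) /\
    exists T : (R * R -> R[i]) -> (R * R -> R[i]),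
      [/\ L2_operator T,
          forall f, schwartz f -> ae_eq (mu2 R) setT (T f) (hilbert Q f)
        & forall f, L2 f -> (norm2 (T f) <= C%:E * norm2 f)%E].
Proof.
(* One monomial more than in [Q]: the phase of a character along the curve also has a linear
   term. *)
have [B B0 oscB] := @osc_sym_bound R d.+1.
(* For squares: 2 B^2 on trigonometric polynomials, 8 B^2 for truncations on the plane, and twice
   that for their limit. *)
exists (Num.sqrt (2 * (8 * B ^+ 2))) => a alpha alpha0 Q.
pose q : {poly R} := \sum_(i < d) a i *: 'X^(alpha i).
have Qq t : Q t = q.[t].
  by rewrite horner_sum; apply: eq_bigr => i _; rewrite hornerZ hornerXn.
(* Positive exponents make the curve pass through the origin, as the small shells and the principal
   value require. *)
have q0 : q.[0] = 0.
  by rewrite -Qq /Q /sparse_poly big1// => i _; rewrite expr0n (gtn_eqF (alpha0 i)) mulr0.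
have sq : sparse d ('X * q^`()).
  exists [seq alpha i | i <- enum 'I_d]; first by rewrite size_map size_enum_ord.
  move=> n; rewrite coefXM; case: n => [|n]; first by rewrite /= eqxx.
  rewrite /= coef_deriv coef_sum; apply: contraNT => nal.
  rewrite big1 ?mul0rn// => i _; rewrite coefZ coefXn.
  case: eqP => [e|_]; last by rewrite mulr0.
  by move: nal; rewrite e map_f// mem_enum.
have C0 : 0 <= 8 * B ^+ 2 by rewrite mulr_ge0// sqr_ge0.
have truncC u v (f : R * R -> R) : 0 < u -> u <= v -> L2r f ->
    (sqint (mu2 R) setT (trunc q u v f) <= (8 * B ^+ 2)%:E * sqint (mu2 R) setT f)%E.
  by move=> u0 uv Lf; exact: (sqint_trunc_bound sq).
split=> [f sf x y|]; first exact: (schwartz_hilbert_defined q0 Qq).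
exists (complex_transform q); split.
- exact: (complex_transform_operator q0 C0 truncC).
- by move=> f sf; exact: (complex_transform_hilbert q0 Qq C0 truncC).
- by move=> f Lf; exact: (complex_transform_bound q0 C0 truncC).
Qed.
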